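(* Let $\beta>1$ and, for each $n\ge 1$, let $\{m_n(t)\}_{t\ge 0}$ be the Curie-Weiss empirical magnetization process at inverse temperature $\beta$, i.e. the Markov process on $E_n=\{-1,-1+\tfrac2n,\dots,1-\tfrac2n,1\}$ with generator $$\mathcal{A}_nf(x) = n \frac{1-x}{2} e^{\beta x} \left[f\left(x + \tfrac{2}{n}\right) - f(x)\right] + n \frac{1+x}{2} e^{-\beta x} \left[f\left(x - \tfrac{2}{n}\right) - f(x)\right].$$ Put $G_{1,\beta}(x) = \cosh(\beta x) - x \sinh(\beta x)$ and $G_{2,\beta}(x) = \sinh(\beta x) - x \cosh(\beta x)$, and let $m\in\{-m_\beta,+m_\beta\}$ be a non-zero solution of $G_{2,\beta}(x) = 0$. Let $\{b_n\}_{n\geq 1}$ be a sequence of positive real numbers such that $b_n \to \infty$ and $b_n^{2} n^{-1} \to 0$. Suppose that $b_n (m_n(0) - m)$ satisfies the large deviation principle with speed $n b_n^{-2}$ on $\mathbb{R}$ with rate function $I_0$. Then the trajectories $\left\{b_n (m_n(t) - m)\right\}_{t \geq 0}$ satisfy the large deviation principle on $D_{\mathbb{R}}(\mathbb{R}^+)$ with speed $n b_n^{-2}$ and good rate function $$I(\gamma) = \begin{cases} I_0(\gamma(0)) + \int_0^\infty \mathcal{L} (\gamma(s),\dot{\gamma}(s)) \,\mathrm{d}s & \text{if } \gamma \in \mathcal{AC}, \\ \infty & \text{otherwise},\end{cases}$$ where $$\mathcal{L}(x,v) = \frac{(v-2xG_{2,\beta}'(m))^2}{8 G_{1,\beta}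(m)}.$$
   Context: For $\beta>1$ the equation $G_{2,\beta}(x)=0$ has exactly the solutions $0$ and $\pm m_\beta$, with $m_\beta>0$. $D_{\mathbb{R}}(\mathbb{R}^+)$ is the Skorohod space of càdlàg functions $\mathbb{R}^+=[0,\infty)\to\mathbb{R}$. $\mathcal{AC}$ is the set of absolutely continuous curves $\gamma:\mathbb{R}^+\to\mathbb{R}$: for every $T\ge 0$ there is $g\in L^1[0,T]$ with $\gamma(t)=\gamma(0)+\int_0^t g(s)\,\mathrm{d}s$ for $t\in[0,T]$; one writes $\dot\gamma=g$. For random variables $X_1,X_2,\dots$ on a Polish space $F$, a function $I:F\to[0,\infty]$ is a good rate function if $\{x : I(x)\le c\}$ is compact for every $c\ge 0$. The sequence $\{X_n\}$ satisfies the large deviation principle with speed (rate) $r(n)$ and good rate function $I$ if for every closed $A\subseteq F$, $\limsup_{n} \frac{1}{r(n)}\log \mathbb{P}[X_n\in A]\le -\inf_{x\in A} I(x)$, and for every open $U\subseteq F$, $\liminf_{n} \frac{1}{r(n)}\log \mathbb{P}[X_n\in U]\ge -\inf_{x\in U} I(x)$. The rate function $I_0$ is a good rate function in this sense. *)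

(* Defs.v *)
From HB Require Import structures.
From mathcomp Require Import all_boot all_order all_algebra.
From mathcomp Require Import all_classical all_reals all_analysis.
Set Implicit Arguments.
Unset Strict Implicit.
Unset Printing Implicit Defensive.
Import Order.TTheory GRing.Theory Num.Theory.
Import numFieldNormedType.Exports.
Local Open Scope classical_set_scope.
Local Open Scope ring_scope.

(* The space D_R(R^+).  A path on [0, +oo[ is represented by its extension to R
   that is constant on negative times, so that two elements are equal iff they
   agree on [0, +oo[. *)
Record skorohod (R : realType) := Skorohod {
  path :> R -> R ;
  path_neg : forall t, t < 0 -> path t = path 0 ;
  path_right_cont : forall t, 0 <= t -> path s @[s --> t^'+] --> path t ;
  path_left_lim : forall t, 0 < t -> cvg (path s @[s --> t^'-]) }.

HB.instance Definition _ (R : realType) := gen_eqMixin (skorohod R).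
HB.instance Definition _ (R : realType) := gen_choiceMixin (skorohod R).

Section skorohod_topology.
Context {R : realType}.

(* Increasing bijections of [0, +oo[; the values at negative times are
   irrelevant. *)
Definition time_change (l : R -> R) :=
  set_bij `[0, +oo[ `[0, +oo[ l /\ forall s t, 0 <= s -> s < t -> l s < l t.

Definition skorohod_nbhd (T e : R) (x : skorohod R) : set (skorohod R) :=
  [set y : skorohod R | exists2 l, time_change l &
    forall t, 0 <= t <= T -> `|l t - t| < e /\ `|y t - x (l t)| < e].

(* Skorohod's J1 topology: x_k converges to x iff for every T there are time
   changes l_k such that l_k(t) - t and x_k(t) - x(l_k(t)) tend to 0 uniformly
   on [0, T] (Ethier & Kurtz, Markov Processes, Proposition 3.5.3(c)). *)
Definition skorohod_open (U : set (skorohod R)) :=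
  forall x, U x -> exists T e, 0 < e /\ skorohod_nbhd T e x `<=` U.

Lemma skorohod_nbhdS (T T' e e' : R) (x : skorohod R) :
  T' <= T -> e <= e' -> skorohod_nbhd T e x `<=` skorohod_nbhd T' e' x.
Proof.
move=> TT ee y [l ltc H]; exists l => // t /andP[t0 tT].
have [|h1 h2] := H t; first by rewrite t0 (le_trans tT TT).
by split; [exact: lt_le_trans h1 ee|exact: lt_le_trans h2 ee].
Qed.

Lemma skorohod_openT : skorohod_open setT.
Proof. by move=> x _; exists 0, 1; split. Qed.

Lemma skorohod_openI : setI_closed skorohod_open.
Proof.
move=> A B oA oB x [Ax Bx].
have [T1 [e1 [e10 s1]]] := oA x Ax; have [T2 [e2 [e20 s2]]] := oB x Bx.
exists (Num.max T1 T2), (Num.min e1 e2); split; first by rewrite lt_min e10.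
move=> y xy; split.
  by apply: s1; apply: skorohod_nbhdS xy; rewrite ?le_max ?ge_min lexx.
by apply: s2; apply: skorohod_nbhdS xy; rewrite ?le_max ?ge_min lexx orbT.
Qed.

Lemma skorohod_open_bigU (I : Type) (f : I -> set (skorohod R)) :
  (forall i, skorohod_open (f i)) -> skorohod_open (\bigcup_i f i).
Proof.
move=> of_ x [i _ fix_]; have [T [e [e0 s]]] := of_ i x fix_.
by exists T, e; split=> // y /s fiy; exists i.
Qed.

HB.instance Definition _ := @isOpenTopological.Build (skorohod R)
  skorohod_open skorohod_openT skorohod_openI skorohod_open_bigU.

End skorohod_topology.

Section rescaled_path.
Context {R : realType}.
Variables (a c : R) (x : skorohod R).

Let f (t : R) := a * (x t - c).

Let f_neg t : t < 0 -> f t = f 0.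
Proof. by move=> t0; rewrite /f path_neg. Qed.

Let f_right_cont t : 0 <= t -> f s @[s --> t^'+] --> f t.
Proof.
move=> t0; apply: cvgM; first exact: cvg_cst.
by apply: cvgB; [exact: path_right_cont|exact: cvg_cst].
Qed.

Let f_left_lim t : 0 < t -> cvg (f s @[s --> t^'-]).
Proof.
move=> t0; apply: is_cvgM; first exact: is_cvg_cst.
by apply: is_cvgB; [exact: path_left_lim|exact: is_cvg_cst].
Qed.

Definition rescale : skorohod R := Skorohod f_neg f_right_cont f_left_lim.

End rescaled_path.

Section large_deviations.
Context {R : realType}.
Local Open Scope ereal_scope.

Definition good_rate_function (F : topologicalType) (I : F -> \bar R) :=
  (forall x, 0 <= I x) /\
  forall c : R, (0 <= c)%R -> compact [set x | I x <= c%:E].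

(* The index n = 0 is left out.  The first clause says that the X n are random
   variables for the Borel sigma-algebra of F; lne 0 = -oo and the infimum over
   the empty set is +oo. *)
Definition LDP (d : nat -> measure_display)
    (Omega : forall n, measurableType (d n))
    (P : forall n, probability (Omega n) R)
    (F : topologicalType) (X : forall n, Omega n -> F)
    (r : nat -> R) (I : F -> \bar R) :=
  [/\ forall n U, (0 < n)%N -> open U -> measurable (X n @^-1` U),
      good_rate_function I,
      forall A, closed A ->
        limn_esup (fun n => (r n)^-1%:E * lne (P n (X n @^-1` A)))
          <= - ereal_inf [set I x | x in A]
    & forall U, open U ->
        - ereal_inf [set I x | x in U]
          <= limn_einf (fun n => (r n)^-1%:E * lne (P n (X n @^-1` U)))].

End large_deviations.

Section absolutely_continuous_curves.
Context {R : realType}.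
Notation mu := (@lebesgue_measure R).

Definition ac_density (gamma : R -> R) (T : R) (g : R -> R) :=
  mu.-integrable `[0, T] (EFin \o g) /\
  forall t, 0 <= t <= T ->
    gamma t = gamma 0 + \int[mu]_(s in `[0, t]) g s.

Definition AC (gamma : R -> R) :=
  forall T, 0 <= T -> exists g, ac_density gamma T g.

(* For gamma in AC, densities on the intervals [0, T] agree almost everywhere
   and hence glue; this selects a density on [0, +oo[. *)
Definition AC_derivative (gamma : R -> R) : R -> R :=
  xget (fun=> 0) [set g | forall T, 0 <= T -> ac_density gamma T g].

Definition path_rate (I0 : R -> \bar R) (L : R -> R -> R)
    (gamma : skorohod R) : \bar R :=
  if `[< AC gamma >] then
    (I0 (gamma 0%R) +
     \int[mu]_(s in `[0%R, +oo[) (L (gamma s) (AC_derivative gamma s))%:E)%E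
  else +oo%E.

End absolutely_continuous_curves.

Section curie_weiss.
Context {R : realType}.

Definition cosh (x : R) := (expR x + expR (- x)) / 2.
Definition sinh (x : R) := (expR x - expR (- x)) / 2.

Definition G1 (beta x : R) := cosh (beta * x) - x * sinh (beta * x).
Definition G2 (beta x : R) := sinh (beta * x) - x * cosh (beta * x).

Definition CW_lagrangian (beta m x v : R) :=
  (v - 2 * x * derive1 (G2 beta) m) ^+ 2 / (8 * G1 beta m).

Definition magn (n : nat) (k : 'I_n.+1) : R := -1 + 2 * k%:R / n%:R.
Definition E_ (n : nat) : set R := range (@magn n).

Definition CW_generator (beta : R) (n : nat) (f : R -> R) (x : R) :=
  n%:R * ((1 - x) / 2) * expR (beta * x) * (f (x + 2 / n%:R) - f x) +
  n%:R * ((1 + x) / 2) * expR (- beta * x) * (f (x - 2 / n%:R) - f x).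

(* The value of p t x y matters only for t >= 0 and x, y in E_ n. *)
Definition transition_function (n : nat) (p : R -> R -> R -> R) :=
  [/\ forall t x y, 0 <= t -> E_ n x -> E_ n y -> 0 <= p t x y,
      forall t x, 0 <= t -> E_ n x -> \sum_(k < n.+1) p t x (magn k) = 1,
      forall x y, E_ n x -> E_ n y -> p 0 x y = (x == y)%:R
    & forall s t x y, 0 <= s -> 0 <= t -> E_ n x -> E_ n y ->
        p (s + t) x y = \sum_(k < n.+1) p s x (magn k) * p t (magn k) y].

Definition has_generator (n : nat) (p : R -> R -> R -> R)
    (A : (R -> R) -> R -> R) :=
  forall f x, E_ n x ->
    (\sum_(k < n.+1) p h x (magn k) * f (magn k) - f x) / h @[h --> 0^'+]
      --> A f x.

Definition natural_filtration (d : measure_display) (Omega : measurableType d)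
    (X : Omega -> skorohod R) (s : R) : set (set Omega) :=
  <<s [set A | exists u B, [/\ 0 <= u <= s, measurable B &
                              A = (fun w => X w u) @^-1` B]] >>.

(* The last clause is P[X_{s+t} = y | F_s] = p_t(X_s, y) almost surely. *)
Definition markov_process (d : measure_display) (Omega : measurableType d)
    (P : probability Omega R) (n : nat) (A : (R -> R) -> R -> R)
    (X : Omega -> skorohod R) :=
  [/\ forall t, 0 <= t -> measurable_fun setT (fun w => X w t),
      forall w t, 0 <= t -> E_ n (X w t)
    & exists p, [/\ transition_function n p, has_generator n p A &
        forall s t y B, 0 <= s -> 0 <= t -> E_ n y ->
          natural_filtration X s B ->
          P (B `&` [set w | X w (s + t) = y]) =
            (\int[P]_(w in B) (p t (X w s) y)%:E)%E]].

End curie_weiss.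

(* Main.v *)
Require Import Defs.
From HB Require Import structures.
From mathcomp Require Import all_boot all_order all_algebra.
From mathcomp Require Import all_classical all_reals all_analysis.
From mathcomp Require Import measurable_realfun.
From mathcomp Require Import ring lra.
Import Order.TTheory GRing.Theory Num.Theory.
Import numFieldNormedType.Exports.
Local Open Scope classical_set_scope.
Local Open Scope ring_scope.


(** Put [y = b_n (m_n - m)] and [r = n / b_n^2], which tends to infinity. Applying the generator to
    [exp(r p y)] and dividing by [r exp(r p y)] gives a Hamiltonian. Since [G2] vanishes at [m], a
    Taylor expansion shows that it converges, uniformly on compact sets, to [kappa y p + s2 p^2 / 2]
    with [kappa = 2 G2'(m)] and [s2 = 4 G1(m)] ([cw_hamiltonian_approx]). This is the Hamiltonian of
    an Ornstein-Uhlenbeck process with small noise, and its Legendre transform is the Lagrangian of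
    the theorem. In terms of the driving path [psi(t) = y(t) - y(0) - kappa * (integral of y over
    [0, t])], called [driver], the rate is [I0(y(0))] plus the integral of [psi'^2 / (2 s2)]: to
    exponential order [psi] behaves like a Brownian motion of variance [s2 / r].

    For each [n] the process is observed on a grid of mesh [2^-N], with [N] chosen after [n]. It
    becomes a finite Markov chain whose one-step exponential moments are those of the limit up to a
    small error ([step_bounds]).

    Upper bound. Chernoff bounds stopped at first passage ([mass_hit], [mass_crosses]) are applied
    to finitely many exponents. They show that, up to an exponentially small probability, the
    discrete noise of the chain has small action over blocks of time and moves little inside each
    block ([mass_not_good]). Such a path is uniformly close to a curve with polygonal driver that
    belongs to a level set of the rate ([good_path_level], [chain_upper]). A closed set that misses
    a compact level set stays at a positive uniform distance from it ([closed_separation]). Slicing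
    the initial value by the levels of [I0] combines both costs ([path_upper]).

    Lower bound. An exponential tilt makes the chain follow a given curve with probability at least
    1/2, and the density of the tilt is controlled by the action of the curve ([mass_near],
    [chain_lower], [path_lower]).

    Goodness of the rate. Level sets are bounded and equicontinuous, so an ultrafilter on a level
    set converges uniformly on compact time intervals. Discrete actions pass to the limit, and a
    square-integrable density of the limiting driver is recovered from dyadic difference quotients
    ([l2_density], [level_ultra]).

    From grid to path. A path with values in [E_ n] has at most one jump in each cell of a fine
    enough grid, hence is determined by its grid values up to a small time change ([nice_near],
    [nice_close]). This gives measurability for the Skorohod topology ([measurable_open_preimage])
    and carries the estimates on the grid over to the whole path ([grid_tube]). *)

(** * Path probabilities of inhomogeneous finite Markov chains *)

Section finite_chains.
Context {R : realType} {I : finType}.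
Implicit Types (p q xi : nat -> I -> I -> R) (S : seq I -> Prop).

(** The probability that the next [N] states, starting from [x] at time [k], form a list in [S]. It
    is a finite sum, so no measure on paths has to be built. The absolute time [k] is carried along
    because tilted chains are inhomogeneous. *)
Fixpoint mass q (N k : nat) S (x : I) : R :=
  if N is N'.+1 then
    \sum_(y : I) q k x y * mass q N' k.+1 (fun s => S (y :: s)) y
  else `[< S [::] >]%:R.

Lemma mass_ge0 q N k S x : (forall k x y, 0 <= q k x y) -> 0 <= mass q N k S x.
Proof.
move=> q0; elim: N k S x => [|N IH] k S x /=; first exact: ler0n.
by apply: sumr_ge0 => y _; rewrite mulr_ge0.
Qed.

Lemma le_mass q N k S S' x : (forall k x y, 0 <= q k x y) ->
  (forall s, size s = N -> S s -> S' s) -> mass q N k S x <= mass q N k S' x.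
Proof.
move=> q0; elim: N k S S' x => [|N IH] k S S' x SS /=.
  case: (asboolP (S [::])) => [h1|_]; last exact: ler0n.
  by case: (asboolP (S' [::])) => // h2; exfalso; apply: h2; apply: SS.
apply: ler_sum => y _; rewrite ler_wpM2l// IH// => s sN; apply: SS => /=; exact: f_equal.
Qed.

Lemma massT q N k x : (forall k x, \sum_y q k x y = 1) ->
  mass q N k (fun=> True) x = 1.
Proof.
move=> q1; elim: N k x => [|N IH] k x /=; first by case: asboolP.
by under eq_bigr do rewrite IH mulr1.
Qed.

Lemma mass_pred0 q N k S x : (forall k x y, 0 <= q k x y) ->
  (forall s, size s = N -> ~ S s) -> mass q N k S x <= 0.
Proof.
move=> q0; elim: N k S x => [|N IH] k S x nS /=.
  by case: asboolP => // /nS; exact.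
apply: sumr_le0 => y _; rewrite mulr_ge0_le0//; apply: IH => s sN; apply: nS.
by rewrite /= sN.
Qed.

Lemma massU q N k S S' x : (forall k x y, 0 <= q k x y) ->
  mass q N k (fun s => S s \/ S' s) x <= mass q N k S x + mass q N k S' x.
Proof.
move=> q0; elim: N k S S' x => [|N IH] k S S' x /=.
  rewrite -natrD ler_nat.
  by case: (asboolP (S [::])) => h1; case: (asboolP (S' [::])) => h2; case: asboolP => //; tauto.
rewrite -big_split/=; apply: ler_sum => y _.
by rewrite -mulrDr ler_wpM2l//.
Qed.

Lemma mass_bigU (J : eqType) (r : seq J) q N k (S : J -> seq I -> Prop) x :
  (forall k x y, 0 <= q k x y) ->
  mass q N k (fun s => exists2 j, j \in r & S j s) x <=
  \sum_(j <- r) mass q N k (S j) x.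
Proof.
move=> q0; elim: r => [|j r IH].
  by rewrite big_nil; apply: mass_pred0 => // s _ [].
rewrite big_cons; apply: le_trans (lerD (lexx _) IH).
apply: le_trans (massU _ _ _ _ _ _ q0); apply: le_mass => // s _ [i].
by rewrite inE => /orP[/eqP ->|ir Si]; [left|right; exists i].
Qed.

Lemma massC q N k S x : (forall k x y, 0 <= q k x y) ->
  (forall k x, \sum_y q k x y = 1) ->
  1 - mass q N k (fun s => ~ S s) x <= mass q N k S x.
Proof.
move=> q0 q1; rewrite lerBlDr -(massT q N k x q1).
apply: le_trans (massU _ _ _ _ _ _ q0); apply: le_mass => // s _ _; exact: EM.
Qed.

(** First passage of the partial sums of [xi] above a level, with all states before the passage in
    [loc]. The argument [a] is the part of the level still to be covered, which makes the Chernoff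
    bound a plain induction. *)
Fixpoint hit (loc : I -> Prop) xi (k : nat) (x : I) (a : R) (s : seq I) : Prop :=
  a <= 0 \/
  if s is y :: s' then loc x /\ hit loc xi k.+1 y (a - xi k x y) s' else False.

Lemma hit_intro loc xi z k x a s j : (j <= size s)%N ->
  (forall i, (i < j)%N -> loc (nth z (x :: s) i)) ->
  a <= \sum_(i < j) xi (k + i)%N (nth z (x :: s) i) (nth z (x :: s) i.+1) ->
  hit loc xi k x a s.
Proof.
elim: s x k a j => [|y s IH] x k a [|j] //=; rewrite ?big_ord0; try by left.
move=> js locj; rewrite big_ord_recl/= addn0 => aj; right; split.
  exact: (locj 0%N).
apply: (IH y k.+1 (a - xi k x y) j) => //; first by move=> i ij; exact: (locj i.+1).
rewrite lerBlDl; apply: le_trans aj _; rewrite lerD2l.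
by apply: ler_sum => i _; rewrite /= /bump/= add1n addnS addSn.
Qed.

(* Chernoff bound stopped at the first passage, hence uniform in time. *)
Lemma mass_hit q (loc : I -> Prop) xi (c : nat -> R) N k x a :
  (forall k x y, 0 <= q k x y) -> (forall k x, \sum_y q k x y = 1) ->
  (forall k, 0 <= c k) ->
  (forall k x, loc x -> \sum_y q k x y * expR (xi k x y) <= expR (c k)) ->
  mass q N k (hit loc xi k x a) x <= expR (- a + \sum_(i < N) c (k + i)%N).
Proof.
move=> q0 q1 c0 qc; elim: N k x a => [|N IH] k x a.
  rewrite /= big_ord0 addr0; case: asboolP => [[a0|//]|_]; last exact: expR_ge0.
  by rewrite -[leLHS]expR0 ler_expR oppr_ge0.
have [a0|a0] := leP a 0.
  apply: (@le_trans _ _ 1); last first.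
    rewrite -[leLHS]expR0 ler_expR addr_ge0 ?oppr_ge0// sumr_ge0// => i _; exact: c0.
  by rewrite -(massT q N.+1 k x q1); apply: le_mass.
have [lx|lx] := pselect (loc x); last first.
  apply: le_trans (expR_ge0 _); apply: mass_pred0 => // -[|y s] _ /= [|[]//]; by rewrite leNgt a0.
rewrite big_ord_recl/= addn0.
rewrite (_ : expR _ = expR (c k) * expR (- a + \sum_(i < N) c (k.+1 + i)%N)); last first.
  rewrite -expRD addrCA; congr (expR (_ + (_ + _))).
  by apply: eq_bigr => i _; rewrite /bump/= add1n addnS addSn.
apply: (@le_trans _ _ (\sum_y q k x y * expR (xi k x y) *
    expR (- a + \sum_(i < N) c (k.+1 + i)%N))).
  apply: ler_sum => y _; rewrite -mulrA ler_wpM2l// -expRD addrA -[xi k x y - a]opprK opprB.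
  apply: le_trans (IH _ _ _); apply: le_mass => // s _ /= [|[]//]; by rewrite leNgt a0.
by rewrite -mulr_suml ler_wpM2r ?expR_ge0//; exact: qc.
Qed.

(** Change of measure: on lists of states, [q] has with respect to [p] the density whose logarithm
    is the sum of [eta] along the path. It serves to bound the mass under [p] from below by the mass
    under a tilt. *)
Lemma mass_tilt p q (eta : nat -> I -> I -> R) z N k S x C :
  (forall k x y, 0 <= p k x y) ->
  (forall k x y, q k x y = p k x y * expR (eta k x y)) ->
  (forall s, size s = N -> S s ->
    \sum_(i < N) eta (k + i)%N (nth z (x :: s) i) (nth z (x :: s) i.+1) <= C) ->
  mass q N k S x <= expR C * mass p N k S x.
Proof.
move=> p0 qp; elim: N k S x C => [|N IH] k S x C SC /=.
  case: asboolP => [S0|]; last by rewrite mulr0.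
  have := SC [::] erefl S0; rewrite big_ord0 mulr1 => C0.
  by rewrite -[leLHS]expR0 ler_expR.
rewrite mulr_sumr; apply: ler_sum => y _; rewrite qp mulrCA -mulrA ler_wpM2l//.
rewrite (_ : C = eta k x y + (C - eta k x y)); last by rewrite addrC subrK.
rewrite expRD -mulrA ler_wpM2l ?expR_ge0//; apply: IH => s sN Ss.
rewrite lerBrDl; have := SC (y :: s); rewrite /= sN big_ord_recl/= addn0 => /(_ erefl Ss).
apply: le_trans; rewrite lerD2l.
by apply: ler_sum => i _; rewrite /= /bump/= add1n addnS addSn.
Qed.

End finite_chains.

(** * The quadratic limit of the rescaled Hamiltonian at a root of [G2] *)

Section hamiltonian.
Context {R : realType}.
Implicit Types (beta m x u : R).

(** Since [(k + 3)! >= k!], the series from its third power on is bounded termwise by [|u|^3] times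
    the exponential series at [|u|]. *)
Lemma expR_order3 u : `|u| <= 1 ->
  `|expR u - (1 + u + u ^+ 2 / 2)| <= `|u| ^+ 3 * expR 1.
Proof.
move=> u1.
have cu : series (exp_coeff u) n @[n --> \oo] --> expR u.
  exact: is_cvg_series_exp_coeff.
have le_series n : series (exp_coeff `|u|) n <= expR 1.
  apply: (@le_trans _ _ (expR `|u|)); last by rewrite ler_expR.
  apply: nondecreasing_cvgn_le; last exact: is_cvg_series_exp_coeff.
  by apply: nondecreasing_series => i _ _; apply: exp_coeff_ge0.
have : `|series (exp_coeff u) (n + 3)%N - (1 + u + u ^+ 2 / 2)| @[n --> \oo]
    --> `|expR u - (1 + u + u ^+ 2 / 2)|.
  apply: cvg_norm; apply: cvgB; last exact: cvg_cst.
  by rewrite (cvg_shiftn 3 (series (exp_coeff u))).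
move=> /cvg_lim <- //; apply: limr_le.
  apply/cvg_ex; exists `|expR u - (1 + u + u ^+ 2 / 2)|; apply: cvg_norm; apply: cvgB; last exact: cvg_cst.
  by rewrite (cvg_shiftn 3 (series (exp_coeff u))).
near=> n.
rewrite /series/= addnC 3?(big_ltn, big_add1)// /exp_coeff/=.
rewrite expr0 expr1 !factS fact0 !muln1 divr1.
set s := \sum_(_ <= _ < _) _.
rewrite (_ : _ - _ = s); last by rewrite divr1; ring.
rewrite /s; apply: le_trans (ler_norm_sum _ _ _) _.
apply: (@le_trans _ _ (`|u| ^+ 3 * series (exp_coeff `|u|) n)); last first.
  by rewrite ler_wpM2l ?exprn_ge0.
rewrite /series/= mulr_sumr.
rewrite -{1}[3%N]add0n big_addn addKn; apply: ler_sum_nat => k _.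
rewrite normrM normrX normfV normr_nat exprD [X in X * _]mulrC -mulrA.
rewrite /exp_coeff/= !ler_wpM2l ?exprn_ge0//.
rewrite lef_pV2 ?posrE ?ltr0n ?fact_gt0// ler_nat.
by rewrite leq_fact ?leq_addr.
Unshelve. all: by end_near. Qed.

(** The equation reads [exp(beta m) (1 - m) = exp(- beta m) (1 + m)]. Neither factor [1 - m] nor
    [1 + m] can be nonpositive without the other being so too, which is absurd; and [G1] is half the
    sum of the two sides. *)
Lemma G2_root_bound beta m : G2 beta m = 0 ->
  [/\ -1 < m, m < 1 & 0 < G1 beta m].
Proof.
rewrite /G2 /G1 /cosh /sinh.
have := expR_gt0 (beta * m); have := expR_gt0 (- (beta * m)).
set a := expR (beta * m); set c := expR _ => c0 a0 h.
have m1 : m < 1 by rewrite ltNge; apply/negP => m1; nra.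
have m2 : -1 < m by rewrite ltNge; apply/negP => m2; nra.
by split=> //; nra.
Qed.

Lemma continuous_linear_expR beta : continuous (fun x : R => expR (beta * x)).
Proof.
move=> x; apply: continuous_comp; last exact: continuous_expR.
exact: mulrl_continuous.
Qed.

Lemma is_derive_G2 beta m :
  is_derive m 1 (G2 beta)
    (beta * cosh (beta * m) - cosh (beta * m) - m * beta * sinh (beta * m)).
Proof.
rewrite /G2 /cosh /sinh.
apply: is_derive_eq.
rewrite /GRing.scale/=; ring.
Qed.

(** With [A] and [C] the upward and downward rates divided by [n], [A - C = G2] and [A + C = G1]. To
    second order in [2 p / b] the first expression is [2 p b G2(x) + 2 p^2 G1(x)], and
    [b G2(m + y / b)] tends to [G2'(m) y] because [G2(m) = 0]. *)
Lemma cw_hamiltonian_approx beta m : G2 beta m = 0 ->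
  forall M eta, 0 < M -> 0 < eta -> exists2 B, 0 < B & forall b y p x,
    x = m + y / b -> B <= b -> `|y| <= M -> `|p| <= M ->
    `|b ^+ 2 * ((1 - x) / 2 * expR (beta * x) * (expR (2 * p / b) - 1) +
         (1 + x) / 2 * expR (- beta * x) * (expR (- (2 * p / b)) - 1)) -
      (2 * derive1 (G2 beta) m * y * p + 2 * G1 beta m * p ^+ 2)| <= eta.
Proof.
move=> hm M eta M0 eta0.
set g := derive1 (G2 beta) m.
pose A x := (1 - x) / 2 * expR (beta * x).
pose C x := (1 + x) / 2 * expR (- beta * x).
have cA : {for m, continuous A}.
  apply: continuousM; last exact: continuous_linear_expR.
  by apply: continuousM; [apply: continuousB => //; exact: cst_continuous|exact: cst_continuous].
have cC : {for m, continuous C}.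
  apply: continuousM; last exact: continuous_linear_expR.
  by apply: continuousM; [apply: continuousD => //; exact: cst_continuous|exact: cst_continuous].
have G2E x : G2 beta x = A x - C x.
  by rewrite /G2 /cosh /sinh /A /C mulNr; field.
have G1E x : G1 beta x = A x + C x.
  by rewrite /G1 /cosh /sinh /A /C mulNr; field.
(* The errors from [G2] and from [G1] are at most [2 M^2 eps] each, together [eta / 2]; the cubic
   remainder takes the other half. *)
set eps := eta / (8 * M ^+ 2).
have eps0 : 0 < eps by rewrite divr_gt0// mulr_gt0// exprn_gt0.
set K := 1 + `|A m| + `|C m|.
have K0 : 0 < K by rewrite /K -addrA ltr_pwDl// addr_ge0.
have [t t0 Ht] : exists2 t, 0 < t & forall h, `|h| < t ->
    [/\ `|G2 beta (m + h) - g * h| <= eps * `|h|,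
        `|G1 beta (m + h) - G1 beta m| <= eps, `|A (m + h)| <= K &
        `|C (m + h)| <= K].
  have dG := is_derive_G2 beta m.
  have dd : derivable (G2 beta) m 1 by case: dG.
  have : h^-1 *: (G2 beta (h *: 1 + m) - G2 beta m) @[h --> (0:R)^'] --> g.
    by rewrite /g derive1E; exact: dd.
  move=> /cvgrPdist_le /(_ _ eps0) /nbhs_ballP [t1 /= t10 H1].
  have e0 : 0 < Num.min 1 (eps / 2) by rewrite lt_min ltr01 divr_gt0.
  have /cvgrPdist_le/(_ _ e0)/nbhs_ballP [t2 /= t20 H2] := cA.
  have /cvgrPdist_le/(_ _ e0)/nbhs_ballP [t3 /= t30 H3] := cC.
  exists (Num.min t1 (Num.min t2 t3)); first by rewrite !lt_min t10 t20.
  move=> h; rewrite !lt_min => /and3P[ht1 ht2 ht3].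
  have {H2} := H2 (m + h); rewrite /ball/= opprD addNKr normrN => /(_ ht2).
  have {H3} := H3 (m + h); rewrite /ball/= opprD addNKr normrN => /(_ ht3).
  rewrite !le_min => /andP[HC1 HC2] /andP[HA1 HA2]; split.
  - have [->|h0] := eqVneq h 0; first by rewrite addr0 hm mulr0 subrr normr0 mulr0.
    have := H1 h; rewrite /ball/= sub0r normrN => /(_ ht1 h0).
    rewrite hm subr0 /GRing.scale/= mulr1 [h + m]addrC => H.
    rewrite (_ : _ - _ = - (h * (g - h^-1 * G2 beta (m + h)))); last by field.
    by rewrite normrN normrM mulrC ler_wpM2r.
  - rewrite !G1E distrC opprD addrACA; apply: le_trans (ler_normD _ _) _.
    by apply: le_trans (lerD HA2 HC2) _; rewrite -splitr.
  - rewrite -[A (m + h)](subKr (A m)); apply: le_trans (ler_normB _ _) _.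
    by apply: le_trans (lerD (lexx _) HA1) _; rewrite /K addrC lerDl.
  - rewrite -[C (m + h)](subKr (C m)); apply: le_trans (ler_normB _ _) _.
    by apply: le_trans (lerD (lexx _) HC1) _; rewrite /K; have := normr_ge0 (A m); lra.
(* The three lower bounds on [b] ensure, in this order, [|2 p / b| <= 1], [|y / b| < t], and a cubic
   remainder of at most [eta / 2]. *)
pose B := Num.max (2 * M) (Num.max (2 * M / t) (32 * K * M ^+ 3 * expR 1 / eta)).
exists B; first by rewrite lt_max mulr_gt0.
move=> b y p x xE; rewrite !ge_max => /and3P[b1 b2 b3] yM pM.
have b0 : 0 < b by apply: lt_le_trans b1; rewrite mulr_gt0.
have [] := Ht (y / b).
  rewrite normrM normfV (gtr0_norm b0) ltr_pdivrMr//.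
  move: b2; rewrite ler_pdivrMr// => b2; apply: le_lt_trans yM _.
  by rewrite mulrC; apply: lt_le_trans b2; rewrite ltr_pMl// ltr1n.
rewrite -xE => c1 c2 c3 c4.
set u := 2 * p / b.
have u1 : `|u| <= 2 * M / b.
  by rewrite /u normrM normfV (gtr0_norm b0) ler_pM2r ?invr_gt0// normrM ger0_norm// ler_pM2l.
have uM : 2 * M / b <= 1 by rewrite ler_pdivrMr// mul1r.
have := expR_order3 u (le_trans u1 uM).
have := expR_order3 (- u); rewrite normrN => /(_ (le_trans u1 uM)).
set r1 := _ - _; set r2 := _ - _ => h1 h2.
have u3 : `|u| ^+ 3 * expR 1 <= (2 * M / b) ^+ 3 * expR 1.
  by rewrite ler_wpM2r ?expR_ge0// lerXn2r ?nnegrE// mulr_ge0 ?mulr_ge0 ?invr_ge0 ?ltW.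
have bne : b != 0 by rewrite gt_eqF.
rewrite (_ : _ - _ = 2 * p * (b * (G2 beta x - g * (y / b))) +
   2 * p ^+ 2 * (G1 beta x - G1 beta m) + b ^+ 2 * (A x * r2 + C x * r1)); last first.
  by rewrite /r1 /r2 G2E (G1E x) -/(A x) -/(C x) /u; field.
have E1 : `|2 * p * (b * (G2 beta x - g * (y / b)))| <= 2 * M * (eps * M).
  have b0' := ltW b0; rewrite !normrM normr_nat (gtr0_norm b0).
  apply: ler_pM; rewrite ?mulr_ge0//; first by rewrite ler_pM2l.
  apply: (@le_trans _ _ (b * (eps * `|y / b|))); first by rewrite ler_pM2l.
  by rewrite mulrCA ler_pM2l// normrM normfV (gtr0_norm b0) mulrCA divff// mulr1.
have E2 : `|2 * p ^+ 2 * (G1 beta x - G1 beta m)| <= 2 * M ^+ 2 * eps.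
  rewrite normrM [`|2 * p ^+ 2|]normrM normr_nat normrX; apply: ler_pM; rewrite ?mulr_ge0 ?exprn_ge0//.
  by rewrite ler_pM2l// lerXn2r ?nnegrE// ltW.
have E3 : `|b ^+ 2 * (A x * r2 + C x * r1)| <= 16 * K * M ^+ 3 * expR 1 / b.
  rewrite normrM normrX (gtr0_norm b0).
  rewrite (_ : 16 * K * M ^+ 3 * expR 1 / b =
     b ^+ 2 * (K * ((2 * M / b) ^+ 3 * expR 1) + K * ((2 * M / b) ^+ 3 * expR 1))); last by field.
  rewrite ler_pM2l ?exprn_gt0//; apply: le_trans (ler_normD _ _) _; apply: lerD.
    by rewrite normrM; apply: ler_pM => //; apply: le_trans u3.
  by rewrite normrM; apply: ler_pM => //; apply: le_trans u3.
have E4 : 16 * K * M ^+ 3 * expR 1 / b <= eta / 2.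
  rewrite ler_pdivrMr//; move: b3; rewrite ler_pdivrMr// => b3.
  by lra.
have E5 : 2 * M * (eps * M) + 2 * M ^+ 2 * eps = eta / 2.
  by rewrite /eps; field; rewrite gt_eqF.
move: E1 E2 E3; set a1 := _ * (b * _); set a2 := _ * (G1 _ _ - _); set a3 := _ * (_ + _).
move=> E1 E2 E3; have := ler_normD (a1 + a2) a3; have := ler_normD a1 a2.
by lra.
Qed.

End hamiltonian.

(** * From the generator to one small time step *)

Section generator_step.
Context {R : realType}.

(** From [exp(- h c) >= 1 - h c] follows [(1 - h c) exp(h c) <= 1], while
    [(1 - h c) (1 + h c') >= 1] as soon as [h c c' <= c' - c]. *)
Lemma expR_lt_step (c c' : R) : c < c' ->
  \forall h \near 0^'+, expR (h * c) <= 1 + h * c'.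
Proof.
move=> cc'; pose C := 1 + `|c| + `|c * c'|.
have C0 : 0 < C by rewrite /C -addrA ltr_pwDl// addr_ge0.
have e0 : 0 < Num.min (C^-1) ((c' - c) / C) by rewrite lt_min invr_gt0 C0 divr_gt0// subr_gt0.
near=> h.
have h0 : 0 < h by [].
have : h < Num.min (C^-1) ((c' - c) / C) by near: h; apply: nbhs_right_lt.
rewrite lt_min => /andP[h1]; rewrite ltr_pdivlMr// => h2.
have {}h1 : h * C < 1 by rewrite -ltr_pdivlMr// mul1r.
have hc : h * c < 1.
  apply: le_lt_trans h1; rewrite ler_pM2l// /C.
  by have := ler_norm c; have := normr_ge0 (c * c'); lra.
have hcc : h * (c * c') <= c' - c.
  apply: le_trans (ltW h2); rewrite ler_pM2l// /C.
  by have := ler_norm (c * c'); have := normr_ge0 c; lra.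
have := expR_ge1Dx (- (h * c)); rewrite expRN => H.
have e1 := expR_gt0 (h * c).
have : (1 - h * c) * expR (h * c) <= 1.
  by rewrite -ler_pdivlMr// mul1r.
have : 1 <= (1 - h * c) * (1 + h * c') by nra.
move=> H1 H2; rewrite -(@ler_pM2l _ (1 - h * c)) ?subr_gt0//.
exact: le_trans H2 H1.
Unshelve. all: by end_near. Qed.

(** The strict inequality for the generator absorbs the error [o(h)] of the one-step expectation,
    and [1 + h c <= exp(h c)]. The reverse bound [generator_ge] needs an intermediate constant,
    since there the exponential lies on the wrong side of its tangent. *)
Lemma generator_le n p A (f : R -> R) x c : has_generator n p A -> E_ n x ->
  0 < f x -> A f x < c * f x ->
  \forall h \near 0^'+,
    \sum_(k < n.+1) p h x (magn k) * f (magn k) <= expR (h * c) * f x.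
Proof.
move=> hA Ex fx0 Afc.
have := hA f x Ex; move=> /(cvgr_lt (A f x)) /(_ _ Afc) H.
near=> h.
have h0 : 0 < h by [].
have : (\sum_(k < n.+1) p h x (magn k) * f (magn k) - f x) / h < c * f x by near: h.
rewrite ltr_pdivrMr// ltrBlDr => /ltW H1; apply: le_trans H1 _.
have := expR_ge1Dx (h * c); rewrite -(ler_pM2r fx0) => H2.
by apply: le_trans H2; lra.
Unshelve. all: by end_near. Qed.

Lemma generator_ge n p A (f : R -> R) x c : has_generator n p A -> E_ n x ->
  0 < f x -> c * f x < A f x ->
  \forall h \near 0^'+,
    expR (h * c) * f x <= \sum_(k < n.+1) p h x (magn k) * f (magn k).
Proof.
move=> hA Ex fx0 Afc.
have [c' cc' c'A] : exists2 c', c < c' & c' * f x < A f x.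
  move: Afc; rewrite -ltr_pdivlMr// => Afc.
  by exists ((c + A f x / f x) / 2); rewrite ?midf_lt// -ltr_pdivlMr// midf_lt.
have := hA f x Ex; move=> /(cvgr_gt (A f x)) /(_ _ c'A) H.
near=> h.
have h0 : 0 < h by [].
have : c' * f x < (\sum_(k < n.+1) p h x (magn k) * f (magn k) - f x) / h by near: h.
rewrite ltr_pdivlMr// ltrBrDr => /ltW; apply: le_trans.
have : expR (h * c) <= 1 + h * c' by near: h; apply: expR_lt_step.
by rewrite -(ler_pM2r fx0) => H2; apply: le_trans H2 _; lra.
Unshelve. all: by end_near. Qed.

End generator_step.

(** * Discrete noise, the Gronwall inequality and sums over blocks *)

Section noise.
Context {R : realType}.
Implicit Types (y theta : nat -> R) (dk : R).

(* Here [dk] is the time step times the drift coefficient. *)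
Definition noise dk y (k : nat) : R := y k - y 0%N - dk * \sum_(i < k) y i.

Lemma noise0 dk y : noise dk y 0 = 0.
Proof. by rewrite /noise big_ord0 mulr0 subrr subr0. Qed.

Lemma noiseS dk y k : noise dk y k.+1 - noise dk y k = y k.+1 - y k - dk * y k.
Proof. by rewrite /noise big_ord_recr/=; ring. Qed.

Lemma discrete_gronwall (b C : R) (a : nat -> R) K : 0 <= b ->
  (forall k, (k <= K)%N -> a k <= C + b * \sum_(i < k) a i) ->
  forall k, (k <= K)%N -> a k <= C * (1 + b) ^+ k.
Proof.
move=> b0 aC; elim/ltn_ind => k IH kK.
apply: le_trans (aC k kK) _.
have -> : C * (1 + b) ^+ k = C + b * \sum_(i < k) C * (1 + b) ^+ i.
  elim: k {IH kK} => [|k IH]; first by rewrite big_ord0 expr0 mulr0 mulr1 addr0.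
  by rewrite exprS mulrDl mulrDr mul1r {1}IH big_ord_recr/=; ring.
rewrite lerD2l ler_wpM2l//; apply: ler_sum => i _; apply: IH => //.
exact: leq_trans (ltnW (ltn_ord i)) kK.
Qed.

Lemma gronwall_expR (b C : R) (a : nat -> R) K : 0 <= b -> 0 <= C ->
  (forall k, (k <= K)%N -> a k <= C + b * \sum_(i < k) a i) ->
  forall k, (k <= K)%N -> a k <= C * expR (b * K%:R).
Proof.
move=> b0 C0 aC k kK; apply: le_trans (discrete_gronwall b C a K b0 aC k kK) _.
rewrite ler_wpM2l//; apply: (@le_trans _ _ ((1 + b) ^+ K)).
  by rewrite ler_weXn2l// lerDl.
by rewrite expRM_natr lerXn2r ?nnegrE ?addr_ge0// ?expR_ge0// expR_ge1Dx.
Qed.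

Lemma sum_blocks (J K : nat) (F : nat -> R) :
  \sum_(i < J * K) F i = \sum_(j < J) \sum_(i < K) F (j * K + i)%N.
Proof.
elim: J => [|J IH]; first by rewrite mul0n !big_ord0.
by rewrite big_ord_recr/= -IH mulSnr big_split_ord.
Qed.

Lemma sum_blocks_cst (J K : nat) (g : nat -> R) (F : nat -> R) : (0 < K)%N ->
  \sum_(i < J * K) g (i %/ K)%N * (F i.+1 - F i) =
  \sum_(j < J) g j * (F (j.+1 * K)%N - F (j * K)%N).
Proof.
move=> K0; rewrite (sum_blocks J K (fun i => g (i %/ K)%N * (F i.+1 - F i))).
apply: eq_bigr => j _.
transitivity (\sum_(i < K) g j * (F (j * K + i).+1 - F (j * K + i)%N)).
  by apply: eq_bigr => i _; rewrite divnMDl// divn_small// addn0.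
rewrite -mulr_sumr; congr (_ * _).
rewrite -(big_mkord xpredT (fun i => F (j * K + i).+1 - F (j * K + i)%N)).
rewrite (eq_bigr (fun i => (fun i => F (j * K + i)%N) i.+1 - (fun i => F (j * K + i)%N) i)).
  by rewrite telescope_sumr//= addn0 mulSnr.
by move=> i _ /=; rewrite addnS.
Qed.

Lemma sum_blocks_div (J K : nat) (K_gt0 : (0 < K)%N) (G : nat -> R) :
  \sum_(i < J * K) G (i %/ K)%N = \sum_(j < J) K%:R * G j.
Proof.
rewrite (sum_blocks J K (fun i => G (i %/ K)%N)); apply: eq_bigr => j _.
transitivity (\sum_(i < K) G j); last by rewrite sumr_const card_ord mulr_natl.
by apply: eq_bigr => i _; rewrite divnMDl// divn_small// addn0.
Qed.

End noise.

(** * Exponential moments and exponential tilts of a chain *)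

Section chain_estimates.
Context {R : realType} {I : finType}.
Context (p : I -> I -> R) (Y : I -> R) (r delta kappa s2 M eta : R) (Th : seq R).

Definition one_step_mgf (x : I) (th : R) :=
  \sum_y p x y * expR (r * th * (Y y - Y x)).

(** The only information on the dynamics used by the deviation bounds: per unit of time and at speed
    [r], the logarithmic moments are those of the Ornstein-Uhlenbeck limit up to [eta], for
    exponents in a finite list and inside the window [[-M, M]]. *)
Definition mgf_bounds := forall x th, `|Y x| <= M -> th \in Th ->
  expR (r * delta * (kappa * Y x * th + s2 * th ^+ 2 / 2 - eta)) <= one_step_mgf x th /\
  one_step_mgf x th <= expR (r * delta * (kappa * Y x * th + s2 * th ^+ 2 / 2 + eta)).

Context (p_ge0 : forall x y, 0 <= p x y).
Context (p_sum1 : forall x, \sum_y p x y = 1).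
Context (r_gt0 : 0 < r) (delta_gt0 : 0 < delta) (s2_gt0 : 0 < s2).
Context (eta_ge0 : 0 <= eta) (step_bounds : mgf_bounds).

Let dk := delta * kappa.

Let mgf_gt0 x th : 0 < one_step_mgf x th.
Proof.
have F0 y : 0 <= p x y * expR (r * th * (Y y - Y x)) by rewrite mulr_ge0// expR_ge0.
rewrite lt_neqAle sumr_ge0// andbT eq_sym; apply/negP => /eqP H.
have := p_sum1 x; rewrite big1 => [/esym/eqP|y _]; first by rewrite oner_eq0.
have /eqP := @psumr_eq0P _ _ xpredT _ (fun y _ => F0 y) H y isT.
by rewrite mulf_eq0 expR_eq0 orbF => /eqP.
Qed.

(** Cramer tilt with a time-dependent exponent. The normalisation is put inside the exponential to
    match the form required by [mass_tilt]. *)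
Definition tilt (th0 : nat -> R) (k : nat) (x y : I) : R :=
  p x y * expR (r * th0 k * (Y y - Y x) - ln (one_step_mgf x (th0 k))).

Lemma tiltE th0 k x y : tilt th0 k x y =
  p x y * expR (r * th0 k * (Y y - Y x)) / one_step_mgf x (th0 k).
Proof.
by rewrite /tilt expRD expRN lnK ?posrE// mulrA.
Qed.

Lemma tilt_ge0 th0 k x y : 0 <= tilt th0 k x y.
Proof. by rewrite mulr_ge0// expR_ge0. Qed.

Lemma tilt_sum1 th0 k x : \sum_y tilt th0 k x y = 1.
Proof.
by under eq_bigr do rewrite tiltE; rewrite -mulr_suml -/(one_step_mgf x (th0 k)) divff// gt_eqF.
Qed.

Lemma tilt0 : tilt (fun=> 0) = fun=> p.
Proof.
apply/funext => k; apply/funext => x; apply/funext => y; rewrite tiltE.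
rewrite /one_step_mgf mulr0 mul0r expR0 mulr1.
by under eq_bigr do rewrite mul0r expR0 mulr1; rewrite p_sum1 divr1.
Qed.

Definition path_of (x : I) (s : seq I) (k : nat) : R := Y (nth x (x :: s) k).

(** To leading order [delta * s2 * th0 i] is the mean of the noise increment under the tilt, so the
    summands are centred. The window is imposed strictly before the crossing time, which is where
    the moment bounds are used. *)
Definition crosses (th th0 : nat -> R) (a : R) (L : nat) (y : nat -> R) :=
  exists j, [/\ (j <= L)%N, forall i, (i < j)%N -> `|y i| <= M &
    a <= \sum_(i < j) th i *
      (noise dk y i.+1 - noise dk y i - delta * s2 * th0 i)].

(** Under the tilt, the moment at [th] is the quotient of the moments of [p] at [th0 + th] and at
    [th0]. Once the drift and the cross term are compensated, [s2 th^2 / 2] remains, and each of the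
    two moments contributes one [eta]. *)
Lemma mass_crosses th th0 a L x :
  (forall k, th0 k \in Th) -> (forall k, th0 k + th k \in Th) ->
  mass (tilt th0) L 0 (fun s => crosses th th0 a L (path_of x s)) x <=
  expR (r * (- a + \sum_(i < L) delta * (s2 * th i ^+ 2 / 2 + 2 * eta))).
Proof.
move=> Th0 Th1.
pose loc x := `|Y x| <= M.
pose xi k x y := r * th k * (Y y - Y x - dk * Y x - delta * s2 * th0 k).
pose c k := r * (delta * (s2 * th k ^+ 2 / 2 + 2 * eta)).
apply: (@le_trans _ _ (mass (tilt th0) L 0 (hit loc xi 0 x (r * a)) x)).
  apply: le_mass; first exact: tilt_ge0.
  move=> s sL [j [jL jloc ja]].
  apply: (hit_intro _ _ x _ _ _ _ j); first by rewrite sL.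
    by move=> i ij; exact: jloc.
  rewrite -(ler_pM2l r_gt0) in ja; apply: le_trans ja _.
  rewrite mulr_sumr; apply: ler_sum => i _; rewrite noiseS /xi mulrA.
  by rewrite /path_of.
apply: (@le_trans _ _ (expR (- (r * a) + \sum_(i < L) c (0 + i)%N))); last first.
  by rewrite ler_expR mulrDr mulrN mulr_sumr.
apply: mass_hit; [exact: tilt_ge0|exact: tilt_sum1| |].
  move=> k; apply: mulr_ge0; first exact: ltW.
  apply: mulr_ge0; first exact: ltW.
  apply: addr_ge0; last by rewrite mulr_ge0.
  by rewrite divr_ge0// mulr_ge0 ?sqr_ge0 ?ltW.
move=> k z lz.
have [lo _] := step_bounds z _ lz (Th0 k); have [_ hi] := step_bounds z _ lz (Th1 k).
rewrite (_ : \sum_y _ = one_step_mgf z (th0 k + th k) / one_step_mgf z (th0 k)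
     * expR (- (r * th k * (dk * Y z + delta * s2 * th0 k)))); last first.
  rewrite /one_step_mgf 2!mulr_suml; apply: eq_bigr => y _.
  rewrite tiltE -!mulrA; congr (_ * _); rewrite mulrCA [RHS]mulrCA; congr (_ * _).
  by rewrite -!expRD /xi; congr expR; rewrite /dk; ring.
apply: (@le_trans _ _ (expR (r * delta * (kappa * Y z * (th0 k + th k) + s2 * (th0 k + th k) ^+ 2 / 2 + eta)) / expR (r * delta * (kappa * Y z * th0 k + s2 * th0 k ^+ 2 / 2 - eta)) * expR (- (r * th k * (dk * Y z + delta * s2 * th0 k))))).
  rewrite ler_wpM2r ?expR_ge0//; apply: ler_pM => //.
  - exact/ltW/mgf_gt0.
  - by rewrite invr_ge0; exact/ltW/mgf_gt0.
  - by rewrite lef_pV2 ?posrE ?expR_gt0.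
rewrite -expRB -expRD ler_expR /c /dk le_eqVlt; apply/orP; left; apply/eqP; by field.
Qed.

(** In the logarithmic density, the drift part of the log-moments merges with the increments of [Y]
    into noise increments; the lower moment bound controls the normalisation. *)
Lemma mass_tilt_le (th0 : nat -> R) L (S : seq I -> Prop) x (C : R) :
  (forall k, th0 k \in Th) ->
  (forall s, size s = L -> S s ->
     (forall i, (i < L)%N -> `|path_of x s i| <= M) /\
     \sum_(i < L) (th0 i * (noise dk (path_of x s) i.+1 - noise dk (path_of x s) i)
        - delta * (s2 * th0 i ^+ 2 / 2 - eta)) <= C) ->
  mass (tilt th0) L 0 S x <= expR (r * C) * mass (fun=> p) L 0 S x.
Proof.
move=> Th0 SC.
apply: (mass_tilt (fun=> p) (tilt th0) (fun k x y => r * th0 k * (Y y - Y x) - ln (one_step_mgf x (th0 k))) x) => //.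
move=> s sL Ss; have [lo hi] := SC s sL Ss.
rewrite -(ler_pM2l r_gt0) in hi; apply: le_trans hi.
rewrite mulr_sumr; apply: ler_sum => i _.
rewrite noiseS mulrBr -!addrA add0n.
have [lb _] := step_bounds (nth x (x :: s) i) _ (lo i (ltn_ord i)) (Th0 i).
have : r * delta * (kappa * Y (nth x (x :: s) i) * th0 i + s2 * th0 i ^+ 2 / 2 - eta)
   <= ln (one_step_mgf (nth x (x :: s) i) (th0 i)).
  by rewrite -ler_expR lnK ?posrE.
rewrite /path_of /dk; set l := ln _ => H.
by move: H; lra.
Qed.

End chain_estimates.

(** * Noise tubes and the quadratic cost of blocks *)

Section tubes.
Context {R : realType}.
Context (delta kappa s2 M : R).
Context (delta_gt0 : 0 < delta) (s2_gt0 : 0 < s2).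
Implicit Types (y th : nat -> R).

Local Notation dk := (delta * kappa).

Lemma noise_telescope (e : R) y k : noise e y k = \sum_(i < k) (noise e y i.+1 - noise e y i).
Proof.
rewrite -(big_mkord xpredT (fun i => noise e y i.+1 - noise e y i)).
by rewrite telescope_sumr// noise0 subr0.
Qed.

(** A noise deviation larger than [w] would be a crossing for the constant exponent [q] or [-q]. The
    tube holds as long as the path is in the window, and by Gronwall the tube keeps it there; strong
    induction on time resolves the circularity. *)
Lemma noise_tube y th0 q w D R0 L : 0 < q -> 0 <= w -> 0 <= D -> 0 <= R0 ->
  `|y 0%N| <= R0 ->
  (R0 + w + D) * expR (delta * `|kappa| * L%:R) <= M ->
  (forall k, (k <= L)%N -> `|\sum_(i < k) delta * s2 * th0 i| <= D) ->
  ~ crosses delta kappa s2 M (fun=> q) th0 (q * w) L y ->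
  ~ crosses delta kappa s2 M (fun=> - q) th0 (q * w) L y ->
  forall k, (k <= L)%N -> `|y k| <= M /\
    `|noise dk y k - \sum_(i < k) delta * s2 * th0 i| <= w.
Proof.
move=> q0 w0 D0 R00 yR RM hD nc1 nc2.
have yM k : (k <= L)%N -> (forall i, (i < k)%N -> `|y i| <= M) ->
    `|noise dk y k - \sum_(i < k) delta * s2 * th0 i| <= w.
  move=> kL hk; rewrite noise_telescope -sumrB.
  have qs (t : R) : \sum_(i < k) t * (noise dk y i.+1 - noise dk y i - delta * s2 * th0 i)
      = t * \sum_(i < k) (noise dk y i.+1 - noise dk y i - delta * s2 * th0 i).
    by rewrite mulr_sumr.
  rewrite ler_norml; apply/andP; split.
    rewrite leNgt; apply/negP => H; apply: nc2; exists k; split => //.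
    by rewrite qs mulNr -mulrN ler_pM2l// lerNr ltW.
  rewrite leNgt; apply/negP => H; apply: nc1; exists k; split => //.
  by rewrite qs ler_pM2l// ltW.
suff H : forall k, (k <= L)%N -> `|y k| <= M.
  by move=> k kL; split; [exact: H|apply: yM => // i ik; apply: H; exact: leq_trans (ltnW ik) kL].
elim/ltn_ind => k IH kL.
have b0 : 0 <= delta * `|kappa| by rewrite mulr_ge0// ltW.
have C0 : 0 <= R0 + w + D by rewrite !addr_ge0.
apply: le_trans RM; apply: (@le_trans _ _ ((R0 + w + D) * expR (delta * `|kappa| * k%:R))); last first.
  by rewrite ler_wpM2l// ler_expR ler_wpM2l// ler_nat.
apply: (@gronwall_expR _ _ _ (fun k => `|y k|) k b0 C0) => //.
  move=> j jk.
  have jL := leq_trans jk kL.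
  have nj : `|noise dk y j - \sum_(i < j) delta * s2 * th0 i| <= w.
    apply: yM => // i ij; apply: IH; first exact: leq_trans ij jk.
    exact: leq_trans (ltnW ij) jL.
  have -> : y j = y 0%N + (noise dk y j - \sum_(i < j) delta * s2 * th0 i) +
     \sum_(i < j) delta * s2 * th0 i + dk * \sum_(i < j) y i.
    by rewrite {1}/noise; ring.
  apply: le_trans (ler_normD _ _) _; apply: lerD.
    apply: le_trans (ler_normD _ _) _; apply: lerD; last exact: hD.
    by apply: le_trans (ler_normD _ _) _; apply: lerD.
  rewrite normrM normrM (gtr0_norm delta_gt0) ler_wpM2l//; exact: ler_norm_sum.
Qed.

Context (J K : nat) (K_gt0 : (0 < K)%N).
Local Notation tau := (K%:R * delta).

Lemma tau_gt0 : 0 < tau. Proof. by rewrite mulr_gt0// ltr0n. Qed.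

(** The data from which a nearby curve is built: boundedness, small noise oscillation inside each
    block, and the action of the polygon through the noise at block ends. *)
Definition good_path (c e : R) y :=
  [/\ forall k, (k <= J * K)%N -> `|y k| <= M,
      forall j i, (j < J)%N -> (i <= K)%N ->
        `|noise dk y (j * K + i) - noise dk y (j * K)| <= e
    & \sum_(j < J) (noise dk y (j.+1 * K) - noise dk y (j * K)) ^+ 2 / (2 * s2 * tau) <= c].

(** Scaled so that [s2 * tau * v^2 / 2], the price of tilting one block by this exponent, is exactly
    [zeta] times the integer. The boolean is the sign. *)
Definition box_value (zeta : R) (v : bool * nat) : R :=
  (if v.1 then 1 else -1) * Num.sqrt (2 * zeta * v.2%:R / (s2 * tau)).

Definition box n (zeta : R) (f : {ffun 'I_J -> bool * 'I_n.+1}) (j : nat) : R :=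
  if insub j is Some i then box_value zeta ((f i).1, nat_of_ord (f i).2) else 0.

Definition box_cost n zeta (f : {ffun 'I_J -> bool * 'I_n.+1}) : R :=
  \sum_(j < J) s2 * tau * box n zeta f j ^+ 2 / 2.

(** Convex duality with finitely many dual vectors. The optimal exponents [z j / (s2 * tau)] are
    rounded towards zero to the lattice of [box_value], losing at most [zeta] per block. Rounding
    down keeps [v * z >= s2 * tau * v^2], so the pairing is at least twice the cost. *)
Lemma box_cover n zeta c (z : nat -> R) : 0 < zeta -> c <= zeta * n%:R ->
  c < \sum_(j < J) z j ^+ 2 / (2 * s2 * tau) ->
  exists2 f : {ffun 'I_J -> bool * 'I_n.+1}, c - zeta * J%:R <= box_cost n zeta f &
    2 * box_cost n zeta f <= \sum_(j < J) box n zeta f j * z j.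
Proof.
move=> z0 cn cz; have t0 := tau_gt0.
pose g j := z j ^+ 2 / (2 * s2 * tau).
have st0 : 0 < s2 * tau by rewrite mulr_gt0.
have g0 j : 0 <= g j by rewrite divr_ge0 ?sqr_ge0// -mulrA mulr_ge0// ltW.
(* Truncating at [n] keeps the set of dual vectors finite; a coordinate that reaches [n] already
   costs [zeta * n >= c]. *)
pose k j := minn n (Num.truncn (g j / zeta)).
pose f := [ffun j : 'I_J => (0 <= z j, inord (k j) : 'I_n.+1)].
have boxE (j : 'I_J) : box n zeta f j = box_value zeta (0 <= z j, k j).
  by rewrite /box valK ffunE/= inordK// ltnS geq_minl.
have val2 b i : box_value zeta (b, i) ^+ 2 = 2 * zeta * i%:R / (s2 * tau).
  rewrite exprMn sqr_sqrtr; last by rewrite divr_ge0 ?(ltW st0)// !mulr_ge0// ltW.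
  by case: b; rewrite /= ?sqrrN expr1n mul1r.
have costE (j : 'I_J) : s2 * tau * box n zeta f j ^+ 2 / 2 = zeta * (k j)%:R.
  by rewrite boxE val2; field; rewrite !gt_eqF// ltr0n.
have kg j : zeta * (k j)%:R <= g j.
  rewrite mulrC -ler_pdivlMr//; apply: (@le_trans _ _ (Num.truncn (g j / zeta))%:R).
    by rewrite ler_nat geq_minr.
  by rewrite truncn_le divr_ge0// ltW.
exists f.
  rewrite /box_cost; under eq_bigr do rewrite costE.
  have [/existsP[j /eqP kj]|/existsPn kn] := boolP [exists j : 'I_J, k j == n].
    rewrite (bigD1 j)//= kj; apply: le_trans (_ : zeta * n%:R <= _).
      by apply: le_trans cn; rewrite gerBl mulr_ge0// ltW.
    by rewrite lerDl sumr_ge0// => i _; rewrite mulr_ge0// ltW.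
  rewrite lerBlDr; apply: le_trans (ltW cz) _.
  have -> : zeta * J%:R = \sum_(j < J) zeta.
    by rewrite sumr_const card_ord mulr_natr.
  rewrite -big_split/=; apply: ler_sum => j _; rewrite -/(g j).
  have kj : k j = Num.truncn (g j / zeta).
    have := kn j; rewrite /k; case: (leqP n (Num.truncn (g j / zeta))) => h.
      by rewrite eqxx.
    by [].
  rewrite kj -[X in _ + X]mulr1 -mulrDr mulrC -ler_pdivrMr// natr1 ltW//.
  by rewrite truncnS_gt.
rewrite /box_cost mulr_sumr; apply: ler_sum => j _.
rewrite boxE; have bv := val2 (0 <= z j) (k j).
set v := box_value _ _ in bv *.
have vz : v * z j = `|v| * `|z j|.
  rewrite /v /box_value/= normrM (ger0_norm (sqrtr_ge0 _)).
  case: (lerP 0 (z j)) => h /=; first by rewrite normr1 ?ger0_norm.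
  by rewrite normrN1 ?(ltr0_norm h); ring.
have v2 : `|v| ^+ 2 = 2 * zeta * (k j)%:R / (s2 * tau) by rewrite real_normK ?num_real.
rewrite vz (_ : 2 * _ = `|v| * (s2 * tau * `|v|)); last first.
  by rewrite -[v ^+ 2]real_normK ?num_real//; field.
rewrite ler_wpM2l//.
rewrite -(@ler_pXn2r _ 2) ?nnegrE ?mulr_ge0 ?(ltW s2_gt0) ?(ltW delta_gt0)//.
rewrite exprMn v2 real_normK ?num_real//.
have := kg j; rewrite /g ler_pdivlMr; last by rewrite -mulrA mulr_gt0.
apply: le_trans; rewrite le_eqVlt; apply/orP; left; apply/eqP.
by field; rewrite !gt_eqF// ltr0n.
Qed.

End tubes.

(** * Upper and lower deviation bounds for a chain *)

Section chain_deviations.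
Context {R : realType} {I : finType}.
Context (p : I -> I -> R) (Y : I -> R) (r delta kappa s2 M eta : R) (Th : seq R).
Context (p_ge0 : forall x y, 0 <= p x y).
Context (p_sum1 : forall x, \sum_y p x y = 1).
Context (r_gt0 : 0 < r) (delta_gt0 : 0 < delta) (s2_gt0 : 0 < s2).
Context (eta_ge0 : 0 <= eta) (J K : nat) (K_gt0 : (0 < K)%N).
Context (step_bounds : mgf_bounds p Y r delta kappa s2 M eta Th).
Local Notation dk := (delta * kappa).
Local Notation tau := (K%:R * delta).
Local Notation T := (delta * (J * K)%:R).

Lemma sum_one_block (F : nat -> R) (l : R) j i : (i <= K)%N ->
  \sum_(k < j * K + i) (if (k %/ K)%N == j then l else 0) * (F k.+1 - F k) =
  l * (F (j * K + i)%N - F (j * K)%N).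
Proof.
move=> iK; rewrite big_split_ord/= big1 ?add0r; last first.
  move=> k _; have : (k %/ K < j)%N by rewrite ltn_divLR.
  by case: ltngtP => // _ _; rewrite mul0r.
transitivity (\sum_(k < i) l * (F (j * K + k).+1 - F (j * K + k)%N)).
  apply: eq_bigr => k _; rewrite divnMDl// divn_small ?addn0 ?eqxx//.
  exact: leq_trans (ltn_ord k) iK.
rewrite -mulr_sumr; congr (_ * _).
rewrite -(big_mkord xpredT (fun k => F (j * K + k).+1 - F (j * K + k)%N)).
rewrite (eq_bigr (fun k => (fun k => F (j * K + k)%N) k.+1 - (fun k => F (j * K + k)%N) k)).
  by rewrite telescope_sumr//= addn0.
by move=> k _ /=; rewrite addnS.
Qed.

Definition sgb (b : bool) : R := if b then 1 else - 1.

Lemma sgb2 b : sgb b ^+ 2 = 1. Proof. by case: b; rewrite /= ?sqrrN expr1n. Qed.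

(** The ways in which a path can fail to be good: a large noise upwards or downwards over the whole
    horizon, the same within block [j], or a large action, detected by a dual vector of
    [box_cover]. *)
Definition rare_event n : Type :=
  (bool + (bool * 'I_J) + {ffun 'I_J -> bool * 'I_n.+1})%type.

Definition rare_tilt n lam zeta (i : rare_event n) (k : nat) : R :=
  match i with
  | inl (inl b) => sgb b
  | inl (inr (b, j)) => if (k %/ K)%N == j then sgb b * lam else 0
  | inr f => box delta s2 J K n zeta f (k %/ K)%N
  end.

Definition rare_level n w lam e zeta (i : rare_event n) : R :=
  match i with
  | inl (inl b) => w
  | inl (inr (b, j)) => lam * e
  | inr f => 2 * box_cost delta s2 J K n zeta f
  end.

Definition rare_cond n c zeta (i : rare_event n) : Prop :=
  if i is inr f then c - zeta * J%:R <= box_cost delta s2 J K n zeta f else True.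

Lemma not_rare_good n zeta c e w lam R0 y : 0 < zeta -> c <= zeta * n%:R ->
  0 < lam -> 0 <= w -> 0 <= R0 -> `|y 0%N| <= R0 ->
  (R0 + w) * expR (delta * `|kappa| * (J * K)%:R) <= M ->
  (forall i : rare_event n, rare_cond n c zeta i ->
    ~ crosses delta kappa s2 M (rare_tilt n lam zeta i) (fun=> 0)
        (rare_level n w lam e zeta i) (J * K) y) ->
  good_path delta kappa s2 M J K c e y.
Proof.
move=> z0 cn l0 w0 R00 yR RM nc.
have yM k : (k <= J * K)%N -> `|y k| <= M.
  move=> kL.
  have h1 := nc (inl (inl true)) Logic.I; have h2 := nc (inl (inl false)) Logic.I.
  rewrite /= -[w]mul1r in h1 h2.
  have D0 j : (j <= J * K)%N -> `|\sum_(i < j) delta * s2 * 0| <= 0 :> R.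
    by rewrite big1 ?normr0// => i _; rewrite mulr0.
  rewrite -[R0 + w]addr0 in RM.
  by have [] := noise_tube delta kappa s2 M delta_gt0 y (fun=> 0) 1 w 0 R0
    (J * K) ltr01 w0 (lexx _) R00 yR RM D0 h1 h2 k kL.
split => //.
- move=> j i jJ iK.
  have jiL : (j * K + i <= J * K)%N.
    by apply: (@leq_trans (j.+1 * K)); rewrite ?leq_mul2r ?jJ ?orbT// mulSnr leq_add2l.
  have key b : sgb b * (noise dk y (j * K + i) - noise dk y (j * K)) <= e.
    rewrite leNgt; apply/negP => H.
    apply: (nc (inl (inr (b, Ordinal jJ)))) => //=.
    exists (j * K + i)%N; split => //.
      by move=> k kj; apply: yM; apply: leq_trans jiL; exact: ltnW.
    under eq_bigr do rewrite mulr0 subr0.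
    rewrite (sum_one_block (noise dk y)) // [X in _ <= X * _]mulrC -mulrA ler_pM2l//.
    exact: ltW.
  have := key true; have := key false; rewrite /sgb mul1r mulN1r => k1 k2.
  by rewrite ler_norml k2 andbT lerNl.
- rewrite leNgt; apply/negP => H.
  have [f cf bf] := box_cover delta s2 delta_gt0 s2_gt0 J K K_gt0 n zeta c
     (fun j => noise dk y (j.+1 * K) - noise dk y (j * K)) z0 cn H.
  apply: (nc (inr f)) => //=; exists (J * K)%N; split => //.
    by move=> k kj; apply: yM; exact: ltnW.
  under eq_bigr do rewrite mulr0 subr0.
  by rewrite (sum_blocks_cst J K (box delta s2 J K n zeta f) (noise dk y)).
Qed.

(** Union bound over [rare_event], each case being a crossing of the untilted chain. The three
    inequalities on [c'] are the Chernoff exponents of the three kinds. A dual vector of cost [C]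
    crosses the level [2 C] while its exponential moment spends [C], which leaves [C]. *)
Lemma mass_not_good n zeta c e w lam R0 c' x : 0 < zeta -> c <= zeta * n%:R ->
  0 < lam -> 0 <= w -> 0 <= R0 -> `|Y x| <= R0 ->
  (R0 + w) * expR (delta * `|kappa| * (J * K)%:R) <= M ->
  c' <= w - T * (s2 / 2 + 2 * eta) ->
  c' <= lam * e - (tau * s2 * lam ^+ 2 / 2 + 2 * eta * T) ->
  c' <= c - zeta * J%:R - 2 * eta * T ->
  0 \in Th -> (forall (i : rare_event n) k, rare_tilt n lam zeta i k \in Th) ->
  mass (fun=> p) (J * K) 0
    (fun s => ~ good_path delta kappa s2 M J K c e (path_of Y x s)) x <=
  #|{: rare_event n}|%:R * expR (- (r * c')).
Proof.
move=> z0 cn l0 w0 R00 xR RM c1 c2 c3 Th0 Th1.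
pose S (i : rare_event n) s := rare_cond n c zeta i /\
  crosses delta kappa s2 M (rare_tilt n lam zeta i) (fun=> 0)
        (rare_level n w lam e zeta i) (J * K) (path_of Y x s).
apply: (@le_trans _ _ (mass (fun=> p) (J * K) 0 (fun s => exists2 i, i \in enum {: rare_event n} & S i s) x)).
  apply: le_mass => // s _ ng; apply: contrapT => ns; apply: ng.
  apply: (not_rare_good n zeta c e w lam R0) => // i ci cr; apply: ns.
  by exists i; [rewrite mem_enum|split].
apply: le_trans (mass_bigU _ _ _ _ _ _ _ _) _ => //.
rewrite big_enum/=; apply: (@le_trans _ _ (\sum_(i : rare_event n) expR (- (r * c')))); last first.
  by rewrite sumr_const mulr_natl.
apply: ler_sum => i _.
have [ci|nci] := pselect (rare_cond n c zeta i); last first.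
  by apply: le_trans (expR_ge0 _); apply: mass_pred0 => // s _ [].
apply: (@le_trans _ _ (mass (fun=> p) (J * K) 0 (fun s => crosses delta kappa s2 M (rare_tilt n lam zeta i) (fun=> 0)
        (rare_level n w lam e zeta i) (J * K) (path_of Y x s)) x)).
  by apply: le_mass => // s _ [].
rewrite -(tilt0 p Y r p_ge0 p_sum1).
apply: (le_trans (mass_crosses p Y r delta kappa s2 M eta Th p_ge0 p_sum1 r_gt0 delta_gt0 s2_gt0 eta_ge0 step_bounds (rare_tilt n lam zeta i) (fun=> 0) _ _ _ _ _)) => //.
  by move=> k; rewrite add0r.
rewrite ler_expR -mulrN ler_pM2l//.
have cst (v : R) : \sum_(i < J * K) delta * v = T * v.
  by rewrite sumr_const card_ord -[in LHS]mulr_natl; ring.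
have cst2 : \sum_(j < J) K%:R * (delta * (2 * eta)) = 2 * eta * T.
  by rewrite sumr_const card_ord -mulr_natl natrM; ring.
case: i ci => [[b|[b j]]|f] /= ci.
- rewrite (eq_bigr (fun=> delta * (s2 / 2 + 2 * eta))); last by move=> i _; rewrite sgb2 mulr1.
  by rewrite cst; move: c1; lra.
- rewrite (sum_blocks_div J K K_gt0 (fun k => delta * (s2 * (if k == j then sgb b * lam else 0) ^+ 2 / 2 + 2 * eta))).
  rewrite (_ : \sum_(_ < _) _ = tau * s2 * lam ^+ 2 / 2 + 2 * eta * T); first by move: c2; lra.
  rewrite -cst2 [X in _ = _ + X](bigD1 j)//= [X in X = _](bigD1 j)//= eqxx addrA; congr (_ + _).
    by rewrite exprMn sgb2; field.
  apply: eq_bigr => k /negbTE kj.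
  by rewrite (_ : (nat_of_ord k == nat_of_ord j) = false)// expr0n/= mulr0 mul0r add0r.
- rewrite (sum_blocks_div J K K_gt0 (fun k => delta * (s2 * (box delta s2 J K n zeta f k) ^+ 2 / 2 + 2 * eta))).
  rewrite (_ : \sum_(_ < _) _ = box_cost delta s2 J K n zeta f + 2 * eta * T).
    by move: c3 ci; lra.
  rewrite -cst2 -big_split/=; apply: eq_bigr => k _.
  by field.
Qed.

(** The tilt [th0] gives the noise of block [j] the mean [d j]. The tilted chain stays in the tube
    with probability at least 1/2, two crossings having probability at most 1/4 each, and on the
    tube the density is at most [exp(r C)]. In [C] stand the action, the price of following [d] only
    up to [e], and the error of the moments. *)
Lemma mass_near (d : nat -> R) e q R0 D x : 0 < q -> 0 <= e -> 0 <= D -> 0 <= R0 ->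
  `|Y x| <= R0 -> (R0 + e + D) * expR (delta * `|kappa| * (J * K)%:R) <= M ->
  let th0 k := d (k %/ K)%N / (tau * s2) in
  (forall k, (k <= J * K)%N -> `|\sum_(i < k) delta * s2 * th0 i| <= D) ->
  (forall k, th0 k \in Th) -> (forall k, th0 k + q \in Th) ->
  (forall k, th0 k - q \in Th) ->
  expR (r * (- (q * e) + T * (s2 * q ^+ 2 / 2 + 2 * eta))) <= 4^-1 ->
  expR (- (r * (\sum_(j < J) d j ^+ 2 / (2 * s2 * tau) +
             2 * e * \sum_(j < J) `|d j| / (tau * s2) + eta * T))) / 2 <=
  mass (fun=> p) (J * K) 0 (fun s => forall k, (k <= J * K)%N ->
    `|noise dk (path_of Y x s) k - \sum_(i < k) delta * s2 * th0 i| <= e) x.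
Proof.
move=> q0 e0 D0 R00 xR RM th0 hD Th0 Thp Thm small.
set C := _ + _ + _.
have ts0 : 0 < tau * s2 by rewrite !mulr_gt0// ltr0n.
pose near (s : seq I) := forall k, (k <= J * K)%N -> `|path_of Y x s k| <= M /\
    `|noise dk (path_of Y x s) k - \sum_(i < k) delta * s2 * th0 i| <= e.
have cst (v : R) : \sum_(i < J * K) delta * v = T * v.
  by rewrite sumr_const card_ord -[in LHS]mulr_natl; ring.
have tilt_near : 2^-1 <= mass (tilt p Y r th0) (J * K) 0 near x.
  have tp0 := tilt_ge0 p Y r p_ge0 th0.
  have tp1 := tilt_sum1 p Y r p_ge0 p_sum1 th0.
  apply: le_trans (massC _ _ _ _ _ tp0 tp1).
  suff : mass (tilt p Y r th0) (J * K) 0 (fun s => ~ near s) x <= 2^-1 by lra.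
  apply: (@le_trans _ _ (mass (tilt p Y r th0) (J * K) 0 (fun s =>
     crosses delta kappa s2 M (fun=> q) th0 (q * e) (J * K) (path_of Y x s) \/
     crosses delta kappa s2 M (fun=> - q) th0 (q * e) (J * K) (path_of Y x s)) x)).
    apply: le_mass => // s _ ns; apply: contrapT => nc; apply: ns.
    apply: (noise_tube delta kappa s2 M delta_gt0 (path_of Y x s) th0 q e D R0) => //.
      by move=> h; apply: nc; left.
    by move=> h; apply: nc; right.
  apply: le_trans (massU _ _ _ _ _ _ tp0) _.
  have -> : 2^-1 = 4^-1 + 4^-1 :> R by field.
  apply: lerD.
    apply: le_trans small.
    apply: (le_trans (mass_crosses p Y r delta kappa s2 M eta Th p_ge0 p_sum1 r_gt0 delta_gt0 s2_gt0 eta_ge0 step_bounds (fun=> q) th0 _ _ _ _ _)) => //.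
    by rewrite cst.
  apply: le_trans small.
  apply: (le_trans (mass_crosses p Y r delta kappa s2 M eta Th p_ge0 p_sum1 r_gt0 delta_gt0 s2_gt0 eta_ge0 step_bounds (fun=> - q) th0 _ _ _ _ _)) => //.
  by rewrite sqrrN cst.
have dE j : (j <= J)%N -> \sum_(i < j * K) delta * s2 * th0 i = \sum_(i < j) d i.
  move=> jJ; rewrite (sum_blocks j K (fun i => delta * s2 * th0 i)).
  apply: eq_bigr => i _; transitivity (\sum_(l < K) delta * s2 * (d i / (tau * s2))).
    by apply: eq_bigr => l _; rewrite /th0 divnMDl// divn_small// addn0.
  rewrite sumr_const card_ord -mulr_natl; field.
  by rewrite !gt_eqF// ltr0n.
have := mass_tilt_le p Y r delta kappa s2 M eta Th p_ge0 p_sum1 r_gt0 step_bounds th0 (J * K) near x C Th0.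
set P := mass (fun=> p) _ _ near x => H.
apply: (@le_trans _ _ P); last by apply: le_mass => // s _ ns k kJ; have [] := ns k kJ.
have {H} : mass (tilt p Y r th0) (J * K) 0 near x <= expR (r * C) * P.
  apply: H => s sL ns; split; first by move=> i iJ; have [] := ns i (ltnW iJ).
  rewrite sumrB (sum_blocks_cst J K (fun j => d j / (tau * s2)) (noise dk (path_of Y x s)))//.
  rewrite (sum_blocks_div J K K_gt0 (fun j => delta * (s2 * (d j / (tau * s2)) ^+ 2 / 2 - eta))).
  rewrite /C.
  have -> : eta * T = \sum_(j < J) K%:R * (delta * eta).
    by rewrite sumr_const card_ord -mulr_natl natrM; ring.
  rewrite /C -sumrB mulr_sumr -!big_split/=; apply: ler_sum => j _.
  have V (i : nat) : (i <= J)%N -> exists2 v, `|v| <= e & noise dk (path_of Y x s) (i * K) = \sum_(l < i) d l + v.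
    move=> iJ; exists (noise dk (path_of Y x s) (i * K) - \sum_(l < i) d l); last by ring.
    by rewrite -(dE i iJ); have [] := ns (i * K)%N _; rewrite ?leq_mul2r ?iJ ?orbT.
  have [v1 v1e ->] := V j.+1 (ltn_ord j); have [v2 v2e ->] := V j (ltnW (ltn_ord j)).
  rewrite big_ord_recr/=.
  have dv : d j / (tau * s2) * (v1 - v2) <= 2 * e * (`|d j| / (tau * s2)).
    apply: le_trans (ler_norm _) _; rewrite normrM mulrC [`|d j / _|]normrM.
    rewrite normfV (gtr0_norm ts0) ler_wpM2r ?divr_ge0 ?(ltW ts0)//.
    by apply: le_trans (ler_normB _ _) _; move: v1e v2e; lra.
  move: dv; set S := \sum_(_ < _) _; set Z := 2 * e * _ => dv.
  rewrite (_ : d j / (tau * s2) * (S + d j + v1 - (S + v2)) = d j ^+ 2 / (tau * s2) + d j / (tau * s2) * (v1 - v2)); last first.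
    by ring.
  rewrite (_ : K%:R * (delta * (s2 * _ ^+ 2 / 2 - eta)) = d j ^+ 2 / (2 * s2 * tau) - K%:R * (delta * eta)); last first.
    by field; rewrite !gt_eqF// ltr0n.
  rewrite (_ : d j ^+ 2 / (tau * s2) = 2 * (d j ^+ 2 / (2 * s2 * tau))); last first.
    by field; rewrite !gt_eqF// ltr0n.
  by move: dv; lra.
move=> /(le_trans tilt_near) H.
by move: H; rewrite -(ler_pM2l (expR_gt0 (- (r * C)))) mulrA -expRD addNr expR0 mul1r.
Qed.

End chain_deviations.

(** * The natural filtration and the law of the process on a time grid *)

Section filtration.
Context {R : realType} {dd : measure_display} {Omega : measurableType dd}.
Context (X : Omega -> skorohod R).
Context (mX : forall t, 0 <= t -> measurable_fun setT (fun w => X w t)).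

Lemma natural_filtration_mono s t B : s <= t ->
  natural_filtration X s B -> natural_filtration X t B.
Proof.
move=> st; apply: sub_sigma_algebra2 => A [u [C [/andP[u0 us] mC ->]]].
by exists u, C; split => //; rewrite u0 (le_trans us st).
Qed.

Lemma natural_filtrationI s A B : natural_filtration X s A ->
  natural_filtration X s B -> natural_filtration X s (A `&` B).
Proof.
by have /sigma_algebraP[] := smallest_sigma_algebra setT
  [set A | exists u C, [/\ 0 <= u <= s, measurable C & A = (fun w => X w u) @^-1` C]];
  [by []|move=> _ _ _; exact].
Qed.

Lemma natural_filtration_coord s u (C : set R) : 0 <= u <= s -> measurable C ->
  natural_filtration X s ((fun w => X w u) @^-1` C).
Proof. by move=> us mC; apply: sub_gen_smallest; exists u, C. Qed.

Lemma natural_filtration_measurable s B : natural_filtration X s B -> measurable B.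
Proof.
move: B; apply: smallest_sub; first exact: sigma_algebra_measurable.
move=> A [u [C [/andP[u0 _] mC ->]]].
by rewrite -[X in measurable X]setTI; exact: mX.
Qed.

End filtration.

Section skeleton.
Context {R : realType} {dd : measure_display} {Omega : measurableType dd}.
Context (P : probability Omega R) (n : nat) (X : Omega -> skorohod R).
Context (n_gt0 : (0 < n)%N).
Local Notation state := ('I_n.+1).
Implicit Types (S : seq state -> Prop).

Lemma magn_inj : injective (@magn R n).
Proof.
move=> i j /addrI; rewrite -!mulrA => /mulfI; rewrite pnatr_eq0 => /(_ isT).
move=> /mulIf; rewrite invr_eq0 pnatr_eq0 -lt0n n_gt0 => /(_ isT) /eqP.
by rewrite eqr_nat => /eqP /val_inj.
Qed.

Definition state_of (v : R) : state := odflt ord0 [pick k | @magn R n k == v].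

Lemma state_ofK k : state_of (magn k) = k.
Proof.
rewrite /state_of; case: pickP => [j /eqP /magn_inj//|/(_ k)].
by rewrite eqxx.
Qed.

Lemma magnK v : E_ n v -> magn (state_of v) = v.
Proof. by move=> [k _ <-]; rewrite state_ofK. Qed.

(** The list starts at time [k + 1]: the state at time [k] is the starting point given separately to
    [mass]. *)
Definition skeleton (delta : R) (k N : nat) (w : Omega) : seq state :=
  mkseq (fun i => state_of (X w ((k + i).+1%:R * delta))) N.

Lemma skeletonS delta k N w : skeleton delta k N.+1 w =
  state_of (X w (k.+1%:R * delta)) :: skeleton delta k.+1 N w.
Proof.
rewrite /skeleton /mkseq/= addn0; congr (_ :: _).
rewrite -[1%N]addn0 iotaDl -map_comp; apply: eq_map => i /=.
by rewrite add1n addnS addSn.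
Qed.

Context (mX : forall t, 0 <= t -> measurable_fun setT (fun w => X w t)).
Context (EX : forall w t, 0 <= t -> E_ n (X w t)).
Context (p : R -> R -> R -> R).
Context (markov : forall s t y B, 0 <= s -> 0 <= t -> E_ n y ->
   natural_filtration X s B ->
   P (B `&` [set w | X w (s + t) = y]) = (\int[P]_(w in B) (p t (X w s) y)%:E)%E).
Context (delta : R) (delta_ge0 : 0 <= delta).

Local Notation at_ k x := [set w | X w (k%:R * delta) = magn x].
Local Notation kernel := (fun (_ : nat) (x y : state) => p delta (magn x) (magn y)).

Lemma at_filtration k (x : state) : natural_filtration X (k%:R * delta) (at_ k x).
Proof.
have -> : at_ k x = (fun w => X w (k%:R * delta)) @^-1` [set magn x] by [].
by apply: natural_filtration_coord; rewrite ?lexx ?mulr_ge0.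
Qed.

Lemma at_measurable k (x : state) : measurable (at_ k x).
Proof. exact: (natural_filtration_measurable X mX _ _ (at_filtration k x)). Qed.

Lemma measurable_skeleton k N S : measurable [set w | S (skeleton delta k N w)].
Proof.
elim: N k S => [|N IH] k S.
  have [s0|s0] := pselect (S [::]).
    by rewrite (_ : [set _ | _] = setT)//; apply/seteqP; split.
  by rewrite (_ : [set _ | _] = set0)//; apply/seteqP; split.
rewrite (_ : [set _ | _] = \big[setU/set0]_(y < n.+1)
   (at_ k.+1 y `&` [set w | S (y :: skeleton delta k.+1 N w)])).
  by apply: bigsetU_measurable => y _; apply: measurableI;
    [exact: at_measurable|exact: (IH _ (fun s => S (y :: s)))].
rewrite -bigcup_seq; apply/seteqP; split => w /=.
  rewrite skeletonS => Sw; exists (state_of (X w (k.+1%:R * delta))).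
    by rewrite /= mem_index_enum.
  by split => //=; rewrite magnK//; apply: EX; rewrite mulr_ge0.
by move=> [y _ [/= Xy Sy]]; rewrite skeletonS Xy state_ofK.
Qed.

Lemma probability_split k (A : set Omega) : measurable A ->
  P A = (\sum_(y < n.+1) P (A `&` at_ k y))%E.
Proof.
move=> mA; rewrite -measure_bigsetU_ord.
- congr (P _); rewrite -bigcup_seq; apply/seteqP; split => w /=.
    move=> Aw; exists (state_of (X w (k%:R * delta))).
      by rewrite /= mem_index_enum.
    by split => //=; rewrite magnK//; apply: EX; rewrite mulr_ge0.
  by move=> [y _ []].
- by move=> y; apply: measurableI => //; exact: at_measurable.
- by move=> i j _ _ [w [[_ /= h1] [_ /= h2]]]; apply: magn_inj; rewrite -h1.
Qed.

(** On [B'] the state at time [k] is [x], so the integrand of the Markov clause is constant there.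
    As [B'] also belongs to the filtration at time [k + 1], it can take the place of [B] in the
    induction. *)
Lemma skeleton_law k N S B x : natural_filtration X (k%:R * delta) B ->
  P (B `&` at_ k x `&` [set w | S (skeleton delta k N w)]) =
  (P (B `&` at_ k x) * (mass kernel N k S x)%:E)%E.
Proof.
elim: N k S B x => [|N IH] k S B x FB.
  rewrite /skeleton /=; case: asboolP => s0.
    by rewrite mule1 (_ : [set _ : Omega | S [::]] = setT) ?setIT//; apply/seteqP; split.
  by rewrite mule0 (_ : [set _ : Omega | S [::]] = set0) ?setI0 ?measure0//; apply/seteqP; split.
set B' := B `&` at_ k x.
have FB' : natural_filtration X (k%:R * delta) B'.
  by apply: natural_filtrationI => //; exact: at_filtration.
have kd : k.+1%:R * delta = k%:R * delta + delta by rewrite -natr1 mulrDl mul1r.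
have FB'' : natural_filtration X (k.+1%:R * delta) B'.
  by apply: natural_filtration_mono FB'; rewrite kd lerDl.
have mB' := natural_filtration_measurable X mX _ _ FB'.
rewrite (probability_split k.+1); last by apply: measurableI => //; exact: measurable_skeleton.
have -> : (P B' * (mass kernel N.+1 k S x)%:E)%E =
   (\sum_(y < n.+1) P B' * (p delta (magn x) (magn y) * mass kernel N k.+1 (fun s => S (y :: s)) y)%:E)%E.
  rewrite /= -sumEFin fin_num_sume_distrr//; last exact: fin_num_measure.
apply: eq_bigr => y _.
transitivity (P (B' `&` at_ k.+1 y `&` [set w | S (y :: skeleton delta k.+1 N w)])).
  congr (P _); apply/seteqP; split => w /=; rewrite skeletonS.
    by move=> [[h1 h2] h3]; rewrite h3 state_ofK in h2.
  by move=> [[h1 h3] h2]; rewrite h3 state_ofK.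
rewrite (IH k.+1 (fun s => S (y :: s)) B' y FB'') EFinM muleA; congr (_ * _)%E.
have := markov (k%:R * delta) delta (magn y) B' (mulr_ge0 (ler0n _ _) delta_ge0) delta_ge0 _ FB'.
rewrite kd => ->; last by exists y.
rewrite (eq_integral (cst (p delta (magn x) (magn y))%:E)); last first.
  by move=> w; rewrite inE => -[_ /= ->].
by rewrite integral_cst// muleC.
Qed.

Definition skeleton_event (V : set R) (S : state -> seq state -> Prop) N :=
  [set w | V (X w 0) /\ S (state_of (X w 0)) (skeleton delta 0 N w)].

Lemma measurable_skeleton_event (V : set R) (S : state -> seq state -> Prop) N : measurable V ->
  measurable (skeleton_event V S N).
Proof.
move=> mV; rewrite (_ : skeleton_event V S N = \big[setU/set0]_(x < n.+1)
  ([set w | V (X w 0)] `&` (at_ 0 x `&` [set w | S x (skeleton delta 0 N w)]))).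
  apply: bigsetU_measurable => x _; apply: measurableI.
    by rewrite -[X in measurable X]setTI; exact: mX.
  by apply: measurableI; [exact: at_measurable|exact: (measurable_skeleton _ _ (S x))].
rewrite -bigcup_seq; apply/seteqP; split => w /=.
  move=> [Vw Sw]; exists (state_of (X w 0)); first by rewrite /= mem_index_enum.
  by split => //; split => //=; rewrite mul0r magnK//; exact: EX.
by move=> [x _ [Vw []]] /=; rewrite mul0r => Xx Sx; split => //; rewrite Xx state_ofK.
Qed.

Lemma skeleton_event_at (V : set R) (S : state -> seq state -> Prop) N (x : state) : V (magn x) ->
  P (skeleton_event V S N `&` at_ 0 x) =
  (P (at_ 0 x) * (mass kernel N 0 (S x) x)%:E)%E.
Proof.
move=> Vx.
have FT : natural_filtration X (0%:R * delta) setT.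
  by apply: (natural_filtration_coord X _ 0 setT); rewrite ?mul0r ?lexx.
have := skeleton_law 0 N (S x) setT x FT; rewrite setTI => <-; congr (P _).
apply/seteqP; split => w /=; rewrite mul0r.
  by move=> [[Vw Sw] Xx]; split => //; move: Sw; rewrite Xx state_ofK.
by move=> [Xx Sx]; split => //; split; rewrite Xx ?state_ofK.
Qed.

Lemma skeleton_eventT (V : set R) (x : state) : V (magn x) ->
  [set w | V (X w 0)] `&` at_ 0 x = at_ 0 x.
Proof.
move=> Vx; apply/seteqP; split => w /=; rewrite mul0r; first by case.
by move=> Xx; split => //; rewrite Xx.
Qed.

Lemma skeleton_event0 (V : set R) (S : state -> seq state -> Prop) N (x : state) : ~ V (magn x) ->
  skeleton_event V S N `&` at_ 0 x = set0.
Proof.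
move=> Vx; apply/seteqP; split => // w /= [[]]; rewrite mul0r => Vw _ Xx.
by apply: Vx; rewrite -Xx.
Qed.

Lemma measurable_initial (V : set R) : measurable V -> measurable [set w | V (X w 0)].
Proof. by move=> mV; rewrite -[X in measurable X]setTI; exact: mX. Qed.

Lemma skeleton_le (V : set R) (S : state -> seq state -> Prop) N (c : R) : measurable V -> 0 <= c ->
  (forall x : state, V (magn x) -> mass kernel N 0 (S x) x <= c) ->
  (P (skeleton_event V S N) <= P [set w | V (X w 0%R)] * c%:E)%E.
Proof.
move=> mV c0 mc; have mE := measurable_skeleton_event V S N mV.
have mI := measurable_initial V mV.
rewrite (probability_split 0 _ mE) (probability_split 0 _ mI).
rewrite ge0_sume_distrl//; apply: lee_sum => x _.
have [Vx|Vx] := pselect (V (magn x)).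
  by rewrite skeleton_event_at// skeleton_eventT// lee_wpmul2l// lee_fin mc.
by rewrite skeleton_event0// measure0 mule_ge0// lee_fin.
Qed.

Lemma skeleton_ge (V : set R) (S : state -> seq state -> Prop) N (c : R) : measurable V -> 0 <= c ->
  (forall x : state, V (magn x) -> c <= mass kernel N 0 (S x) x) ->
  (P [set w | V (X w 0%R)] * c%:E <= P (skeleton_event V S N))%E.
Proof.
move=> mV c0 mc; have mE := measurable_skeleton_event V S N mV.
have mI := measurable_initial V mV.
rewrite (probability_split 0 _ mE) (probability_split 0 _ mI).
rewrite ge0_sume_distrl//; apply: lee_sum => x _.
have [Vx|Vx] := pselect (V (magn x)).
  by rewrite skeleton_event_at// skeleton_eventT// lee_wpmul2l// lee_fin mc.
rewrite (_ : _ `&` _ = set0) ?measure0 ?mul0e//.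
apply/seteqP; split => // w /=; rewrite mul0r => -[Vw Xx].
by apply: Vx; rewrite -Xx.
Qed.

Lemma nth_skeleton N w k x0 : (k <= N)%N ->
  nth x0 (state_of (X w 0) :: skeleton delta 0 N w) k = state_of (X w (k%:R * delta)).
Proof.
case: k => [|k] kN /=; first by rewrite mul0r.
by rewrite /skeleton nth_mkseq.
Qed.

End skeleton.

(** * Primitives of locally integrable functions and the linear integral equation *)

Section primitives.
Context {R : realType}.
Notation mu := (@lebesgue_measure R).
Implicit Types (f g : R -> R) (s t T : R).

Definition locint f := forall T, mu.-integrable `[0, T] (EFin \o f).

(** It vanishes for [t <= 0], in accordance with paths being constant at negative times. *)
Definition prim f t : R := \int[mu]_(s in `[0, t]) f s.

Lemma prim_le0 f t : t <= 0 -> prim f t = 0.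
Proof.
rewrite le_eqVlt => /predU1P[->|t0].
  by rewrite /prim set_itv1 Rintegral_set1.
by rewrite /prim set_itv_ge ?Rintegral_set0// bnd_simp -ltNge.
Qed.

Lemma locintD f g : locint f -> locint g -> locint (fun s => f s + g s).
Proof. by move=> hf hg T; exact: (integrableD _ (hf T) (hg T)). Qed.

Lemma locintB f g : locint f -> locint g -> locint (fun s => f s - g s).
Proof. by move=> hf hg T; exact: (integrableB _ (hf T) (hg T)). Qed.

Lemma locintZ c f : locint f -> locint (fun s => c * f s).
Proof. by move=> hf T; exact: (integrableZl _ c (hf T)). Qed.

Lemma primD f g t : locint f -> locint g ->
  prim (fun s => f s + g s) t = prim f t + prim g t.
Proof. by move=> hf hg; apply: RintegralD. Qed.

Lemma primB f g t : locint f -> locint g ->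
  prim (fun s => f s - g s) t = prim f t - prim g t.
Proof. by move=> hf hg; apply: RintegralB. Qed.

Lemma primZ c f t : locint f -> prim (fun s => c * f s) t = c * prim f t.
Proof. by move=> hf; apply: RintegralZl. Qed.

Lemma locint_oc f s t : 0 <= s -> locint f -> mu.-integrable `]s, t] (EFin \o f).
Proof.
move=> s0 hf; apply: integrableS (hf t) => //.
by apply: subset_itvr; rewrite bnd_simp.
Qed.

Lemma prim_oc f s t : locint f -> 0 <= s -> s <= t ->
  prim f t - prim f s = \int[mu]_(u in `]s, t]) f u.
Proof.
move=> hf s0 st; rewrite /prim Rintegral_itvB//; exact: hf.
Qed.

Lemma locint_eq f g : (forall t, 0 <= t -> f t = g t) -> locint f -> locint g.
Proof.
move=> fg hf T; apply: (eq_integrable _ _ _ _ (hf T)) => //.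
by move=> t; rewrite inE/= in_itv/= => /andP[t0 _]; rewrite fg.
Qed.

Lemma prim_eq f g t : (forall t, 0 <= t -> f t = g t) -> prim f t = prim g t.
Proof.
move=> fg; apply: eq_Rintegral => s.
by rewrite inE/= in_itv/= => /andP[s0 _]; rewrite fg.
Qed.

Lemma prim_norm_le f B s t : locint f -> 0 <= s -> s <= t ->
  (forall u, s <= u <= t -> `|f u| <= B) -> `|prim f t - prim f s| <= B * (t - s).
Proof.
move=> hf s0 st fB; rewrite prim_oc//.
have hst := locint_oc f s t s0 hf.
apply: le_trans (le_normr_Rintegral _ _) _ => //.
have -> : B * (t - s) = \int[mu]_(u in `]s, t]) B.
  rewrite Rintegral_cst//= lebesgue_measure_itv/= lte_fin.
  case: ifPn => //=; rewrite -leNgt => ts.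
  by rewrite (_ : t = s) ?subrr//; apply/eqP; rewrite eq_le ts st.
apply: le_Rintegral => //.
- exact: (integrable_abse hst).
- have : mu.-integrable `[s, t] (EFin \o cst B); last first.
    by apply: integrableS => //; apply: subset_itvr; rewrite bnd_simp.
  apply: continuous_compact_integrable; first exact: segment_compact.
  by apply: continuous_subspaceT => x; exact: cst_continuous.
- move=> u; rewrite /= in_itv/= => /andP[su ut]; apply: fB.
  by rewrite (ltW su).
Qed.

Lemma continuous_locint f : continuous f -> locint f.
Proof.
move=> cf T; apply: continuous_compact_integrable; first exact: segment_compact.
exact: continuous_subspaceT.
Qed.

(** Extending [f] by zero to the left turns [prim f] into an integral from some [a < 0], so that
    every point, including 0, is interior. *)
Lemma prim_continuous f : locint f -> continuous (prim f).
Proof.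
move=> hf t.
pose g := (f \_ `[0, +oo[) : R -> R.
pose a := Num.min t 0 - 1; pose b := Num.max t 0 + 1.
have at0 : a < t by rewrite /a ltrBlDr; apply: (@le_lt_trans _ _ t); rewrite ?ge_min ?lexx// ltrDl.
have a0 : a < 0 by rewrite /a ltrBlDr; apply: (@le_lt_trans _ _ 0); rewrite ?ge_min ?lexx ?orbT// add0r.
have tb : t < b by rewrite /b; apply: (@le_lt_trans _ _ (Num.max t 0)); rewrite ?le_max ?lexx// ltrDl.
have ab : a < b := lt_trans at0 tb.
have gE (x : R) : `[a, x]%classic `&` `[0, +oo[%classic = `[0, x]%classic.
  apply/seteqP; split => y /=; rewrite !in_itv/= ?andbT.
    by move=> [/andP[_ ->] ->].
  by move=> /andP[y0 ->]; rewrite y0 (le_trans (ltW a0) y0).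
have ig : mu.-integrable `[a, b] (EFin \o g).
  rewrite /g -restrict_EFin; apply/integrable_restrict => //=.
  by rewrite gE; exact: hf.
have pE : prim f = parameterized_integral mu a ^~ g.
  apply/funext => x; rewrite /parameterized_integral /g /prim.
  by rewrite -Rintegral_mkcondr gE.
have := parameterized_integral_continuous (ltW ab) ig.
move=> /(continuous_within_itvP _ ab)[+ _ _] => /(_ t); rewrite in_itv/= at0 tb => /(_ isT).
by rewrite pE.
Qed.

Lemma prim_FTC2 f F t : continuous f -> continuous F -> 0 <= t ->
  (forall s, 0 < s -> is_derive s 1 F (f s)) -> prim f t = F t - F 0.
Proof.
move=> cf cF; rewrite le_eqVlt => /predU1P[<- _|t0 dF].
  by rewrite prim_le0// subrr.
rewrite /prim /Rintegral (continuous_FTC2 t0 (F := F))//.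
- exact: continuous_subspaceT.
- split.
  + by move=> s; rewrite in_itv/= => /andP[s0 _]; case: (dF s s0).
  + exact/cvg_at_right_filter/cF.
  + exact/cvg_at_left_filter/cF.
- by move=> s; rewrite in_itv/= => /andP[s0 _]; rewrite derive1E; apply: derive_val; exact: dF.
Qed.

Lemma is_derive_prim f t : continuous f -> 0 < t -> is_derive t 1 (prim f) (f t).
Proof.
move=> cf t0.
have [||||d1 d2] := @continuous_FTC1 R f (BLeft 0) t (t + 1).
- by rewrite ltrDl.
- exact: continuous_locint.
- exact: t0.
- exact: cf.
- by apply: DeriveDef => //; rewrite -derive1E.
Qed.

Lemma continuous_expR_lin (k : R) : continuous (fun t => expR (k * t)).
Proof.
move=> x; apply: continuous_comp; last exact: continuous_expR.
exact: mulrl_continuous.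
Qed.

(* Variation of constants for [x' = a' + k x]. *)
Lemma ode_uniq (k : R) (x a : R -> R) t : continuous x -> continuous a -> 0 <= t ->
  (forall s, 0 <= s -> x s = a s + k * prim x s) ->
  prim x t = expR (k * t) * prim (fun s => expR (- k * s) * a s) t.
Proof.
move=> cx ca t0 xE.
have cp : continuous (prim x) by exact/prim_continuous/continuous_locint.
have cf : continuous (fun s => expR (- k * s) * a s).
  by move=> s; apply: cvgM; [exact: continuous_expR_lin|exact: ca].
have cF : continuous (fun s => expR (- k * s) * prim x s).
  by move=> s; apply: cvgM; [exact: continuous_expR_lin|exact: cp].
have dF s : 0 < s -> is_derive s 1 (fun s => expR (- k * s) * prim x s) (expR (- k * s) * a s).
  move=> s0; have dp := is_derive_prim x s cx s0.
  by apply: is_derive_eq; rewrite /GRing.scale/= xE ?ltW//; ring.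
rewrite (prim_FTC2 _ _ t cf cF t0 dF) (prim_le0 _ 0)// mulr0 subr0 mulrA -expRD.
by rewrite mulNr subrr expR0 mul1r.
Qed.

(** The factor of the last [k] in [x] vanishes at 0 and has derivative [x], hence equals
    [prim x]. *)
Lemma ode_exists (k : R) (a : R -> R) : continuous a ->
  let x t := a t + k * (expR (k * t) * prim (fun s => expR (- k * s) * a s) t) in
  continuous x /\ forall t, 0 <= t -> x t = a t + k * prim x t.
Proof.
move=> ca x.
have cea : continuous (fun s => expR (- k * s) * a s).
  by move=> s; apply: cvgM; [exact: continuous_expR_lin|exact: ca].
have cp : continuous (prim (fun s => expR (- k * s) * a s)).
  exact/prim_continuous/continuous_locint.
have cu : continuous (fun t => expR (k * t) * prim (fun s => expR (- k * s) * a s) t).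
  by move=> s; apply: cvgM; [exact: continuous_expR_lin|exact: cp].
have cx : continuous x.
  move=> s; apply: cvgD; first exact: ca.
  by apply: cvgM; [exact: cvg_cst|exact: cu].
split => // t t0; rewrite {1}/x; congr (_ + k * _).
have du s : 0 < s -> is_derive s 1 (fun t => expR (k * t) * prim (fun s => expR (- k * s) * a s) t) (x s).
  move=> s0; have dp := is_derive_prim _ s cea s0.
  apply: is_derive_eq; rewrite /GRing.scale/= /x !mulNr !expRN.
  by field; rewrite expR_eq0.
by rewrite (prim_FTC2 x _ t cx cu t0 du) (prim_le0 _ 0)// mulr0 subr0.
Qed.

End primitives.

(** * Absolutely continuous curves and their densities *)

Section densities.
Context {R : realType}.
Notation mu := (@lebesgue_measure R).
Implicit Types (f g h gamma : R -> R) (s t T : R).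

Lemma integrable_setU d (T : measurableType d) (nu : {measure set T -> \bar R})
    (A B : set T) (f : T -> \bar R) : measurable A -> measurable B ->
  [disjoint A & B] -> nu.-integrable A f -> nu.-integrable B f ->
  nu.-integrable (A `|` B) f.
Proof.
move=> mA mB AB /integrableP[mfA fA] /integrableP[mfB fB].
apply/integrableP; split; first exact/measurable_funU.
rewrite ge0_integral_setU//=; first exact: lte_add_pinfty.
by apply/measurable_funU => //; split; exact: measurableT_comp.
Qed.

Definition unit_cell t : nat := xget 0%N [set k | k%:R < t <= k.+1%:R].

Lemma unit_cellE k t : k%:R < t -> t <= k.+1%:R -> unit_cell t = k.
Proof.
move=> kt tk; have H : [set k | k%:R < t <= k.+1%:R] k by rewrite /= kt tk.
rewrite /unit_cell; case: xgetP => [j -> /andP[jt tj]|/(_ k)//].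
apply/eqP; rewrite eqn_leq -ltnS -(ltr_nat R) (lt_le_trans jt tk).
by rewrite -ltnS -(ltr_nat R) (lt_le_trans kt tj).
Qed.

Lemma integrable_cc_oc f s t u : 0 <= s -> s <= t -> t <= u ->
  mu.-integrable `[s, t] (EFin \o f) -> mu.-integrable `]t, u] (EFin \o f) ->
  mu.-integrable `[s, u] (EFin \o f).
Proof.
move=> s0 st tu h1 h2; rewrite (@itv_bndbnd_setU _ _ _ (BRight t)); last 2 first.
- by rewrite bnd_simp.
- by rewrite bnd_simp.
apply: integrable_setU => //.
apply/disj_setPS => y [/=]; rewrite !in_itv/= => /andP[_ yx] /andP[].
by rewrite ltNge yx.
Qed.

(** Of the density chosen on [[0, k + 1]] only the last cell []k, k + 1]] is kept. The increment of
    [gamma] over a cell is computed from a single density, so two of them are never compared. *)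
Lemma AC_glue gamma : Defs.AC gamma ->
  exists2 g, locint g & forall t, 0 <= t -> gamma t = gamma 0 + prim g t.
Proof.
move=> ac.
have /choice[G HG] : forall k, exists g, ac_density gamma k.+1%:R g.
  by move=> k; apply: ac; rewrite ler0n.
pose g t := G (unit_cell t) t.
have gG k t : k%:R < t -> t <= k.+1%:R -> g t = G k t.
  by move=> kt tk; rewrite /g (unit_cellE k).
have sub (k : nat) s : 0 <= s -> s <= k.+1%:R -> mu.-integrable `[0, s] (EFin \o G k).
  move=> s0 sk; have [iG _] := HG k; apply: integrableS iG => //.
  by apply: subset_itvl; rewrite bnd_simp.
have sub2 (k : nat) s : k%:R <= s -> s <= k.+1%:R -> mu.-integrable `]k%:R, s] (EFin \o g).
  move=> ks sk.
  have : mu.-integrable `]k%:R, s] (EFin \o G k).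
    apply: integrableS (sub k s _ sk) => //; last exact: le_trans ks.
    by apply: subset_itvr; rewrite bnd_simp.
  apply: eq_integrable => //; move=> u; rewrite inE/= in_itv/= => /andP[ku us].
  by rewrite (gG k)//; exact: le_trans us sk.
have intk (k : nat) : mu.-integrable `[0, k%:R] (EFin \o g) /\ gamma k%:R = gamma 0 + prim g k%:R.
  elim: k => [|k [IH1 IH2]].
    rewrite prim_le0// addr0; split => //; rewrite set_itv1.
    have : mu.-integrable `[0, 0] (EFin \o cst (g 0)).
      exact: (continuous_locint _ (@cst_continuous _ _ _)).
    rewrite set_itv1; apply: eq_integrable => //.
    by move=> x; rewrite inE => /= ->.
  have ig : mu.-integrable `[0, k.+1%:R] (EFin \o g).
    by apply: (integrable_cc_oc _ _ k%:R) => //; [rewrite ler_nat|apply: sub2; rewrite ?ler_nat].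
  split => //.
  have [iG HGk] := HG k.
  have E : prim g k.+1%:R - prim g k%:R = prim (G k) k.+1%:R - prim (G k) k%:R.
    rewrite /prim (Rintegral_itvB ig) ?bnd_simp ?ler_nat//.
    rewrite (Rintegral_itvB iG) ?bnd_simp ?ler_nat//.
    apply: eq_Rintegral => u.
    by rewrite inE/= in_itv/= => /andP[ku us]; exact: gG.
  have e1 : gamma k%:R = gamma 0 + prim (G k) k%:R by apply: HGk; rewrite ?ler0n ?ler_nat ?leqnSn.
  have e2 : gamma k.+1%:R = gamma 0 + prim (G k) k.+1%:R by apply: HGk; rewrite ?ler0n ?lexx.
  by move: E e1 e2 IH2; lra.
have lg : locint g.
  move=> T; have [k kT] : exists k : nat, T <= k%:R.
    by exists (Num.truncn T).+1; rewrite ltW// truncnS_gt.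
  apply: integrableS (proj1 (intk k)) => //.
  by apply: subset_itvl; rewrite bnd_simp.
exists g => // t t0.
pose k := Num.truncn t.
have /andP[kt tk] : k%:R <= t < k.+1%:R by apply: truncn_itv.
have [iG HGk] := HG k.
have E : prim g t - prim g k%:R = prim (G k) t - prim (G k) k%:R.
  rewrite prim_oc// /prim (Rintegral_itvB (sub k t t0 (ltW tk))) ?bnd_simp//.
  apply: eq_Rintegral => u; rewrite inE/= in_itv/= => /andP[ku us]; apply: gG => //.
  exact: le_trans us (ltW tk).
have e1 : gamma k%:R = gamma 0 + prim (G k) k%:R by apply: HGk; rewrite ?ler0n ?ler_nat ?leqnSn.
have e2 : gamma t = gamma 0 + prim (G k) t by apply: HGk; rewrite t0 ltW.
by move: E e1 e2 (proj2 (intk k)); lra.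
Qed.

Lemma AC_derivativeP gamma : Defs.AC gamma -> locint (AC_derivative gamma) /\
  forall t, 0 <= t -> gamma t = gamma 0 + prim (AC_derivative gamma) t.
Proof.
move=> /AC_glue[g lg gE].
have : [set g | forall T, 0 <= T -> ac_density gamma T g] (AC_derivative gamma).
  rewrite /AC_derivative; case: xgetP => [? -> //|/(_ g)]; case=> T T0.
  by split => // t /andP[t0 _]; exact: gE.
move=> /= H; split.
  move=> T; have [T0|T0] := leP 0 T; first by have [] := H T T0.
  by rewrite set_itv_ge ?bnd_simp -?ltNge//; exact: integrable_set0.
by move=> t t0; have [_ ->//] := H t t0; rewrite t0 lexx.
Qed.

Lemma prim_AC gamma g : locint g ->
  (forall t, 0 <= t -> gamma t = gamma 0 + prim g t) -> Defs.AC gamma.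
Proof.
by move=> lg gE T T0; exists g; split => // t /andP[t0 _]; exact: gE.
Qed.

(** Lebesgue differentiation: almost everywhere [f] is the derivative of its primitive, which is
    locally constant. *)
Lemma prim_eq0_ae f T : locint f -> (forall t, 0 <= t <= T -> prim f t = 0) ->
  {ae mu, forall t, 0 < t < T -> f t = 0}.
Proof.
move=> lf p0.
pose F := f \_ `[0, T].
have iF : mu.-integrable setT (EFin \o F).
  rewrite /F -restrict_EFin; apply/integrable_restrict => //=.
  by rewrite setTI; exact: lf.
have iFs y : mu.-integrable [set` Interval (BLeft 0) (BRight y)] (EFin \o F).
  by apply: integrableS iF.
have lF : locally_integrable [set: R] F by apply: open_integrable_locally; [exact: openT|exact: iF].
have := FTC1 iFs lF; apply: filterS; first exact: (ae_filter_ringOfSetsType mu).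
move=> t /= H /andP[t0 tk].
have [|_ HD] := H; first by rewrite lte_fin.
have Ft : F t = f t by rewrite /F patchE ifT// inE/= in_itv/= !ltW.
rewrite -Ft -HD derive1E.
transitivity ('D_1 (cst 0 : R -> R) t); last by rewrite derive_cst.
apply: near_eq_derive.
near=> y.
have y0 : 0 < y by near: y; exact: lt_nbhsr.
have yk : y < T by near: y; exact: lt_nbhsl.
rewrite -[RHS](p0 y _); last by rewrite !ltW.
apply: eq_Rintegral => u.
rewrite inE/= in_itv/= => /andP[u0 uy].
by rewrite /F patchE ifT// inE/= in_itv/= u0 (le_trans uy (ltW yk)).
Unshelve. all: by end_near. Qed.

(** The inequality [h^2 >= 2 a h - a^2], integrated. With [a] the mean slope it becomes the
    Cauchy-Schwarz inequality, and it makes sense even if [h] is not square integrable. *)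
Lemma tangent_le_integral_sqr h a s t : locint h -> 0 <= s -> s <= t ->
  ((2 * a * (prim h t - prim h s) - a ^+ 2 * (t - s))%:E <=
   \int[mu]_(u in `]s, t]) (h u ^+ 2)%:E)%E.
Proof.
move=> lh s0 st; have ih := locint_oc h s t s0 lh.
have mh : measurable_fun `]s, t] h by have /integrableP[/measurable_EFinP] := ih.
have mh2 : measurable_fun `]s, t] (fun u => (h u ^+ 2)%:E).
  by apply/measurable_EFinP; exact: measurable_funX.
have [|fin] := leP +oo%E (\int[mu]_(u in `]s, t]) (h u ^+ 2)%:E)%E.
  by apply: le_trans; rewrite leey.
have ih2 : mu.-integrable `]s, t] (EFin \o (fun u => h u ^+ 2)).
  apply/integrableP; split => //; apply: le_lt_trans fin.
  rewrite le_eqVlt; apply/orP; left; apply/eqP; apply: eq_integral => u _.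
  by rewrite /= ger0_norm// sqr_ge0.
have ic : mu.-integrable `]s, t] (EFin \o (fun=> a ^+ 2)).
  by apply: locint_oc => //; apply: continuous_locint; exact: cst_continuous.
have ia : mu.-integrable `]s, t] (EFin \o (fun u => 2 * a * h u)).
  by apply: locint_oc => //; exact: locintZ.
have -> : (\int[mu]_(u in `]s, t]) (h u ^+ 2)%:E)%E = (\int[mu]_(u in `]s, t]) h u ^+ 2)%:E.
  by rewrite /Rintegral fineK//; exact: integrable_fin_num.
rewrite lee_fin.
have -> : 2 * a * (prim h t - prim h s) - a ^+ 2 * (t - s) =
    \int[mu]_(u in `]s, t]) (2 * a * h u - a ^+ 2).
  rewrite RintegralB// RintegralZl// -prim_oc//; congr (_ - _).
  rewrite Rintegral_cst//= lebesgue_measure_itv/= lte_fin.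
  case: ifPn => //=; rewrite -leNgt => ts.
  by rewrite (_ : t = s) ?subrr//; apply/eqP; rewrite eq_le ts st.
apply: le_Rintegral => //; first exact: (integrableB _ ia ic).
by move=> u _; rewrite -subr_ge0; have := sqr_ge0 (h u - a); congr (0 <= _); ring.
Qed.

Lemma sum_sqr_le_integral h tau J : locint h -> 0 < tau ->
  ((\sum_(j < J) (prim h (j.+1%:R * tau) - prim h (j%:R * tau)) ^+ 2 / tau)%:E <=
   \int[mu]_(u in `]0%R, (J%:R * tau)%R]) (h u ^+ 2)%:E)%E.
Proof.
move=> lh tau0; elim: J => [|J IH].
  by rewrite big_ord0; apply: integral_ge0 => u _; rewrite lee_fin sqr_ge0.
have st : J%:R * tau <= J.+1%:R * tau by rewrite ler_pM2r// ler_nat.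
have s0 : 0 <= J%:R * tau by rewrite mulr_ge0 ?ler0n ?ltW.
have E : `]0%R, (J.+1%:R * tau)%R]%classic =
    `]0%R, (J%:R * tau)%R]%classic `|` `](J%:R * tau)%R, (J.+1%:R * tau)%R]%classic.
  by rewrite -itv_bndbnd_setU ?bnd_simp.
have mh : measurable_fun `]0, J.+1%:R * tau] (fun u => (h u ^+ 2)%:E).
  apply/measurable_EFinP; apply: measurable_funX.
  by have /integrableP[/measurable_EFinP] := locint_oc h 0 (J.+1%:R * tau) (lexx _) lh.
rewrite big_ord_recr/= EFinD E ge0_integral_setU//=; last 3 first.
- by rewrite -E.
- by move=> u _; rewrite lee_fin sqr_ge0.
- apply/disj_setPS => y [/=]; rewrite !in_itv/= => /andP[_ yx] /andP[].
  by rewrite ltNge yx.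
apply: leeD => //.
set D := prim _ _ - _.
apply: le_trans (tangent_le_integral_sqr h (D / tau) _ _ lh s0 st).
rewrite lee_fin -/D -mulrBl -natrB ?leqnSn// subSnn mul1r.
by rewrite le_eqVlt; apply/orP; left; apply/eqP; field; rewrite gt_eqF.
Qed.

End densities.

(** * A square-integrable density from difference quotients *)

Section l2_limits.
Context {R : realType} d (T : measurableType d) (mu : {measure set T -> \bar R}).

(** Increments summable in L1 give convergence almost everywhere, with domination by [|G 0|] plus
    the sum of the increments. Dominated convergence handles the integrals over subsets, Fatou the
    bound on the square. *)
Lemma fast_cauchy_limit (D : set T) (G : nat -> T -> R) (c C : R) : measurable D ->
  (forall k, mu.-integrable D (EFin \o G k)) ->
  (forall k, (\int[mu]_(x in D) `|G k.+1 x - G k x|%:E <= (c / 2 ^+ k)%:E)%E) ->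
  (forall k, (\int[mu]_(x in D) (G k x ^+ 2)%:E <= C%:E)%E) ->
  exists h, [/\ mu.-integrable D (EFin \o h),
    forall E, measurable E -> E `<=` D ->
      \int[mu]_(x in E) G k x @[k --> \oo] --> \int[mu]_(x in E) h x &
    (\int[mu]_(x in D) (h x ^+ 2)%:E <= C%:E)%E].
Proof.
move=> mD iG dG G2.
have mG k : measurable_fun D (G k) by have /integrableP[/measurable_EFinP] := iG k.
pose e k x := `|G k.+1 x - G k x|.
have e0 k x : 0 <= e k x by exact: normr_ge0.
have me k : measurable_fun D (e k).
  by apply: measurableT_comp => //; exact: measurable_funB.
have mee k : measurable_fun D (fun x => (e k x)%:E) by exact/measurable_EFinP.
pose S x := (\sum_(k <oo) (e k x)%:E)%E.
have mS : measurable_fun D S.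
  apply: (@ge0_emeasurable_sum _ _ _ D (fun k x => (e k x)%:E) xpredT) => [k x _ _|k _].
    by rewrite lee_fin ?e0.
  exact: mee.
have S0 x : (0 <= S x)%E by apply: nneseries_ge0 => k _ _; rewrite lee_fin ?e0.
have iS : mu.-integrable D S.
  apply/integrableP; split => //.
  rewrite (_ : (\int[mu]_(x in D) `|S x|)%E = (\int[mu]_(x in D) S x)%E); last first.
    by apply: eq_integral => x _; rewrite gee0_abs.
  rewrite integral_nneseries//; last by move=> k x _; rewrite lee_fin ?e0.
  apply: (@le_lt_trans _ _ (\sum_(k <oo) (c / 2 ^+ k)%:E)%E).
    apply: lee_nneseries => [k _ _|k _]; last exact: dG.
    by apply: integral_ge0 => x _; rewrite lee_fin ?e0.
  have c0 : 0 <= c.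
    have := dG 0%N; rewrite expr0 divr1 -lee_fin; apply: le_trans.
    by apply: integral_ge0 => x _; rewrite lee_fin ?e0.
  have cvg2 : series (geometric c 2^-1) @ \oo --> c * (1 - 2^-1)^-1.
    by apply: cvg_geometric_series; rewrite ger0_norm// invf_lt1// ltr1n.
  rewrite (_ : (\sum_(k <oo) _)%E = (c * (1 - 2^-1)^-1)%:E) ?ltry//.
  apply/cvg_lim => //.
  rewrite (_ : (fun n => _) = EFin \o series (geometric c 2^-1)); last first.
    apply/funext => n /=; rewrite sumEFin; congr (_%:E); apply: eq_bigr => k _.
    by rewrite /geometric/= exprVn.
  by apply: cvg_EFin; [exact: nearW|exact: cvg2].
have cvgG : {ae mu, forall x, D x -> exists2 l : R, G k x @[k --> \oo] --> l &
     forall k, `|G k x| <= `|G 0%N x| + fine (S x)}.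
  have := integrable_ae mD iS; apply: filterS => x /= fS Dx.
  have {}fS := fS Dx.
  have Ge k : G k x = G 0%N x + \sum_(i < k) (G i.+1 x - G i x).
    elim: k => [|k IH]; first by rewrite big_ord0 addr0.
    by rewrite big_ord_recr/= addrA -IH addrC subrK.
  have se k : \sum_(i < k) e i x <= fine (S x).
    rewrite -lee_fin fineK// -sumEFin -(big_mkord xpredT (fun i => (e i x)%:E)).
    by apply: nneseries_lim_ge => i _ _; rewrite lee_fin ?e0.
  have cs : cvgn (series (fun i => G i.+1 x - G i x)).
    apply: normed_cvg; apply: nondecreasing_is_cvgn.
      by apply: nondecreasing_series => i _ _; exact: normr_ge0.
    exists (fine (S x)) => _ [k _ <-]; apply: le_trans (se k).
    by rewrite -(big_mkord xpredT (fun i => e i x)).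
  have {}cs : \sum_(i < k) (G i.+1 x - G i x) @[k --> \oo] --> limn (series (fun i => G i.+1 x - G i x)).
    by move: cs; rewrite /series/=; under eq_fun do rewrite big_mkord.
  exists (G 0%N x + limn (series (fun i => G i.+1 x - G i x))).
    under eq_fun do rewrite Ge.
    by apply: cvgD => //; exact: cvg_cst.
  move=> k; rewrite Ge; apply: le_trans (ler_normD _ _) _; rewrite lerD2l.
  by apply: le_trans (ler_norm_sum _ _ _) _; exact: se.
(* An upper limit is measurable without further argument; almost everywhere it is the limit. *)
pose h x := fine (limn_esup (fun k => (G k x)%:E)).
have mh : measurable_fun D h.
  apply: measurableT_comp => //; apply: measurable_fun_limn_esup => k.
  exact/measurable_EFinP.
have hl : {ae mu, forall x, D x -> G k x @[k --> \oo] --> h x}.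
  apply: filterS cvgG => x H Dx; have [l Gl _] := H Dx.
  suff -> : h x = l by [].
  rewrite /h (_ : limn_esup _ = l%:E)//.
  by apply: (snd (cvg_limn_einf_sup _)); apply: cvg_EFin; [exact: nearW|exact: Gl].
have dom : {ae mu, forall x k, D x -> (`|(G k x)%:E| <= `|(G 0%N x)%:E| + S x)%E}.
  have := integrable_ae mD iS; move: cvgG; apply: filterS2 => x H fS k Dx.
  have [l _ Gb] := H Dx; have {}fS := fS Dx.
  by rewrite -(fineK fS) /= -EFinD lee_fin.
have idom : mu.-integrable D (fun x => `|(G 0%N x)%:E| + S x)%E.
  by apply: integrableD => //; exact: (integrable_abse (iG 0%N)).
have hlE : {ae mu, forall x, D x -> (G k x)%:E @[k --> \oo] --> (h x)%:E}.
  by apply: filterS hl => x H Dx; apply: cvg_EFin; [exact: nearW|exact: H].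
have mhE : measurable_fun D (EFin \o h) by exact/measurable_EFinP.
have [ih _ _] := dominated_convergence mD (fun k => measurable_int mu (iG k)) mhE hlE idom dom.
exists h; split => //.
- move=> E mE ED.
  have [||||| _ _] := @dominated_convergence _ _ _ mu E mE (fun k => EFin \o G k) (EFin \o h) (fun x => `|(G 0%N x)%:E| + S x)%E.
  + by move=> k; apply: measurable_funS (measurable_int mu (iG k)).
  + by apply: measurable_funS mhE.
  + by apply: filterS hlE => x H /ED; exact: H.
  + by apply: integrableS idom.
  + by apply: filterS dom => x H k /ED; exact: H.
  have ihE : mu.-integrable E (EFin \o h) by apply: integrableS ih.
  have iGE k : mu.-integrable E (EFin \o G k) by apply: integrableS (iG k).
  have -> : (\int[mu]_(x in E) (EFin \o h) x = (\int[mu]_(x in E) h x)%:E)%E.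
    by rewrite /Rintegral fineK//; exact: integrable_fin_num.
  by move=> /fine_cvgP[_].
- have -> : (\int[mu]_(x in D) (h x ^+ 2)%:E = \int[mu]_(x in D) limn_einf (fun k => (G k x ^+ 2)%:E))%E.
    apply: ae_eq_integral => //.
    + by apply/measurable_EFinP; exact: measurable_funX.
    + rewrite (_ : (fun x => _) = (fun x => - limn_esup (fun k => - (G k x ^+ 2)%:E))%E); last first.
        by apply/funext => x; rewrite (limn_esupN (fun k => (G k x ^+ 2)%:E)) oppeK.
      apply: measurableT_comp => //; apply: measurable_fun_limn_esup => k.
      by apply: measurableT_comp => //; apply/measurable_EFinP; exact: measurable_funX.
    + apply: filterS hl => x H Dx; apply/esym.
      apply: (fst (cvg_limn_einf_sup _)); apply: cvg_EFin; first exact: nearW.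
      by apply: cvgM; exact: H.
  apply: le_trans (fatou mu mD _ _) _.
  + by move=> k; apply/measurable_EFinP; exact: measurable_funX.
  + by move=> k x _; rewrite lee_fin sqr_ge0.
  rewrite limn_einf_lim; apply: lime_le; first exact: is_cvg_einfs.
  apply: nearW => k; apply: le_trans (G2 k); apply: ereal_inf_lbound.
  by exists k => /=.
Qed.

End l2_limits.

Section step_functions.
Context {R : realType}.
Notation mu := (@lebesgue_measure R).

Definition stepf (G : nat -> R) (tau t : R) : R := G (Num.truncn (t / tau)).

Lemma stepfE G tau j t : 0 < tau -> j%:R * tau <= t -> t < j.+1%:R * tau ->
  stepf G tau t = G j.
Proof.
move=> tau0 jt tj; rewrite /stepf; congr G; apply: truncn_def.
by rewrite ler_pdivlMr// jt ltr_pdivrMr.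
Qed.

Lemma stepf_integral G tau J : 0 < tau ->
  mu.-integrable `[0, J%:R * tau[ (EFin \o stepf G tau) /\
  \int[mu]_(t in `[0, J%:R * tau[) stepf G tau t = tau * \sum_(j < J) G j.
Proof.
move=> tau0; elim: J => [|J [IH1 IH2]].
  by rewrite mul0r set_itvco0 Rintegral_set0 big_ord0 mulr0; split => //; exact: integrable_set0.
have J0 : 0 <= J%:R * tau by rewrite mulr_ge0 ?ler0n ?ltW.
have JJ : J%:R * tau <= J.+1%:R * tau by rewrite ler_pM2r// ler_nat.
have E : `[0, J.+1%:R * tau[%classic =
    `[0, J%:R * tau[%classic `|` `[J%:R * tau, J.+1%:R * tau[%classic.
  by rewrite -itv_bndbnd_setU ?bnd_simp.
have dis : [disjoint `[0, J%:R * tau[%classic & `[J%:R * tau, J.+1%:R * tau[%classic].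
  apply/disj_setPS => y [/=]; rewrite !in_itv/= => /andP[_ yx] /andP[].
  by rewrite leNgt yx.
have cell : {in `[J%:R * tau, J.+1%:R * tau[%classic, stepf G tau =1 cst (G J)}.
  by move=> t; rewrite inE/= in_itv/= => /andP[t1 t2]; rewrite (stepfE _ _ J).
have i2 : mu.-integrable `[J%:R * tau, J.+1%:R * tau[ (EFin \o stepf G tau).
  have : mu.-integrable `[J%:R * tau, J.+1%:R * tau[ (EFin \o cst (G J)).
    have : mu.-integrable `[J%:R * tau, J.+1%:R * tau] (EFin \o cst (G J)).
      apply: continuous_compact_integrable; first exact: segment_compact.
      by apply: continuous_subspaceT => x; exact: cst_continuous.
    by apply: integrableS => //; apply: subset_itvl; rewrite bnd_simp.
  by apply: eq_integrable => // t tJ; rewrite /= cell.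
have i3 : mu.-integrable `[0, J.+1%:R * tau[ (EFin \o stepf G tau).
  by rewrite E; exact: integrable_setU.
split => //; rewrite E Rintegral_setU//; last by rewrite -E.
rewrite IH2 (eq_Rintegral mu cell) Rintegral_cst//= lebesgue_measure_itv/= lte_fin.
rewrite ltr_pM2r// ltr_nat ltnSn/= big_ord_recr/= -natr1.
by ring.
Qed.

Lemma stepf_comp (F : R -> R) G tau t : F (stepf G tau t) = stepf (F \o G) tau t.
Proof. by []. Qed.

Lemma truncn_div (x : R) (K : nat) : 0 <= x -> (0 < K)%N ->
  Num.truncn (x / K%:R) = (Num.truncn x %/ K)%N.
Proof.
move=> x0 K0; have /andP[x1 x2] := truncn_itv x0.
apply: truncn_def; rewrite ler_pdivlMr ?ltr0n// ltr_pdivrMr ?ltr0n// -!natrM.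
rewrite (le_trans _ x1) ?ler_nat ?leq_divM//=.
by apply: lt_le_trans x2 _; rewrite ler_nat ltn_ceil.
Qed.

Lemma stepf_refine G tau K t : 0 < tau -> (0 < K)%N -> 0 <= t ->
  stepf G (K%:R * tau) t = stepf (fun j => G (j %/ K)%N) tau t.
Proof.
move=> tau0 K0 t0; rewrite /stepf invfM mulrCA mulrC truncn_div//.
  by rewrite divr_ge0// ltW.
Qed.

(** Pythagoras: the coarse quotient [V] is the block average of the fine quotients [v], that is,
    their projection onto functions constant on blocks. *)
Lemma stepf_diff_sqr (F : nat -> R) tau J K : 0 < tau -> (0 < K)%N ->
  let v i := (F i.+1 - F i) / tau in
  let V j := (F (j.+1 * K)%N - F (j * K)%N) / (K%:R * tau) in
  tau * \sum_(i < J * K) (v i - V (i %/ K)%N) ^+ 2 =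
  tau * \sum_(i < J * K) v i ^+ 2 - K%:R * tau * \sum_(j < J) V j ^+ 2.
Proof.
move=> tau0 K0 v V.
have tn : tau != 0 by rewrite gt_eqF.
have Kn : K%:R != 0 :> R by rewrite pnatr_eq0 -lt0n.
have e1 : \sum_(i < J * K) V (i %/ K)%N * v i = K%:R * \sum_(j < J) V j ^+ 2.
  transitivity ((\sum_(i < J * K) V (i %/ K)%N * (F i.+1 - F i)) / tau).
    by rewrite mulr_suml; apply: eq_bigr => i _; rewrite mulrA.
  rewrite sum_blocks_cst// mulr_suml mulr_sumr; apply: eq_bigr => j _.
  by rewrite /V; field; rewrite Kn tn.
have e2 := sum_blocks_div J K K0 (fun j => V j ^+ 2).
have -> : \sum_(i < J * K) (v i - V (i %/ K)%N) ^+ 2 = \sum_(i < J * K) v i ^+ 2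
   - 2 * (\sum_(i < J * K) V (i %/ K)%N * v i) + \sum_(i < J * K) V (i %/ K)%N ^+ 2.
  rewrite mulr_sumr -sumrB -big_split/=; apply: eq_bigr => i _; ring.
by rewrite e1 e2 -mulr_sumr; ring.
Qed.

(* Dyadic difference quotients form an L2-bounded martingale; a subsequence with
   summable increments converges almost everywhere and dominatedly. *)
Lemma l2_density (psi : R -> R) (T C : R) : continuous psi -> 0 < T ->
  (forall N, \sum_(j < 2 ^ N)
     (psi (j.+1%:R * (T / 2 ^+ N)) - psi (j%:R * (T / 2 ^+ N))) ^+ 2 / (T / 2 ^+ N) <= C) ->
  exists h, [/\ locint h,
    forall t, 0 <= t <= T -> psi t - psi 0 = prim h t &
    (\int[mu]_(t in `[0%R, T]) (h t ^+ 2)%:E <= C%:E)%E].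
Proof.
move=> cpsi T0 HC.
pose tau N := T / 2 ^+ N.
have tau0 N : 0 < tau N by rewrite divr_gt0// exprn_gt0.
have tauT N : (2 ^ N)%:R * tau N = T.
  by rewrite natrX mulrC divfK// expf_neq0// pnatr_eq0.
pose v N j := (psi (j.+1%:R * tau N) - psi (j%:R * tau N)) / tau N.
pose g N := stepf (v N) (tau N).
pose a N := tau N * \sum_(j < 2 ^ N) v N j ^+ 2.
have aC N : a N <= C.
  apply: le_trans (HC N); rewrite le_eqVlt; apply/orP; left; apply/eqP.
  rewrite /a mulr_sumr; apply: eq_bigr => j _; rewrite /v -/(tau N).
  by field; rewrite gt_eqF.
have tauD N M : tau N = (2 ^ M)%:R * tau (N + M)%N.
  by rewrite /tau exprD natrX; field; rewrite !expf_neq0 ?pnatr_eq0.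
have diff N M : tau (N + M)%N * \sum_(i < 2 ^ (N + M))
    (v (N + M)%N i - v N (i %/ 2 ^ M)%N) ^+ 2 = a (N + M)%N - a N.
  have K0 : (0 < 2 ^ M)%N by rewrite expn_gt0.
  have := stepf_diff_sqr (fun i => psi (i%:R * tau (N + M)%N)) (tau (N + M)%N) (2 ^ N) (2 ^ M) (tau0 _) K0.
  rewrite /= -expnD => H; rewrite /a [X in _ = _ - X * _](tauD N M).
  have VE j : v N j = (psi ((j.+1 * 2 ^ M)%:R * tau (N + M)%N) - psi ((j * 2 ^ M)%:R * tau (N + M)%N)) /
      ((2 ^ M)%:R * tau (N + M)%N).
    by rewrite /v (tauD N M) !natrM !mulrA.
  by rewrite (funext VE); exact: H.
have amono N M : a N <= a (N + M)%N.
  rewrite -subr_ge0 -diff; apply: mulr_ge0; first exact: ltW.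
  by apply: sumr_ge0 => i _; exact: sqr_ge0.
have stab : forall k, exists N, forall M, a (N + M)%N - a N <= 4^-1 ^+ k.
  move=> k.
  have hs : has_sup (range a) by split; [exists (a 0%N), 0%N|exists C => _ [N _ <-]].
  have q0 : (0 : R) < 4^-1 ^+ k by rewrite exprn_gt0.
  have [_ [N _ <-] HN] := sup_adherent q0 hs.
  exists N => M; rewrite lerBlDl; apply: le_trans (_ : sup (range a) <= _).
    by apply: sup_upper_bound => //; exists (N + M)%N.
  by rewrite -lerBlDr ltW.
have /choice[n0 Hn0] := stab.
(* Summing the thresholds makes [n] increasing, with [n k >= n0 k] and [n k >= k]. *)
pose n k := (\sum_(i < k.+1) (n0 i).+1)%N.
have n0n k : (n0 k <= n k)%N by rewrite /n big_ord_recr/= (leq_trans (leqnSn _))// leq_addl.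
have nS k : exists M, n k.+1 = (n k + M)%N.
  by exists (n0 k.+1).+1; rewrite /n [in LHS]big_ord_recr.
have kn k : (k <= n k)%N.
  rewrite /n -[X in (X <= _)%N]muln1 -[X in (X * _ <= _)%N]card_ord -sum_nat_const.
  rewrite big_ord_recr/=; apply: leq_trans (leq_addr _ _); exact: leq_sum.
have nk k M : a (n k + M)%N - a (n k) <= 4^-1 ^+ k.
  apply: le_trans (Hn0 k (n k + M - n0 k)%N).
  rewrite subnKC; last exact: leq_trans (n0n k) (leq_addr _ _).
  by rewrite lerD2l lerN2 -[X in _ <= a X](subnKC (n0n k)) amono.
pose G k := g (n k).
pose D := `[0%R, T[%classic : set R.
have DE N : D = `[0%R, (2 ^ N)%:R * tau N[%classic by rewrite tauT.
have iG k : mu.-integrable D (EFin \o G k).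
  rewrite (DE (n k)); exact: (proj1 (stepf_integral _ _ _ _)).
have EFinR (f : nat -> R) N : (\int[mu]_(x in D) (stepf f (tau N) x)%:E = (tau N * \sum_(j < 2 ^ N) f j)%:E)%E.
  have [i1 i2] := stepf_integral f (tau N) (2 ^ N) (tau0 N).
  rewrite -i2 tauT /Rintegral fineK//; move: i1; rewrite tauT => i1.
  exact: integrable_fin_num.
(* With [p = 2^k], the bound [4^-k] on the squared increments becomes a bound of order [2^-k] in
   L1. *)
have young (p q : R) : 0 < p -> q <= (p^-1 + p * q ^+ 2) / 2.
  move=> p0; rewrite ler_pdivlMr// -(ler_pM2l p0) [X in _ <= X]mulrDr divff ?gt_eqF//.
  by have := sqr_ge0 (1 - p * q); lra.
have [||||h [ih hE h2]] := @fast_cauchy_limit R _ _ mu D G ((T + 1) / 2) C.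
  - exact: measurable_itv.
  - exact: iG.
  - move=> k; have [M nM] := nS k.
    pose w i := v (n k + M)%N i - v (n k) (i %/ 2 ^ M)%N.
    have -> : (\int[mu]_(x in D) `|G k.+1 x - G k x|%:E =
        \int[mu]_(x in D) (stepf (fun i => `|w i|) (tau (n k + M)%N) x)%:E)%E.
      apply: eq_integral => x; rewrite inE /D/= in_itv/= => /andP[x0 _].
      by rewrite /G /g nM (tauD (n k) M) stepf_refine// expn_gt0.
    rewrite EFinR lee_fin.
    apply: (@le_trans _ _ (tau (n k + M)%N * \sum_(j < 2 ^ (n k + M)) (2 ^- k + 2 ^+ k * w j ^+ 2) / 2)).
      rewrite ler_pM2l//; apply: ler_sum => j _.
      by rewrite -(real_normK (num_real (w j))) young// exprn_gt0.
    rewrite -mulr_suml big_split/= sumr_const card_ord -mulr_sumr.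
    rewrite -[_ *+ _]mulr_natl mulrA mulrDr mulrA (mulrC (tau _)) tauT.
    rewrite mulrCA diff mulrAC ler_pM2r// mulrDl mul1r lerD2l.
    apply: le_trans (_ : 2 ^+ k * 4^-1 ^+ k <= _).
      by rewrite ler_pM2l ?exprn_gt0// nk.
    by rewrite -exprMn -exprVn le_eqVlt; apply/orP; left; apply/eqP; congr (_ ^+ _); field.
  - move=> k; apply: le_trans (_ : (a (n k))%:E <= _)%E; last by rewrite lee_fin.
    rewrite /a -(EFinR (fun j => v (n k) j ^+ 2)).
    exact: lexx.
pose hh := h \_ D.
have hhE : {in D, hh =1 h} by move=> x xD; rewrite /hh patchE xD.
have ihh : mu.-integrable setT (EFin \o hh).
  rewrite /hh -restrict_EFin; apply/integrable_restrict => //=; first exact: measurable_itv.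
  by rewrite setTI.
have lhh : locint hh by move=> u; apply: integrableS ihh.
exists hh; split => //; last first.
  rewrite -integral_itv_bndo_bndc//=; last first.
    apply/measurable_EFinP; apply: measurable_funX; apply: measurable_funS.
    - exact: measurableT.
    - by [].
    - by have /integrableP[/measurable_EFinP] := ihh.
  apply: le_trans h2; rewrite le_eqVlt; apply/orP; left; apply/eqP.
  by apply: eq_integral => x xD; rewrite hhE.
have dyadic N j : j%:R * tau N <= T -> psi (j%:R * tau N) - psi 0 = prim hh (j%:R * tau N).
  move=> jT; set s := j%:R * tau N.
  have sD : `[0, s[ `<=` D by apply: subset_itvl; rewrite bnd_simp.
  have -> : prim hh s = \int[mu]_(x in `[0, s[) h x.
    rewrite /prim -Rintegral_itv_bndo_bndc; last by apply: integrableS ihh.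
    by apply: eq_Rintegral => x; rewrite inE => /sD xD; rewrite hhE// inE.
  have ev : \forall k \near \oo, \int[mu]_(x in `[0, s[) G k x = psi s - psi 0.
    near=> k.
    have Nk : (N <= n k)%N by apply: leq_trans (kn k); near: k; exact: nbhs_infty_ge.
    have sE : s = (j * 2 ^ (n k - N))%:R * tau (n k).
      by rewrite /s (tauD N (n k - N)%N) subnKC// natrM mulrA.
    rewrite {1}sE; have [_ ->] := stepf_integral (v (n k)) (tau (n k)) (j * 2 ^ (n k - N)) (tau0 _).
    rewrite mulr_sumr [in psi s]sE.
    rewrite (eq_bigr (fun i : 'I__ => psi (i.+1%:R * tau (n k)) - psi (i%:R * tau (n k)))); last first.
      by move=> i _; rewrite /v mulrC divfK// gt_eqF.
    rewrite -(big_mkord xpredT (fun i => psi (i.+1%:R * tau (n k)) - psi (i%:R * tau (n k)))).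
    rewrite (@telescope_sumr _ 0 _ (fun i => psi (i%:R * tau (n k))))// mul0r.
    by [].
  have := hE `[0, s[%classic (measurable_itv _) sD => lim1.
  apply: (@cvg_unique _ (@Rhausdorff R) (\int[mu]_(x in `[0, s[) G k x @[k --> \oo])) => //.
  by apply: cvg_near_cst.
move=> t /andP[t0 tT].
apply/eqP; apply/negPn/negP => neq.
(* [A] is continuous and vanishes at the dyadic points; a nonzero value at [t] is refuted at the
   dyadic point just below [t]. *)
pose A s := psi s - psi 0 - prim hh s.
have cA : continuous A.
  move=> s; apply: cvgB; last exact: prim_continuous.
  by apply: cvgB; [exact: cpsi|exact: cvg_cst].
have At : 0 < `|A t| by rewrite normr_gt0 subr_eq0.
have /cvgrPdist_lt /(_ _ At) /nbhs_ballP[e /= e0 He] := cA t.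
pose N := (Num.truncn (T / e)).+1.
have tauN : tau N < e.
  rewrite /tau ltr_pdivrMr ?exprn_gt0// mulrC -ltr_pdivrMr//.
  apply: lt_le_trans (truncnS_gt _) _; rewrite -natrX ler_nat.
  exact: ltnW (ltn_expl _ _).
pose j := Num.truncn (t / tau N).
have /andP[j1 j2] : j%:R <= t / tau N < j.+1%:R by apply: truncn_itv; rewrite divr_ge0// ltW.
rewrite ler_pdivlMr// in j1; rewrite ltr_pdivrMr// -natr1 mulrDl mul1r in j2.
have := He (j%:R * tau N); rewrite /ball/= ger0_norm ?subr_ge0//.
rewrite ltrBlDl => /(_ (lt_trans j2 _)).
rewrite ltrD2l => /(_ tauN).
by rewrite {2}/A dyadic ?subrr ?subr0 ?ltxx//; exact: le_trans tT.
Unshelve. all: by end_near. Qed.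

End step_functions.

(** * The rate functional expressed through the driving path *)

Section rate_function.
Context {R : realType}.
Notation mu := (@lebesgue_measure R).
Context (kappa s2 : R) (s2_gt0 : 0 < s2) (I0 : R -> \bar R).
Implicit Types (gamma : skorohod R) (h : R -> R).

Definition ou_lagrangian (x v : R) : R := (v - kappa * x) ^+ 2 / (2 * s2).

Local Notation rate := (path_rate I0 ou_lagrangian).

(* The driving path of [gamma]: its derivative is the argument squared in the
   Lagrangian. *)
Definition driver (x : R -> R) (t : R) : R := x t - x 0 - kappa * prim x t.

Lemma AC_continuous gamma : Defs.AC gamma -> continuous gamma.
Proof.
move=> /AC_glue[g lg gE].
have -> : (gamma : R -> R) = fun t => gamma 0 + prim g t.
  apply/funext => t; have [t0|t0] := leP 0 t; first exact: gE.
  by rewrite path_neg// prim_le0 ?addr0// ltW.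
by move=> t; apply: cvgD; [exact: cvg_cst|exact: prim_continuous].
Qed.

Lemma driver_continuous (x : R -> R) : continuous x -> continuous (driver x).
Proof.
move=> cx t; apply: cvgB; first by apply: cvgB; [exact: cx|exact: cvg_cst].
by apply: cvgM; [exact: cvg_cst|exact/prim_continuous/continuous_locint].
Qed.

Lemma driver0 (x : R -> R) : driver x 0 = 0.
Proof. by rewrite /driver prim_le0// mulr0 !subrr. Qed.

Definition driver_density gamma (t : R) : R := AC_derivative gamma t - kappa * gamma t.

Lemma driver_densityP gamma : Defs.AC gamma -> locint (driver_density gamma) /\
  forall t, 0 <= t -> driver gamma t = prim (driver_density gamma) t.
Proof.
move=> acg; have [ld dE] := AC_derivativeP gamma acg.
have lg : locint gamma by exact/continuous_locint/AC_continuous.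
have lkg := locintZ kappa _ lg.
split; first exact: locintB.
move=> t t0; rewrite /driver (dE t t0) /driver_density primB// primZ//.
by ring.
Qed.

Lemma path_rateE gamma : Defs.AC gamma -> rate gamma =
  (I0 (gamma 0%R) + \int[mu]_(s in `[0%R, +oo[) (driver_density gamma s ^+ 2 / (2 * s2))%:E)%E.
Proof. by move=> acg; rewrite /path_rate; case: asboolP. Qed.

Lemma measurable_driver_density gamma : Defs.AC gamma ->
  measurable_fun (`[0, +oo[%classic : set (measurableTypeR R)) (driver_density gamma).
Proof.
move=> acg; have [ld _] := driver_densityP gamma acg.
have -> : `[0, +oo[%classic = \bigcup_(k in @setT nat) `[0, k%:R]%classic :> set R.
  apply/seteqP; split => t /=; rewrite in_itv/= ?andbT.
    move=> t0; exists (Num.truncn t).+1 => //=; rewrite in_itv/= t0/= ltW//.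
    exact: truncnS_gt.
  by move=> [k _] /=; rewrite in_itv/= => /andP[].
apply/measurable_fun_bigcup; first by move=> k; exact: measurable_itv.
by move=> k; have /integrableP[/measurable_EFinP] := ld k%:R.
Qed.

(** On [[0, k]] the given [h] agrees almost everywhere with [driver_density], both having the same
    primitive. Monotone convergence in [k] then carries the bound to [[0, +oo[]. *)
Lemma path_rate_le gamma (C : R) : continuous gamma ->
  (forall k : nat, exists h, [/\ locint h,
     forall t, 0 <= t <= k%:R -> driver gamma t = prim h t &
     (\int[mu]_(t in `[0%R, k%:R]) (h t ^+ 2)%:E <= C%:E)%E]) ->
  (0 <= I0 (gamma 0%R))%E ->
  Defs.AC gamma /\ (rate gamma <= I0 (gamma 0%R) + (C / (2 * s2))%:E)%E.
Proof.
move=> cg H I00.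
have lg : locint gamma by exact: continuous_locint.
have acg : Defs.AC gamma.
  move=> T T0; have [h [lh hE _]] := H (Num.truncn T).+1.
  have lkg := locintZ kappa _ lg.
  exists (fun t => h t + kappa * gamma t); split; first exact: (locintD _ _ lh lkg).
  move=> t /andP[t0 tT].
  rewrite -/(prim (fun t => h t + kappa * gamma t) t) primD// primZ// -hE.
    by rewrite /driver; ring.
  by rewrite t0 (le_trans tT)// ltW// truncnS_gt.
split => //; rewrite path_rateE//; apply: leeD => //.
have mdd := measurable_driver_density gamma acg.
have [ldd ddE] := driver_densityP gamma acg.
have mdk (k : nat) : measurable_fun (`[0, k%:R]%classic : set (measurableTypeR R)) (driver_density gamma).
  by have /integrableP[/measurable_EFinP] := ldd k%:R.
have intk (k : nat) : (\int[mu]_(t in `[0%R, k%:R]) (driver_density gamma t ^+ 2)%:E <= C%:E)%E.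
  have [h [lh hE hC]] := H k; apply: le_trans hC; rewrite le_eqVlt; apply/orP; left; apply/eqP.
  have moo f : locint f -> measurable_fun (`]0, k%:R[%classic : set (measurableTypeR R)) (fun t => (f t ^+ 2)%:E).
    move=> lf; apply/measurable_EFinP; apply: measurable_funX.
    apply: (@measurable_funS _ _ _ _ (`[0, k%:R]%classic : set (measurableTypeR R))) => //.
      by apply: subset_itv; rewrite bnd_simp.
    by have /integrableP[/measurable_EFinP] := lf k%:R.
  rewrite [LHS]integral_itv_bndoo; last exact: moo.
  rewrite [RHS]integral_itv_bndoo; last exact: moo.
  apply: ae_eq_integral; [exact: measurable_itv|exact: moo|exact: moo|].
  have p0 t : 0 <= t <= k%:R -> prim (fun t => driver_density gamma t - h t) t = 0.
    by move=> tk; rewrite primB// -hE// -ddE ?subrr//; case/andP: tk.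
  have := prim_eq0_ae _ _ (locintB _ _ ldd lh) p0.
  apply: filterS; first exact: (ae_filter_ringOfSetsType mu).
  move=> t /= Ht; rewrite in_itv/= => tk.
  by have /eqP := Ht tk; rewrite subr_eq0 => /eqP ->.
have -> : (\int[mu]_(s in `[0%R, +oo[) (driver_density gamma s ^+ 2 / (2 * s2))%:E =
   (2 * s2)^-1%:E * \int[mu]_(s in `[0%R, +oo[) (driver_density gamma s ^+ 2)%:E)%E.
  rewrite -ge0_integralZl//=.
  - by apply: eq_integral => t _; rewrite -EFinM mulrC.
  - by apply/measurable_EFinP; exact: measurable_funX.
  - by move=> t _; rewrite lee_fin sqr_ge0.
  - by rewrite lee_fin invr_ge0 mulr_ge0// ltW.
rewrite [C / _]mulrC EFinM; apply: lee_wpmul2l; first by rewrite lee_fin invr_ge0 mulr_ge0// ltW.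
have E : `[0, +oo[%classic = \bigcup_k `[0, (k : nat)%:R]%classic :> set R.
  apply/seteqP; split => t /=; rewrite in_itv/= ?andbT.
    move=> t0; exists (Num.truncn t).+1 => //=; rewrite in_itv/= t0/= ltW//.
    exact: truncnS_gt.
  by move=> [k _] /=; rewrite in_itv/= => /andP[].
have cv : (\int[mu]_(x in `[0%R, i%:R]) (driver_density gamma x ^+ 2)%:E)%E
    @[i --> \oo] --> (\int[mu]_(x in `[0%R, +oo[) (driver_density gamma x ^+ 2)%:E)%E.
  rewrite E; apply: (@ge0_nondecreasing_set_cvg_integral _ _ _ (fun k : nat => `[0, k%:R]%classic : set (measurableTypeR R))).
  - move=> i j ij; apply/subsetPset; apply: subset_itvl.
    by rewrite bnd_simp ler_nat.
  - by move=> i; exact: measurable_itv.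
  - by move=> i; apply/measurable_EFinP; exact: measurable_funX.
  - by move=> i x _; rewrite lee_fin sqr_ge0.
rewrite -(cvg_lim _ cv)//; apply: lime_le; first by apply/cvg_ex; eexists; exact: cv.
exact: nearW.
Qed.

Definition rate_level (c : R) : set (skorohod R) := [set gamma | (rate gamma <= c%:E)%E].

Lemma rate_level_AC c gamma : rate_level c gamma -> Defs.AC gamma.
Proof.
by rewrite /rate_level/= /path_rate; case: asboolP => // _; rewrite leye_eq.
Qed.

Lemma rate_level_continuous c gamma : rate_level c gamma -> continuous gamma.
Proof. by move=> /rate_level_AC /AC_continuous. Qed.

Context (I0_ge0 : forall x, (0 <= I0 x)%E).

Lemma integral_driver_ge0 gamma : Defs.AC gamma ->
  (0 <= \int[mu]_(s in `[0%R, +oo[) (driver_density gamma s ^+ 2 / (2 * s2))%:E)%E.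
Proof.
move=> _; apply: integral_ge0 => t _.
by rewrite lee_fin divr_ge0 ?sqr_ge0// mulr_ge0// ltW.
Qed.

Lemma rate_ge0 gamma : (0 <= rate gamma)%E.
Proof.
rewrite /path_rate; case: asboolP => acg //.
by apply: adde_ge0 => //; exact: (integral_driver_ge0 gamma acg).
Qed.

Lemma rate_level_initial c gamma : rate_level c gamma -> (I0 (gamma 0%R) <= c%:E)%E.
Proof.
move=> rc; have acg := rate_level_AC c gamma rc.
move: rc; rewrite /rate_level/= path_rateE//; apply: le_trans.
by rewrite leeDl// integral_driver_ge0.
Qed.

Lemma driver_sum_le gamma tau J : Defs.AC gamma -> 0 < tau ->
  ((\sum_(j < J) (driver gamma (j.+1%:R * tau) - driver gamma (j%:R * tau)) ^+ 2 /
      (2 * s2 * tau))%:E <=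
   \int[mu]_(s in `[0%R, +oo[) (driver_density gamma s ^+ 2 / (2 * s2))%:E)%E.
Proof.
move=> acg tau0; have [ld dE] := driver_densityP gamma acg.
have mdd := measurable_driver_density gamma acg.
have c0 : 0 <= (2 * s2)^-1 by rewrite invr_ge0 mulr_ge0// ltW.
have -> : (\int[mu]_(s in `[0%R, +oo[) (driver_density gamma s ^+ 2 / (2 * s2))%:E =
   (2 * s2)^-1%:E * \int[mu]_(s in `[0%R, +oo[) (driver_density gamma s ^+ 2)%:E)%E.
  rewrite -ge0_integralZl//=.
  - by apply: eq_integral => t _; rewrite -EFinM mulrC.
  - by apply/measurable_EFinP; exact: measurable_funX.
  - by move=> t _; rewrite lee_fin sqr_ge0.
have -> : \sum_(j < J) (driver gamma (j.+1%:R * tau) - driver gamma (j%:R * tau)) ^+ 2 / (2 * s2 * tau) =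
  (2 * s2)^-1 * \sum_(j < J) (prim (driver_density gamma) (j.+1%:R * tau) -
      prim (driver_density gamma) (j%:R * tau)) ^+ 2 / tau.
  rewrite mulr_sumr; apply: eq_bigr => j _; rewrite !dE ?mulr_ge0 ?ler0n ?(ltW tau0)//.
  by field; rewrite !gt_eqF.
rewrite EFinM; apply: lee_wpmul2l; first by rewrite lee_fin.
apply: le_trans (sum_sqr_le_integral _ tau J ld tau0) _.
apply: ge0_subset_integral => //=.
- by apply/measurable_EFinP; exact: measurable_funX.
- by move=> t _; rewrite lee_fin sqr_ge0.
- by move=> t /=; rewrite !in_itv/= andbT => /andP[t0 _]; exact: ltW.
Qed.

Lemma rate_level_sum c gamma tau J : rate_level c gamma -> 0 < tau ->
  (I0 (gamma 0%R) + (\sum_(j < J) (driver gamma (j.+1%:R * tau) - driver gamma (j%:R * tau)) ^+ 2 /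
      (2 * s2 * tau))%:E <= c%:E)%E.
Proof.
move=> rc tau0; have acg := rate_level_AC c gamma rc.
move: rc; rewrite /rate_level/= path_rateE//; apply: le_trans.
by rewrite leeD2l// driver_sum_le.
Qed.

(** Cauchy-Schwarz, through [tangent_le_integral_sqr] at the mean slope: on a level set the drivers
    are uniformly Hoelder of exponent 1/2. *)
Lemma driver_holder c gamma s t : rate_level c gamma -> 0 <= s -> s <= t ->
  (driver gamma t - driver gamma s) ^+ 2 <= 2 * s2 * c * (t - s).
Proof.
move=> rc s0; rewrite le_eqVlt => /predU1P[->|st].
  by rewrite !subrr mulr0 expr0n.
have acg := rate_level_AC c gamma rc.
have [ld dE] := driver_densityP gamma acg.
have mdd := measurable_driver_density gamma acg.
have ts0 : 0 < t - s by rewrite subr_gt0.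
have intc : (\int[mu]_(u in `[0%R, +oo[) (driver_density gamma u ^+ 2)%:E <= (2 * s2 * c)%:E)%E.
  have : (\int[mu]_(u in `[0%R, +oo[) (driver_density gamma u ^+ 2 / (2 * s2))%:E <= c%:E)%E.
    move: (rc); rewrite /rate_level/= path_rateE//; apply: le_trans.
    by rewrite leeDr.
  have -> : (\int[mu]_(u in `[0%R, +oo[) (driver_density gamma u ^+ 2)%:E =
     (2 * s2)%:E * \int[mu]_(u in `[0%R, +oo[) (driver_density gamma u ^+ 2 / (2 * s2))%:E)%E.
    rewrite -ge0_integralZl//=.
    - by apply: eq_integral => u _; rewrite -EFinM; congr (_%:E); field; rewrite gt_eqF.
    - by apply/measurable_EFinP; apply: measurable_funM => //; exact: measurable_funX.
    - by move=> u _; rewrite lee_fin divr_ge0 ?sqr_ge0// mulr_ge0// ltW.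
    - by rewrite lee_fin mulr_ge0// ltW.
  by move=> H; rewrite [leRHS]EFinM; apply: lee_wpmul2l => //; rewrite lee_fin mulr_ge0// ltW.
set D := driver gamma t - driver gamma s.
have := tangent_le_integral_sqr _ (D / (t - s)) s t ld s0 (ltW st).
rewrite -!dE ?(le_trans s0 (ltW st))// -/D => H.
have : ((2 * (D / (t - s)) * D - (D / (t - s)) ^+ 2 * (t - s))%:E <= (2 * s2 * c)%:E)%E.
  apply: le_trans H _; apply: le_trans intc; apply: ge0_subset_integral => //=.
  - by apply/measurable_EFinP; exact: measurable_funX.
  - by move=> u _; rewrite lee_fin sqr_ge0.
  - by move=> u /=; rewrite !in_itv/= andbT => /andP[su _]; exact: le_trans s0 (ltW su).
rewrite lee_fin (_ : 2 * _ * D - _ = D ^+ 2 / (t - s)); last by field; rewrite gt_eqF.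
by rewrite ler_pdivrMr.
Qed.

End rate_function.

(** * Bounds and equicontinuity on level sets; curves with polygonal driver *)

Section rate_levels.
Context {R : realType}.
Notation mu := (@lebesgue_measure R).
Context (kappa s2 : R) (s2_gt0 : 0 < s2) (I0 : R -> \bar R).
Context (I0_good : good_rate_function I0).
Implicit Types (gamma : skorohod R).
Local Notation level := (rate_level kappa s2 I0).

Let I0_ge0 x : (0 <= I0 x)%E. Proof. by case: I0_good. Qed.

Lemma initial_level_bounded c : 0 <= c ->
  exists2 r, 0 <= r & forall x, (I0 x <= c%:E)%E -> `|x| <= r.
Proof.
move=> c0; have [_ /(_ c c0) /compact_bounded] := I0_good.
move=> /pinfty_ex_gt0[r r0 H]; exists r; first exact: ltW.
by move=> x Ix; apply: H.
Qed.

(** The initial value ranges in a compact set and the driver is bounded by its Hoelder estimate;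
    variation of constants transfers the bound to the curve. *)
Lemma level_bounded c T : 0 <= c -> 0 <= T ->
  exists2 B, 0 <= B & forall gamma t, level c gamma -> 0 <= t <= T -> `|gamma t| <= B.
Proof.
move=> c0 T0; have [r r0 Hr] := initial_level_bounded c c0.
(* The driver is bounded through [z <= 1 + z^2], which avoids a square root. *)
pose A := r + (1 + 2 * s2 * c * T).
have A0 : 0 <= A by rewrite addr_ge0// addr_ge0// !mulr_ge0// ltW.
pose E := expR (`|kappa| * T).
exists (A + `|kappa| * (E * (E * A * T))).
  by rewrite addr_ge0// !mulr_ge0// expR_ge0.
move=> gamma t lc /andP[t0 tT].
have cg := rate_level_continuous _ _ _ _ _ lc.
pose a s := gamma 0 + driver kappa gamma s.
have ca : continuous a.
  by move=> s; apply: cvgD; [exact: cvg_cst|exact: driver_continuous].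
have gE s : 0 <= s -> gamma s = a s + kappa * prim gamma s.
  by move=> _; rewrite /a /driver; ring.
have aA s : 0 <= s <= T -> `|a s| <= A.
  move=> /andP[sp sT]; apply: le_trans (ler_normD _ _) _; apply: lerD.
    by apply: Hr; exact: rate_level_initial lc.
  have := driver_holder _ _ s2_gt0 _ I0_ge0 c gamma 0 s lc (lexx _) sp.
  rewrite driver0 !subr0 => H.
  have H2 : driver kappa gamma s ^+ 2 <= 2 * s2 * c * T.
    by apply: le_trans H _; rewrite ler_wpM2l// !mulr_ge0// ltW.
  rewrite -(real_normK (num_real _)) in H2.
  by have := sqr_ge0 (`|driver kappa gamma s| - 1); move: H2; set z := `|_|; nra.
have Et s : 0 <= s <= T -> expR (kappa * s) <= E /\ expR (- kappa * s) <= E.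
  move=> /andP[sp sT]; have kT : `|kappa| * s <= `|kappa| * T by rewrite ler_wpM2l.
  rewrite !ler_expR; split; apply: le_trans kT; rewrite ler_wpM2r// ?ler_norm//.
  by rewrite -normrN ler_norm.
have cea : continuous (fun s => expR (- kappa * s) * a s).
  by move=> s; apply: cvgM; [exact: continuous_expR_lin|exact: ca].
rewrite gE//; apply: le_trans (ler_normD _ _) _; apply: lerD; first by apply: aA; rewrite t0.
rewrite normrM ler_wpM2l// (ode_uniq kappa gamma a t cg ca t0 gE) normrM.
have tT' : 0 <= t <= T by rewrite t0.
have [e1 _] := Et t tT'.
apply: ler_pM => //; first by rewrite ger0_norm ?expR_ge0// e1.
have := prim_norm_le _ (E * A) 0 t (continuous_locint _ cea) (lexx _) t0.
rewrite (prim_le0 _ 0)// !subr0 => H; apply: le_trans (H _) _.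
  move=> u /andP[u0 ut]; have uT : 0 <= u <= T by rewrite u0 (le_trans ut).
  have [_ e2] := Et u uT.
  rewrite normrM; apply: ler_pM => //; last exact: aA.
  by rewrite ger0_norm ?expR_ge0.
by rewrite ler_wpM2l// mulr_ge0// expR_ge0.
Qed.

Lemma level_modulus c T e : 0 <= c -> 0 <= T -> 0 < e ->
  exists2 theta, 0 < theta & forall gamma s t, level c gamma -> 0 <= s -> s <= t ->
    t <= T -> t - s <= theta ->
    `|gamma t - gamma s| <= e /\ `|driver kappa gamma t - driver kappa gamma s| <= e.
Proof.
move=> c0 T0 e0; have [B B0 HB] := level_bounded c T c0 T0.
have K0 : 0 <= 2 * s2 * c by rewrite !mulr_ge0// ltW.
pose t1 := (e / 2) ^+ 2 / (2 * s2 * c + 1).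
pose t2 := (e / 2) / (`|kappa| * B + 1).
have kB0 : 0 <= `|kappa| * B by rewrite mulr_ge0.
have t10 : 0 < t1 by rewrite divr_gt0 ?exprn_gt0 ?divr_gt0// ltr_wpDl.
have t20 : 0 < t2 by rewrite !divr_gt0// ltr_wpDl.
exists (Num.min t1 t2); first by rewrite lt_min t10.
move=> gamma s t lc s0 st tT; rewrite le_min => /andP[h1 h2].
have cg := rate_level_continuous _ _ _ _ _ lc.
have ts0 : 0 <= t - s by rewrite subr_ge0.
have e20 : 0 <= e / 2 by rewrite divr_ge0// ltW.
have d1 : `|driver kappa gamma t - driver kappa gamma s| <= e / 2.
  have := driver_holder _ _ s2_gt0 _ I0_ge0 c gamma s t lc s0 st.
  rewrite -(real_normK (num_real _)) => H.
  rewrite -(@ler_pXn2r _ 2) ?nnegrE//; apply: le_trans H _.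
  apply: (@le_trans _ _ ((2 * s2 * c + 1) * t1)).
    by apply: ler_pM => //; rewrite lerDl.
  by rewrite /t1 mulrC divfK// gt_eqF// ltr_wpDl.
have d2 : `|kappa * (prim gamma t - prim gamma s)| <= e / 2.
  rewrite normrM; apply: (@le_trans _ _ (`|kappa| * (B * (t - s)))).
    rewrite ler_wpM2l//; apply: prim_norm_le => //; first exact: continuous_locint.
    move=> u /andP[su ut]; apply: HB => //.
    by rewrite (le_trans s0)// (le_trans ut).
  rewrite mulrA; apply: (@le_trans _ _ ((`|kappa| * B + 1) * t2)).
    by apply: ler_pM => //; rewrite lerDl.
  by rewrite /t2 mulrC divfK// gt_eqF// ltr_wpDl.
split; last by apply: le_trans d1 _; rewrite ler_pdivrMr// ler_peMr// ?ler1n// ltW.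
have -> : gamma t - gamma s = (driver kappa gamma t - driver kappa gamma s) +
    kappa * (prim gamma t - prim gamma s) by rewrite /driver; ring.
by apply: le_trans (ler_normD _ _) _; apply: le_trans (lerD d1 d2) _; rewrite -splitr.
Qed.

Lemma skorohod_of_continuous (f : R -> R) : continuous f ->
  (forall t, t < 0 -> f t = f 0) -> exists gamma, (gamma : R -> R) = f.
Proof.
move=> cf f0.
have rc t : 0 <= t -> f s @[s --> t^'+] --> f t by move=> _; exact/cvg_at_right_filter/cf.
have lc t : 0 < t -> cvg (f s @[s --> t^'-]).
  by move=> _; apply/cvg_ex; exists (f t); exact/cvg_at_left_filter/cf.
by exists (Skorohod f0 rc lc).
Qed.

(** The driver with slope [u j] on block [j], constant after the last block, is inserted into the
    linear equation solved by [ode_exists]. This provides the curve of finite rate near a good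
    discrete path. *)
Lemma polygonal_path x0 J tau (u : nat -> R) : 0 < tau ->
  exists gamma, [/\ gamma 0 = x0, continuous gamma,
    (path_rate I0 (ou_lagrangian kappa s2) gamma <=
       I0 x0 + (\sum_(j < J) tau * u j ^+ 2 / (2 * s2))%:E)%E,
    forall j, (j <= J)%N -> driver kappa gamma (j%:R * tau) = tau * \sum_(i < j) u i &
    forall j t, (j < J)%N -> j%:R * tau <= t < j.+1%:R * tau ->
      `|driver kappa gamma t - driver kappa gamma (j%:R * tau)| <= `|tau * u j|].
Proof.
move=> tau0.
pose G j := if (j < J)%N then u j else 0.
pose h := stepf G tau.
have big T : exists N : nat, [/\ (J <= N)%N & T < N%:R * tau].
  exists (maxn J (Num.truncn (T / tau)).+1); rewrite leq_maxl; split => //.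
  rewrite -ltr_pdivrMr//; apply: lt_le_trans (truncnS_gt _) _.
  by rewrite ler_nat leq_maxr.
have lh : locint h.
  move=> T; have [N [_ TN]] := big T; have [iN _] := stepf_integral G tau N tau0.
  by apply: integrableS iN => //; apply: subset_itvl; rewrite bnd_simp.
have cp := prim_continuous h lh.
pose a t := x0 + prim h t.
have ca : continuous a by move=> t; apply: cvgD; [exact: cvg_cst|exact: cp].
pose x t := a t + kappa * (expR (kappa * t) * prim (fun s => expR (- kappa * s) * a s) t).
have [cx xE] : continuous x /\ forall t, 0 <= t -> x t = a t + kappa * prim x t.
  exact: ode_exists kappa a ca.
have xneg t : t <= 0 -> x t = x0.
  by move=> t0; rewrite /x /a !prim_le0// !mulr0 !addr0.
have [t t0|gamma gE] := skorohod_of_continuous x cx.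
  by rewrite !xneg// ltW.
have g0 : gamma 0 = x0 by rewrite gE xneg.
have dE t : 0 <= t -> driver kappa gamma t = prim h t.
  by move=> t0; rewrite /driver gE (xE t t0) xneg// /a; ring.
have pj j : (j <= J)%N -> prim h (j%:R * tau) = tau * \sum_(i < j) u i.
  move=> jJ; rewrite /prim -Rintegral_itv_bndo_bndc.
    have [_ ->] := stepf_integral G tau j tau0; congr (_ * _).
    by apply: eq_bigr => i _; rewrite /G (leq_trans (ltn_ord i) jJ).
  by have [] := stepf_integral G tau j tau0.
exists gamma; split => //.
- by rewrite gE.
- rewrite -g0.
  have -> : \sum_(j < J) tau * u j ^+ 2 / (2 * s2) = (tau * \sum_(j < J) u j ^+ 2) / (2 * s2).
    by rewrite mulr_sumr mulr_suml.
  apply: (proj2 (path_rate_le _ _ _ _ _ _ _ _ _)) => //; first by rewrite gE.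
  move=> k; exists h; split => //; first by move=> t /andP[t0 _]; exact: dE.
  have [N [JN kN]] := big k%:R.
  have [iN intN] := stepf_integral (fun j => G j ^+ 2) tau N tau0.
  have -> : tau * \sum_(j < J) u j ^+ 2 = tau * \sum_(j < N) G j ^+ 2.
    congr (_ * _); rewrite -(big_mkord xpredT (fun j => u j ^+ 2)) -(big_mkord xpredT (fun j => G j ^+ 2)).
    have G0 : \sum_(J <= i < N) G i ^+ 2 = 0.
      by rewrite big_nat_cond big1// => i /andP[/andP[Ji _] _]; rewrite /G ltnNge Ji expr0n.
    rewrite (@big_cat_nat _ _ _ J 0 N)//= G0 addr0.
    rewrite big_nat_cond [RHS]big_nat_cond; apply: eq_bigr => i /andP[/andP[_ iJ] _].
    by rewrite /G iJ.
  rewrite -intN /Rintegral fineK; last exact: integrable_fin_num.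
  apply: ge0_subset_integral => //=.
  + by have /integrableP[] := iN.
  + by move=> t _; rewrite lee_fin sqr_ge0.
  + by apply: subset_itvl; rewrite bnd_simp.
- by move=> j jJ; rewrite dE ?pj// mulr_ge0 ?ler0n ?ltW.
- move=> j t jJ /andP[jt tj]; have j0 : 0 <= j%:R * tau by rewrite mulr_ge0 ?ler0n ?ltW.
  have t0 := le_trans j0 jt.
  rewrite !dE//; apply: (@le_trans _ _ (`|u j| * (t - j%:R * tau))).
    apply: prim_norm_le => // v /andP[jv vt].
    by rewrite /h (stepfE _ _ j)// ?/G ?jJ//; exact: le_lt_trans tj.
  rewrite normrM (gtr0_norm tau0) mulrC ler_wpM2r//.
  by rewrite lerBlDl -[X in _ + X]mul1r -mulrDl natr1 ltW.
Qed.

End rate_levels.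

(** * Compactness of level sets and separation from closed sets *)

Section rate_compactness.
Context {R : realType}.
Notation mu := (@lebesgue_measure R).
Context (kappa s2 : R) (s2_gt0 : 0 < s2) (I0 : R -> \bar R).
Context (I0_good : good_rate_function I0).
Implicit Types (gamma y : skorohod R) (U : set_system (skorohod R)).
Local Notation level := (rate_level kappa s2 I0).

Let I0_ge0 x : (0 <= I0 x)%E. Proof. by case: I0_good. Qed.

Definition tube (T e : R) gamma : set (skorohod R) :=
  [set y | forall t, 0 <= t <= T -> `|y t - gamma t| <= e].

Lemma tube_skorohod_nbhd T e e' gamma : e < e' -> tube T e gamma `<=` skorohod_nbhd T e' gamma.
Proof.
move=> ee' y ty; exists id.
  by split => //; split => // t t0; exists t.
move=> t tT; have := ty t tT => H; rewrite subrr normr0; split; last exact: le_lt_trans H ee'.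
by apply: le_lt_trans ee'; apply: le_trans H.
Qed.

Definition ev (t : R) (y : skorohod R) : R := y t.

(** On a level set each coordinate stays in a compact interval, where the image of an ultrafilter
    converges. *)
Lemma level_pointwise_limit c U : UltraFilter U -> 0 <= c -> U (level c) ->
  exists f : R -> R, forall t, ev t @ U --> f t.
Proof.
move=> UU c0 Uc.
suff : forall t, exists l : R, ev t @ U --> l by move=> /choice[f Hf]; exists f.
have key t : 0 <= t -> exists l : R, ev t @ U --> l.
  move=> t0; have [B B0 HB] := level_bounded kappa s2 s2_gt0 I0 I0_good c t c0 t0.
  have FB : U [set y | `[- B, B]%classic (y t)].
    apply: filterS Uc => y yc /=; rewrite in_itv/= -ler_norml.
    by apply: HB => //; rewrite t0 lexx.
  have [l [_ Hl]] := @segment_compact R (- B) B _ (fmap_proper_filter (ev t) _) FB.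
  exists l => N Nl.
  have [//|UN] := in_ultra_setVsetC (fun y : skorohod R => N (y t)) UU.
  by have [z []] := Hl (~` N) N UN Nl.
move=> t; have [t0|t0] := leP 0 t; first exact: key.
have [l Hl] := key 0 (lexx _); exists l.
suff -> : ev t = ev 0 by [].
by apply/funext => y; rewrite /ev (path_neg y t0).
Qed.

Lemma level_limit_continuous c U (f : R -> R) : UltraFilter U -> 0 <= c -> U (level c) ->
  (forall t, ev t @ U --> f t) ->
  continuous f /\ forall t, t < 0 -> f t = f 0.
Proof.
move=> UU c0 Uc Uf.
have near_f t e : 0 < e -> U [set y | `|f t - y t| <= e].
  by move=> e0; have /cvgrPdist_le/(_ e e0) := Uf t.
have fneg t : t < 0 -> f t = f 0.
  move=> t0; have H : ev t @ U --> f 0.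
    suff -> : ev t = ev 0 by exact: Uf.
    by apply/funext => y; rewrite /ev (path_neg y t0).
  exact: (cvg_unique (@Rhausdorff R) (Uf t) H).
split => // t; apply/cvgrPdist_le => e e0.
pose T := `|t| + 1.
have T0 : 0 <= T by rewrite addr_ge0.
have e3 : 0 < e / 3 by rewrite divr_gt0.
have [theta th0 Hth] := level_modulus kappa s2 s2_gt0 I0 I0_good c T (e / 3) c0 T0 e3.
have fmod s u : 0 <= s -> s <= u -> u <= T -> u - s <= theta -> `|f u - f s| <= e.
  move=> s0 su uT us.
  have [y [[yc h1] h2]] : exists y, (level c `&` [set y | `|f s - y s| <= e / 3] `&` [set y | `|f u - y u| <= e / 3]) y.
    by apply: (@filter_ex _ U); apply: filterI; [apply: filterI|] => //; exact: near_f.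
  have [h3 _] := Hth y s u yc s0 su uT us.
  have -> : f u - f s = (f u - y u) + (y u - y s) - (f s - y s) by ring.
  apply: le_trans (ler_normB _ _) _; apply: le_trans (lerD (ler_normD _ _) h1) _.
  by move: h2 h3; rewrite /=; lra.
have fmax z : f z = f (Num.max z 0).
  by have [z0|z0] := leP 0 z; [|rewrite fneg].
apply/nbhs_ballP; exists (Num.min theta 1); first by rewrite /= lt_min th0 ltr01.
move=> z /=; rewrite /ball/= lt_min => /andP[h1 h2].
have mle : `|Num.max t 0 - Num.max z 0| <= `|t - z|.
  have [t0|t0] := leP 0 t; have [z0|z0] := leP 0 z => //.
  - by rewrite subr0 !ger0_norm// ?subr_ge0 ?(le_trans (ltW z0))//; lra.
  - by rewrite sub0r normrN (ger0_norm z0) ltr0_norm ?subr_lt0 ?(lt_le_trans t0)//; lra.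
  - by rewrite subrr normr0.
have mT x : `|t - x| < 1 -> Num.max x 0 <= T.
  move=> tx; rewrite ge_max T0 andbT /T.
  by have := ler_norm t; have := ler_norm (x - t); rewrite distrC; move: tx; lra.
rewrite fmax (fmax z).
have [zt|tz] := leP (Num.max z 0) (Num.max t 0).
  apply: fmod; [by rewrite le_max lexx orbT|exact: zt| |].
    by apply: mT; rewrite subrr normr0.
  by rewrite -[leLHS]ger0_norm ?subr_ge0//; apply: le_trans mle (ltW h1).
rewrite distrC; apply: fmod; [by rewrite le_max lexx orbT|exact: ltW|exact: mT h2|].
by rewrite -[leLHS]ger0_norm ?subr_ge0 ?(ltW tz)// distrC; exact: le_trans mle (ltW h1).
Qed.

(** Arzela-Ascoli with ultrafilters: equicontinuity upgrades the pointwise limit to a uniform one on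
    [[0, T]]. The discrete actions [Q] converge and the sublevels of [I0] are closed, so the initial
    cost plus any discrete action of the limit is at most [c]; [l2_density] turns this into a bound
    on the rate. *)
Lemma level_ultra c U : UltraFilter U -> 0 <= c -> U (level c) ->
  exists2 gamma, level c gamma & forall T e, 0 < e -> U (tube T e gamma).
Proof.
move=> UU c0 Uc.
have [f Uf] := level_pointwise_limit c U UU c0 Uc.
have [cf fneg] := level_limit_continuous c U f UU c0 Uc Uf.
have [gamma gE] := skorohod_of_continuous f cf fneg.
have {}Uf t : ev t @ U --> gamma t by rewrite gE.
have {}cf : continuous gamma by rewrite gE.
have near_f t e : 0 < e -> U [set y | `|gamma t - y t| <= e].
  by move=> e0; have /cvgrPdist_le/(_ e e0) := Uf t.
have Utube T e : 0 < e -> U (tube T e gamma).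
  move=> e0; have [T0|T0] := leP 0 T; last first.
    apply: filterS Uc => y _ t /andP[t0 tT].
    by move: (le_lt_trans (le_trans t0 tT) T0); rewrite ltxx.
  have e3 : 0 < e / 3 by rewrite divr_gt0.
  have [theta th0 Hth] := level_modulus kappa s2 s2_gt0 I0 I0_good c T (e / 3) c0 T0 e3.
  have gmod s u : 0 <= s -> s <= u -> u <= T -> u - s <= theta -> `|gamma u - gamma s| <= e / 3.
    move=> s0 su uT us; apply/ler_addgt0Pr => d d0; have d2 : 0 < d / 2 by rewrite divr_gt0.
    have [y [[yc h1] h2]] : exists y, (level c `&` [set y | `|gamma s - y s| <= d / 2] `&` [set y | `|gamma u - y u| <= d / 2]) y.
      by apply: (@filter_ex _ U); apply: filterI; [apply: filterI|] => //; exact: near_f.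
    have [h3 _] := Hth y s u yc s0 su uT us.
    have -> : gamma u - gamma s = (gamma u - y u) + (y u - y s) - (gamma s - y s) by ring.
    apply: le_trans (ler_normB _ _) _; apply: le_trans (lerD (ler_normD _ _) h1) _.
    by move: h2 h3; rewrite /=; lra.
  have net N : U [set y | forall i, (i <= N)%N -> `|gamma (i%:R * theta) - y (i%:R * theta)| <= e / 3].
    elim: N => [|N IH].
      by apply: filterS (near_f (0%:R * theta) _ e3) => y /= h i; rewrite leqn0 => /eqP ->.
    apply: filterS (filterI IH (near_f (N.+1%:R * theta) _ e3)) => y /= [h1 h2] i.
    by rewrite leq_eqVlt => /predU1P[->//|]; exact: h1.
  apply: filterS (filterI Uc (net (Num.truncn (T / theta)))) => y [yc hy] t /andP[t0 tT].
  pose i := Num.truncn (t / theta).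
  have /andP[i1 i2] : i%:R <= t / theta < i.+1%:R by apply: truncn_itv; rewrite divr_ge0// ltW.
  rewrite ler_pdivlMr// in i1; rewrite ltr_pdivrMr// -natr1 mulrDl mul1r in i2.
  have i0 : 0 <= i%:R * theta by rewrite mulr_ge0 ?ler0n ?ltW.
  have ti : t - i%:R * theta <= theta by rewrite lerBlDl ltW.
  have [h1 _] := Hth y _ t yc i0 i1 tT ti.
  have h2 := gmod _ t i0 i1 tT ti.
  have -> : y t - gamma t = (y t - y (i%:R * theta)) - (gamma (i%:R * theta) - y (i%:R * theta)) - (gamma t - gamma (i%:R * theta)) by ring.
  apply: le_trans (ler_normB _ _) _; apply: le_trans (lerD (ler_normB _ _) h2) _.
  have : `|gamma (i%:R * theta) - y (i%:R * theta)| <= e / 3.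
    apply: hy; rewrite -ltnS -(ltr_nat R); apply: le_lt_trans (truncnS_gt (T / theta)).
    by rewrite ler_pdivlMr// (le_trans i1).
  by move: h1; lra.
exists gamma => //.
have lg : locint gamma by exact: continuous_locint.
have Udriver t : 0 <= t -> (fun y : skorohod R => driver kappa y t) @ U --> driver kappa gamma t.
  move=> t0; apply/cvgrPdist_le => e e0.
  pose e' := e / (2 + `|kappa| * t).
  have k0 : 0 < 2 + `|kappa| * t by rewrite ltr_pwDl// mulr_ge0.
  have e'0 : 0 < e' by rewrite divr_gt0.
  apply: filterS (filterI Uc (Utube t e' e'0)) => y [yc ty].
  have ly : locint y by exact/continuous_locint/(rate_level_continuous _ _ _ _ _ yc).
  have h1 : `|y t - gamma t| <= e' by apply: ty; rewrite t0 lexx.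
  have h2 : `|y 0 - gamma 0| <= e' by apply: ty; rewrite t0 lexx.
  have h3 : `|prim y t - prim gamma t| <= e' * t.
    rewrite -primB// -[prim _ t]subr0 -(prim_le0 (fun s => y s - gamma s) 0)// -[X in e' * X]subr0.
    by apply: prim_norm_le => //; exact: locintB.
  have h4 : `|kappa * (prim y t - prim gamma t)| <= `|kappa| * (e' * t).
    by rewrite normrM ler_wpM2l.
  rewrite distrC.
  have -> : driver kappa y t - driver kappa gamma t = (y t - gamma t) - (y 0 - gamma 0) - kappa * (prim y t - prim gamma t).
    by rewrite /driver; ring.
  apply: le_trans (ler_normB _ _) _; apply: le_trans (lerD (ler_normB _ _) h4) _.
  have -> : e = 2 * e' + `|kappa| * (e' * t) by rewrite /e'; field; rewrite gt_eqF.
  by rewrite lerD2r; move: h1 h2; lra.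
pose Q (y : skorohod R) tau J := \sum_(j < J) (driver kappa y (j.+1%:R * tau) - driver kappa y (j%:R * tau)) ^+ 2 / (2 * s2 * tau).
have UQ tau J : 0 < tau -> (fun y => Q y tau J) @ U --> Q gamma tau J.
  move=> tau0; elim: J => [|J IH].
    by rewrite /Q big_ord0; under eq_fun do rewrite big_ord0; exact: cvg_cst.
  rewrite /Q big_ord_recr/=; under eq_fun do rewrite big_ord_recr/=.
  apply: cvgD; first exact: IH.
  apply: cvgM; last exact: cvg_cst.
  have d (k : nat) : (fun y : skorohod R => driver kappa y (k%:R * tau)) @ U --> driver kappa gamma (k%:R * tau).
    by apply: Udriver; rewrite mulr_ge0 ?ler0n ?ltW.
  by apply: cvgM; apply: cvgB; exact: d.
have IQ tau J : 0 < tau -> (I0 (gamma 0%R) <= (c - Q gamma tau J)%:E)%E.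
  move=> tau0; apply/lee_addgt0Pr => e e0; rewrite -EFinD.
  set b := c - Q gamma tau J + e.
  have Ub : U [set y | (I0 (y 0%R) <= b%:E)%E].
    have : U [set y | `|Q gamma tau J - Q y tau J| <= e] by have /cvgrPdist_le/(_ e e0) := UQ tau J tau0.
    move=> /(filterI Uc); apply: filterS => y /= [yc yQ].
    have := rate_level_sum kappa s2 s2_gt0 I0 c y tau J yc tau0.
    rewrite -/(Q y tau J) -leeBrDr// => /le_trans; apply.
    by rewrite -EFinB lee_fin /b; move: yQ; rewrite ler_norml => /andP[_]; lra.
  have b0 : 0 <= b.
    have [y /= yb] := @filter_ex _ U _ _ Ub.
    by rewrite -lee_fin; exact: le_trans yb.
  have [_ /(_ b b0) cpt] := I0_good.
  have clo := compact_closed (@Rhausdorff R) cpt.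
  exact: (@closed_cvg _ _ U _ (ev 0) (fun x => (I0 x <= b%:E)%E) clo Ub _ (Uf 0)).
have I0fin : I0 (gamma 0%R) \is a fin_num.
  rewrite ge0_fin_numE//; apply: le_lt_trans (IQ 1 0%N ltr01) _; exact: ltry.
pose i0 := fine (I0 (gamma 0%R)).
have i0E : I0 (gamma 0%R) = i0%:E by rewrite fineK.
have QC tau J : 0 < tau -> \sum_(j < J) (driver kappa gamma (j.+1%:R * tau) - driver kappa gamma (j%:R * tau)) ^+ 2 / tau <= 2 * s2 * (c - i0).
  move=> tau0; have := IQ tau J tau0; rewrite i0E lee_fin => H.
  apply: (@le_trans _ _ (2 * s2 * Q gamma tau J)).
    rewrite /Q mulr_sumr le_eqVlt; apply/orP; left; apply/eqP; apply: eq_bigr => j _.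
    by field; rewrite !gt_eqF.
  by rewrite ler_pM2l ?mulr_gt0//; move: H; lra.
have [k|//|acg rg] := path_rate_le kappa s2 s2_gt0 I0 gamma (2 * s2 * (c - i0)) cf.
  have cd := driver_continuous kappa gamma cf.
  have [||h [lh hE hC]] := l2_density (driver kappa gamma) k.+1%:R (2 * s2 * (c - i0)) cd.
  - by rewrite ltr0n.
  - by move=> N; apply: QC; rewrite divr_gt0 ?ltr0n// exprn_gt0.
  have kk : k%:R <= k.+1%:R :> R by rewrite ler_nat.
  exists h; split => //.
    by move=> t /andP[t0 tk]; rewrite -hE ?driver0 ?subr0// t0 (le_trans tk kk).
  apply: le_trans hC; apply: ge0_subset_integral => //=.
  - apply/measurable_EFinP; apply: measurable_funX.
    by have /integrableP[/measurable_EFinP] := lh k.+1%:R.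
  - by move=> t _; rewrite lee_fin sqr_ge0.
  - by apply: subset_itvl; rewrite bnd_simp.
rewrite /rate_level/=; apply: le_trans rg _; rewrite i0E -EFinD lee_fin.
rewrite (_ : 2 * s2 * _ / _ = c - i0); last by field; rewrite gt_eqF.
by lra.
Qed.

End rate_compactness.

Section rate_topology.
Context {R : realType}.
Context (kappa s2 : R) (s2_gt0 : 0 < s2) (I0 : R -> \bar R).
Context (I0_good : good_rate_function I0).
Implicit Types (gamma y : skorohod R).
Local Notation level := (rate_level kappa s2 I0).
Local Notation rate := (path_rate I0 (ou_lagrangian kappa s2)).

Lemma skorohod_open_tube (O : set (skorohod R)) gamma : open O -> O gamma ->
  exists T e, 0 < e /\ tube T e gamma `<=` O.
Proof.
move=> oO Og; have [T [e [e0 H]]] := (oO : skorohod_open O) gamma Og.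
exists T, (e / 2); split; first by rewrite divr_gt0.
move=> y ty; apply: H; apply: (tube_skorohod_nbhd T (e / 2)) => //.
by rewrite ltr_pdivrMr// ltr_pMr// ltr1n.
Qed.

Lemma path_rate_good : good_rate_function rate.
Proof.
have I0_ge0 x : (0 <= I0 x)%E by case: I0_good.
split; first exact: rate_ge0.
move=> c c0; rewrite compact_ultra => F UF FA.
have [gamma lg Ht] := level_ultra kappa s2 s2_gt0 I0 I0_good c F UF c0 FA.
exists gamma; split => //; move=> N; rewrite nbhsE; case=> O [oO Og] ON.
have [T [e [e0 H]]] := skorohod_open_tube O gamma oO Og.
by apply: filterS (Ht T e e0) => y /H /ON.
Qed.

(** Otherwise, for every [k], some curve of the level set has a point of [A] in its tube of width
    [1 / (k + 1)] over [[0, k]]. An ultrafilter containing all these sets of curves converges to a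
    curve of the level set, every tube of which meets [A]; but the complement of [A] is open. *)
Lemma closed_separation (A : set (skorohod R)) c : 0 <= c -> closed A ->
  (forall gamma, level c gamma -> ~ A gamma) ->
  exists T : nat, exists2 e, 0 < e & forall gamma y, level c gamma -> A y ->
    ~ tube T%:R e gamma y.
Proof.
move=> c0 cA disj; apply: contrapT => nsep.
pose B (k : nat) := [set gamma | level c gamma /\ exists2 y, A y & tube k%:R k.+1%:R^-1 gamma y].
have Bn k : B k !=set0.
  apply: contrapT => Bk; apply: nsep; exists k; exists (k.+1%:R^-1).
    by rewrite invr_gt0 ltr0n.
  by move=> gamma y lg Ay ty; apply: Bk; exists gamma; split => //; exists y.
have Bdec j k : (j <= k)%N -> B k `<=` B j.
  move=> jk gamma [lg [y Ay ty]]; split => //; exists y => // t /andP[t0 tj].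
  apply: le_trans (ty t _) _; first by rewrite t0 (le_trans tj)// ler_nat.
  by rewrite lef_pV2 ?posrE ?ltr0n// ler_nat ltnS.
have FF : Filter (filter_from setT B).
  apply: filter_from_filter; first by exists 0%N.
  move=> i j _ _; exists (maxn i j) => // gamma Bg.
  by split; apply: Bdec Bg; rewrite ?leq_maxl ?leq_maxr.
have PF : ProperFilter (filter_from setT B).
  by apply: filter_from_proper => k _; exact: Bn.
have [U [UU FU]] := ultraFilterLemma PF.
have UB k : U (B k) by apply: FU; exists k.
have Ul : U (level c) by apply: filterS (UB 0%N) => gamma [].
have [gamma lg Ht] := level_ultra kappa s2 s2_gt0 I0 I0_good c U UU c0 Ul.
have oAC : open (~` A) by exact: closed_openC.
have [T [e [e0 H]]] := skorohod_open_tube _ gamma oAC (disj gamma lg).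
have e2 : 0 < e / 2 by rewrite divr_gt0.
have [k [kT ke]] : exists k : nat, T <= k%:R /\ k.+1%:R^-1 <= e / 2.
  exists (maxn (Num.truncn T).+1 (Num.truncn (e / 2)^-1).+1); split.
    by apply: le_trans (ltW (truncnS_gt T)) _; rewrite ler_nat leq_maxl.
  rewrite -[leRHS]invrK lef_pV2 ?posrE ?invr_gt0 ?ltr0n//.
  apply: le_trans (ltW (truncnS_gt _)) _; rewrite ler_nat; apply: leqW.
  exact: leq_maxr.
have [x [[lx [y Ay ty]] tx]] : (B k `&` tube T (e / 2) gamma) !=set0.
  by apply: (@filter_ex _ U); apply: filterI; [exact: UB|exact: Ht].
apply: (H y _ Ay) => t /andP[t0 tT].
have h1 := ty t; have h2 := tx t.
have -> : y t - gamma t = (y t - x t) + (x t - gamma t) by ring.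
apply: le_trans (ler_normD _ _) _.
have {}h1 : `|y t - x t| <= e / 2 by apply: le_trans (h1 _) ke; rewrite t0 (le_trans tT).
have {}h2 : `|x t - gamma t| <= e / 2 by apply: h2; rewrite t0.
by move: h1 h2; lra.
Qed.

End rate_topology.

(** * Time changes and paths with finitely many values *)

Section time_changes.
Context {R : realType}.

(** Affine from [[a i, a i.+1[] onto [[b i, b i.+1[], and a translation from [a L] on. On each piece
    [l t - t] is a convex combination of its values at the two ends, whence the uniform bound
    [h]. *)
Lemma piecewise_linear_time_change (a b : nat -> R) h L :
  a 0%N = 0 -> b 0%N = 0 -> (forall i, a i < a i.+1) -> (forall i, b i < b i.+1) ->
  (forall i, `|b i - a i| <= h) ->
  exists l : R -> R,
   [/\ (forall s t, 0 <= s -> s < t -> l s < l t),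
       (forall u, 0 <= u -> exists2 t, 0 <= t & l t = u),
       (forall t, 0 <= t -> 0 <= l t /\ `|l t - t| <= h),
       (forall i t, (i < L)%N -> a i <= t < a i.+1 -> b i <= l t < b i.+1) &
       (forall t, a L <= t -> l t = t + (b L - a L))].
Proof.
move=> a0 b0 aS bS hab.
have a_ge0 i : 0 <= a i by elim: i => [|i IH]; rewrite ?a0// (le_trans IH)// ltW.
have b_ge0 i : 0 <= b i by elim: i => [|i IH]; rewrite ?b0// (le_trans IH)// ltW.
have amono i j : (i <= j)%N -> a i <= a j.
  by elim: j => [|j IH]; rewrite leq_eqVlt => /predU1P[->//|]//; rewrite ltnS => /IH /le_trans; apply; exact: ltW.
elim: L => [|L [l [lmono lsurj lh lcell ltail]]].
  exists id; split => //.
  - by move=> u u0; exists u.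
  - by move=> t t0; split => //; rewrite subrr normr0 (le_trans _ (hab 0%N)).
  - by move=> t _; rewrite a0 b0 subrr addr0.
have da : 0 < a L.+1 - a L by rewrite subr_gt0.
have db : 0 < b L.+1 - b L by rewrite subr_gt0.
pose sg := (b L.+1 - b L) / (a L.+1 - a L).
have sg0 : 0 < sg by rewrite divr_gt0.
have sga : sg * (a L.+1 - a L) = b L.+1 - b L by rewrite /sg divfK// gt_eqF.
pose l' t := if t < a L then l t else if t < a L.+1 then b L + (t - a L) * sg
  else t + (b L.+1 - a L.+1).
have l1 t : t < a L -> l' t = l t by move=> h1; rewrite /l' h1.
have l2 t : a L <= t -> t < a L.+1 -> l' t = b L + (t - a L) * sg.
  by move=> h1 h2; rewrite /l' ltNge h1/= h2.
have l3 t : a L.+1 <= t -> l' t = t + (b L.+1 - a L.+1).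
  move=> h1; have h2 : a L <= t by rewrite (le_trans (ltW (aS L))).
  by rewrite /l' !ltNge h1 h2.
have laL : l (a L) = b L by rewrite ltail//; ring.
have b1 t : 0 <= t -> t < a L -> l' t < b L.
  by move=> t0 tL; rewrite l1// -laL; exact: lmono.
have b2 t : a L <= t -> t < a L.+1 -> b L <= l' t < b L.+1.
  move=> h1 h2; rewrite l2//; have : 0 <= (t - a L) * sg by rewrite mulr_ge0 ?subr_ge0// ltW.
  have : (t - a L) * sg < (a L.+1 - a L) * sg by rewrite ltr_pM2r// ltrD2r.
  by rewrite [X in _ < X]mulrC sga => h3 h4; apply/andP; split; lra.
have b3 t : a L.+1 <= t -> b L.+1 <= l' t by move=> h1; rewrite l3//; lra.
exists l'; split.
- move=> s t s0 st.
  have [sL|sL] := ltP s (a L).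
    have [tL|tL] := ltP t (a L); first by rewrite !l1//; exact: lmono.
    apply: lt_le_trans (b1 s s0 sL) _.
    have [tL1|tL1] := ltP t (a L.+1); first by have /andP[] := b2 t tL tL1.
    by apply: le_trans (ltW (bS L)) (b3 t tL1).
  have tL : a L <= t by rewrite (le_trans sL)// ltW.
  have [tL1|tL1] := ltP t (a L.+1).
    have sL1 : s < a L.+1 by exact: lt_trans tL1.
    by rewrite !l2// ltrD2l ltr_pM2r// ltrD2r.
  have [sL1|sL1] := ltP s (a L.+1).
    by apply: lt_le_trans (b3 t tL1); have /andP[] := b2 s sL sL1.
  by rewrite !l3// ltrD2r.
- move=> u u0; have [uL|uL] := ltP u (b L).
    have [t t0 lt] := lsurj u u0; exists t => //; rewrite l1//.
    rewrite ltNge; apply/negP => aLt; move: uL; rewrite -lt ltail// ltNge; apply/negP/negPn.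
    by lra.
  have [uL1|uL1] := ltP u (b L.+1).
    have s1 : 0 <= (u - b L) / sg by rewrite divr_ge0 ?subr_ge0// ltW.
    have s2 : (u - b L) / sg < a L.+1 - a L.
      by rewrite ltr_pdivrMr// mulrC sga ltrD2r.
    exists (a L + (u - b L) / sg); first by rewrite addr_ge0.
    rewrite l2; last 2 first.
    + by rewrite lerDl.
    + by move: s2; lra.
    by rewrite addrAC subrr add0r divfK ?gt_eqF//; ring.
  exists (u - b L.+1 + a L.+1); first by rewrite addr_ge0// subr_ge0.
  by rewrite l3; [ring|rewrite lerDr subr_ge0].
- move=> t t0; have [tL|tL] := ltP t (a L); first by rewrite l1//; exact: lh.
  have [tL1|tL1] := ltP t (a L.+1); last first.
    split; first by apply: le_trans (b3 t tL1).
    by rewrite l3// addrAC subrr add0r.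
  have /andP[h1 _] := b2 t tL tL1; split; first exact: le_trans h1.
  have := hab L; have := hab L.+1; rewrite !ler_norml => /andP[h2 h3] /andP[h4 h5].
  pose lam := (t - a L) / (a L.+1 - a L).
  have lam0 : 0 <= lam by rewrite divr_ge0 ?subr_ge0// ltW.
  have lam1 : lam <= 1 by rewrite ler_pdivrMr// mul1r lerD2r ltW.
  have -> : l' t - t = (1 - lam) * (b L - a L) + lam * (b L.+1 - a L.+1).
    by rewrite l2// /lam /sg; field; rewrite gt_eqF.
  by apply/andP; split; nra.
- move=> i t; rewrite ltnS leq_eqVlt => /predU1P[->|iL] /andP[h1 h2]; first exact: b2.
  rewrite l1; first by apply: lcell => //; rewrite h1.
  by apply: lt_le_trans h2 _; exact: amono.
- by move=> t h1; rewrite l3.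
Qed.

End time_changes.

Section finite_valued_paths.
Context {R : realType} (n : nat) (n_gt0 : (0 < n)%N).
Implicit Types (y : skorohod R).

Definition finite_valued y := forall t, 0 <= t -> E_ n (y t).

Lemma E_gap (u v : R) : E_ n u -> E_ n v -> `|u - v| < n%:R^-1 -> u = v.
Proof.
move=> [i _ <-] [j _ <-] H.
have n0 : 0 < n%:R :> R by rewrite ltr0n.
suff : nat_of_ord i = nat_of_ord j by move=> /val_inj ->.
move: H; rewrite /magn (_ : _ - _ = 2 * (i%:R - j%:R) / n%:R); last by field; rewrite gt_eqF.
rewrite !normrM normr_nat normfV [`|n%:R|]gtr0_norm// ltr_pdivrMr// mulVf ?gt_eqF//.
move=> H; have [ij|ij|//] := ltngtP i j; exfalso.
  have : (i.+1%:R : R) <= j%:R by rewrite ler_nat.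
  by move: H; rewrite -natr1 => + pq; rewrite ler0_norm; lra.
have : (j.+1%:R : R) <= i%:R by rewrite ler_nat.
by move: H; rewrite -natr1 => + pq; rewrite ger0_norm; lra.
Qed.

Lemma const_right y x : finite_valued y -> 0 <= x ->
  exists2 e, 0 < e & forall s, x <= s < x + e -> y s = y x.
Proof.
move=> fy x0.
have n0 : 0 < (n%:R : R)^-1 by rewrite invr_gt0 ltr0n.
have /cvgrPdist_lt/(_ _ n0) := @path_right_cont R y x x0.
move=> [e /= e0 He]; exists e => // s /andP[xs se].
have [->//|sx] := eqVneq s x.
have xs' : x < s by rewrite lt_neqAle eq_sym sx.
apply/esym/E_gap; [exact: fy|exact/fy/(le_trans x0)|].
apply: He => //=; rewrite ltr0_norm ?subr_lt0//; lra.
Qed.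

Lemma const_left y x : finite_valued y -> 0 < x ->
  exists2 e, 0 < e & forall s t, 0 <= s -> x - e < s < x -> 0 <= t -> x - e < t < x -> y s = y t.
Proof.
move=> fy x0.
have n0 : 0 < (n%:R : R)^-1 / 2 by rewrite divr_gt0 ?invr_gt0 ?ltr0n.
have /cvg_ex[l] := @path_left_lim R y x x0.
move=> /cvgrPdist_lt/(_ _ n0)[e /= e0 He]; exists e => // s t s0 /andP[s1 s2] t0 /andP[t1 t2].
have hs : `|l - y s| < n%:R^-1 / 2 by apply: He => //=; rewrite gtr0_norm ?subr_gt0//; lra.
have ht : `|l - y t| < n%:R^-1 / 2 by apply: He => //=; rewrite gtr0_norm ?subr_gt0//; lra.
apply: E_gap; [exact: fy|exact: fy|].
have -> : y s - y t = (l - y t) - (l - y s) by ring.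
by apply: le_lt_trans (ler_normB _ _) _; lra.
Qed.

Definition grid (N k : nat) : R := k%:R / 2 ^+ N.

Lemma grid_ge0 N k : 0 <= grid N k.
Proof. by rewrite divr_ge0 ?exprn_ge0. Qed.

Lemma gridS N k : grid N k.+1 = grid N k + 2 ^- N.
Proof. by rewrite /grid -natr1 mulrDl mul1r. Qed.

(** At most one jump, stated without reference to a jump time, so that it can be tested on countably
    many times. *)
Definition one_jump y (q r : R) := forall s t, q <= s -> s <= t -> t <= r ->
  y s = y q \/ y t = y r.

Definition nice (N T : nat) y := forall k, (k < T * 2 ^ N)%N ->
  one_jump y (grid N k) (grid N k.+1).

Lemma half_exp_lt (e : R) : 0 < e -> \forall N \near \oo, 2 ^- N < e.
Proof.
move=> e0; near=> N.
rewrite -[e]invrK ltf_pV2 ?posrE ?invr_gt0 ?exprn_gt0//.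
apply: lt_le_trans (truncnS_gt _) _; rewrite -natrX ler_nat.
apply: leq_trans (ltnW (ltn_expl N (ltnSn 1))).
by near: N; exact: nbhs_infty_ge.
Unshelve. all: by end_near. Qed.

Lemma one_jump_near y x : finite_valued y -> 0 <= x ->
  exists2 e, 0 < e & forall q r, 0 <= q -> x - e < q -> r < x + e -> one_jump y q r.
Proof.
move=> fy x0; have [e1 e10 H1] := const_right y x fy x0.
have [e2 e20 H2] : exists2 e, 0 < e & forall s t, 0 <= s -> x - e < s < x ->
    0 <= t -> x - e < t < x -> y s = y t.
  move: x0; rewrite le_eqVlt => /predU1P[x0|x0]; last exact: const_left.
  exists 1 => // s t s0 /andP[_]; rewrite -x0 => sx.
  by move: (le_lt_trans s0 sx); rewrite ltxx.
exists (Num.min e1 e2); first by rewrite lt_min e10.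
move=> q r q0 xq rx s t qs st tr.
have q2 : x - e2 < q by apply: le_lt_trans xq; rewrite lerD2l lerN2 ge_min lexx orbT.
have r1 : r < x + e1 by apply: lt_le_trans rx _; rewrite lerD2l ge_min lexx.
have [sx|xs] := ltP s x.
  left; apply: H2 => //; rewrite ?(le_trans q0)// ?sx ?andbT ?(lt_le_trans q2)//=.
  exact: le_lt_trans sx.
right; rewrite (H1 t) ?(H1 r)//.
  by rewrite (le_trans xs (le_trans st tr)).
by rewrite (le_trans xs st) (le_lt_trans tr).
Qed.

(** Because its values are separated, the path is constant just before and just after each time, so
    short intervals near that time contain at most one jump; compactness of [[0, T]] makes the
    length uniform. *)
Lemma nice_near y T : finite_valued y -> \forall N \near \oo, nice N T y.
Proof.
move=> fy.
have cpt : compact `[0 : R, T%:R] by exact: segment_compact.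
pose P (N : nat) (x : R) := 0 <= x -> one_jump y x (x + 2 ^- N).
have HP : forall x, `[0 : R, T%:R]%classic x -> \forall x' \near x & N \near \oo, P N x'.
  move=> x /=; rewrite in_itv/= => /andP[x0 _].
  have [e e0 He] := one_jump_near y x fy x0.
  have e2 : 0 < e / 2 by rewrite divr_gt0.
  exists (ball x (e / 2), [set N | 2 ^- N < e / 2]) => /=.
    by split; [exact: nbhsx_ballx|exact: half_exp_lt].
  move=> [x' N] /= []; rewrite /ball/= ltr_norml => /andP[h1 h2] hN x'0.
  by apply: He => //; lra.
move/compact_near_coveringP : cpt => /(_ nat \oo P _ HP) H.
near=> N => k kT.
have : `[0 : R, T%:R]%classic `<=` P N by near: N.
move=> /(_ (grid N k)); rewrite /P -gridS; apply; last exact: grid_ge0.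
rewrite /= in_itv/= grid_ge0/= /grid ler_pdivrMr ?exprn_gt0//.
by rewrite -natrX -natrM ler_nat ltnW.
Unshelve. all: by end_near. Qed.

Lemma nice_grid y N T t : nice N T y -> 0 <= t -> t < T%:R ->
  exists k, [/\ (k < T * 2 ^ N)%N, grid N k <= t, t < grid N k.+1 &
    y t = y (grid N k) \/ y t = y (grid N k.+1)].
Proof.
move=> ny t0 tT; pose k := Num.truncn (t * 2 ^+ N).
have p0 : (0 : R) < 2 ^+ N by rewrite exprn_gt0.
have /andP[k1 k2] : k%:R <= t * 2 ^+ N < k.+1%:R by apply: truncn_itv; rewrite mulr_ge0// ltW.
have c1 : grid N k <= t by rewrite /grid ler_pdivrMr.
have c2 : t < grid N k.+1 by rewrite /grid ltr_pdivlMr.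
have kT : (k < T * 2 ^ N)%N.
  rewrite -(ltr_nat R) natrM natrX; apply: le_lt_trans k1 _.
  by rewrite ltr_pM2r.
exists k; split => //; by have [->|->] := ny k kT t t c1 (lexx _) (ltW c2); [left|right].
Qed.

(* The first time at which the value [y r] is taken. *)
Lemma jump_time y q r : finite_valued y -> 0 <= q -> q < r -> one_jump y q r ->
  exists tau, [/\ q < tau, tau <= r, forall s, q <= s -> s < tau -> y s = y q &
    forall s, tau <= s -> s <= r -> y s = y r].
Proof.
move=> fy q0 qr oj.
have [yqr|yqr] := pselect (y q = y r).
  exists r; split => // s h1 h2.
    by have [//|] := oj s s h1 (lexx _) (ltW h2); rewrite yqr.
  by have -> : s = r by apply/eqP; rewrite eq_le h1 h2.
pose A := [set s | q <= s <= r /\ y s = y r].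
have Ar : A r by rewrite /A/= lexx (ltW qr).
have lbA : lbound A q by move=> s [/andP[]].
have hiA : has_inf A by split; [exists r|exists q].
pose tau := inf A.
have tr : tau <= r by apply: ge_inf => //; exists q.
have [e1 e10 H1] := const_right y q fy q0.
have qtau : q < tau.
  apply: (@lt_le_trans _ _ (q + e1)); first by rewrite ltrDl.
  apply: lb_le_inf; first by exists r.
  move=> s [/andP[qs sr] ys]; rewrite leNgt; apply/negP => se.
  by apply: yqr; rewrite -ys H1// qs.
have before s : q <= s -> s < tau -> y s = y q.
  move=> qs st; have [//|ys] := oj s s qs (lexx _) (le_trans (ltW st) tr).
  have : tau <= s by apply: ge_inf; [exists q|split => //; rewrite qs (le_trans (ltW st) tr)].
  by rewrite leNgt st.
have ytau : y tau = y r.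
  have [yt|//] := oj tau tau (ltW qtau) (lexx _) tr.
  have [e2 e20 H2] := const_right y tau fy (le_trans q0 (ltW qtau)).
  have [s [/andP[qs sr] ys] st] := inf_adherent e20 hiA.
  rewrite -ys H2// st andbT; apply: ge_inf; first by exists q.
  by split => //; rewrite qs.
exists tau; split => // s ts sr.
by have [yt|//] := oj tau s (ltW qtau) ts sr; case: yqr; rewrite -yt.
Qed.

(** Both paths run through the same values in the same order, with at most one jump per cell. The
    time change sends the jump times of [y'] to those of [y], and two jump times in the same cell
    differ by at most the mesh. *)
Lemma nice_close y y' N T : finite_valued y -> finite_valued y' ->
  nice N T.+1 y -> nice N T.+1 y' ->
  (forall k, (k <= T.+1 * 2 ^ N)%N -> y (grid N k) = y' (grid N k)) ->
  exists2 l, time_change l & forall t, 0 <= t <= T%:R ->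
    `|l t - t| <= 2 ^- N /\ y' t = y (l t).
Proof.
move=> fy fy' ny ny' E.
pose L := (T.+1 * 2 ^ N)%N.
have h0 : 0 < 2 ^- N :> R by rewrite invr_gt0 exprn_gt0.
have jumps x : finite_valued x -> nice N T.+1 x -> exists tau : nat -> R,
   forall k, [/\ grid N k < tau k, tau k <= grid N k.+1,
    (k < L)%N -> forall s, grid N k <= s -> s < tau k -> x s = x (grid N k) &
    (k < L)%N -> forall s, tau k <= s -> s <= grid N k.+1 -> x s = x (grid N k.+1)].
  move=> fx nx; suff /choice[tau Htau] : forall k, exists tau : R, [/\ grid N k < tau, tau <= grid N k.+1,
    (k < L)%N -> forall s, grid N k <= s -> s < tau -> x s = x (grid N k) &
    (k < L)%N -> forall s, tau <= s -> s <= grid N k.+1 -> x s = x (grid N k.+1)] by exists tau.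
  move=> k.
  have gk : grid N k < grid N k.+1 by rewrite gridS ltrDl.
  have [kL|kL] := ltnP k L; last by exists (grid N k.+1); split.
  have [tau [t1 t2 t3 t4]] := jump_time x _ _ fx (grid_ge0 N k) gk (nx k kL).
  by exists tau; split.
have [a0 Ha] := jumps y' fy' ny'; have [b0 Hb] := jumps y fy ny.
(* Breakpoint [i + 1] is the jump time in cell [i], so between breakpoints [i] and [i + 1] the path
   has its value at grid point [i]. *)
pose sh (c : nat -> R) i := if i is i'.+1 then c i' else 0.
have shS c : (forall k, grid N k < c k /\ c k <= grid N k.+1) -> forall i, sh c i < sh c i.+1.
  move=> Hc [|i] /=; first by have [] := Hc 0%N; rewrite /grid mul0r.
  by have [_ h1] := Hc i; have [h2 _] := Hc i.+1; exact: le_lt_trans h1 h2.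
have aS : forall i, sh a0 i < sh a0 i.+1 by apply: shS => k; have [] := Ha k.
have bS : forall i, sh b0 i < sh b0 i.+1 by apply: shS => k; have [] := Hb k.
have ab i : `|sh b0 i - sh a0 i| <= 2 ^- N.
  case: i => [|i] /=; first by rewrite subrr normr0 ltW.
  have [h1 h2 _ _] := Ha i; have [h3 h4 _ _] := Hb i.
  by rewrite gridS in h2 h4; rewrite ler_norml; apply/andP; split; lra.
have [l [lmono lsurj lh lcell _]] := piecewise_linear_time_change (sh a0) (sh b0) (2 ^- N) L erefl erefl aS bS ab.
exists l.
  split => //; split.
  - by move=> t /=; rewrite !in_itv/= !andbT => t0; have [] := lh t t0.
  - move=> s t; rewrite !inE/= !in_itv/= !andbT => s0 t0 lst.
    have [st|ts|//] := ltgtP s t.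
      by have := lmono s t s0 st; rewrite lst ltxx.
    by have := lmono t s t0 ts; rewrite lst ltxx.
  - move=> u /=; rewrite in_itv/= andbT => u0; have [t t0 lt] := lsurj u u0.
    by exists t => //=; rewrite in_itv/= andbT.
move=> t /andP[t0 tT]; split; first by have [] := lh t t0.
have value x c i s : (forall k, [/\ grid N k < c k, c k <= grid N k.+1,
    (k < L)%N -> forall s, grid N k <= s -> s < c k -> x s = x (grid N k) &
    (k < L)%N -> forall s, c k <= s -> s <= grid N k.+1 -> x s = x (grid N k.+1)]) ->
   (i < L)%N -> sh c i <= s < sh c i.+1 -> x s = x (grid N i) :> R.
  move=> Hc iL /andP[h1 h2]; have [_ _ H3 _] := Hc i.
  have [gs|gs] := leP (grid N i) s; first exact: H3.
  case: i iL h1 h2 H3 gs => [|i] iL h1 h2 H3 gs.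
    by move: gs; rewrite /grid mul0r ltNge h1.
  by have [_ _ _ H4] := Hc i; apply: H4 => //; [exact: ltnW|exact: ltW].
have [i iL ti] : exists2 i, (i < L)%N & sh a0 i <= t < sh a0 i.+1.
  have taL : t < sh a0 L.
    have L0 : (0 < L)%N by rewrite muln_gt0/= expn_gt0.
    rewrite -(prednK L0) /=; have [h1 _ _ _] := Ha L.-1.
    apply: le_lt_trans h1; apply: le_trans tT _.
    rewrite /grid ler_pdivlMr ?exprn_gt0// -natrX -natrM ler_nat.
    rewrite -ltnS prednK// /L mulSn -[X in (X < _)%N]add0n ltn_add2r.
    by rewrite expn_gt0.
  suff H K : t < sh a0 K -> exists2 i, (i < K)%N & sh a0 i <= t < sh a0 i.+1 by exact: H.
  elim: K => [|K IH] tK; first by move: tK; rewrite /= ltNge t0.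
  have [tk|tk] := ltP t (sh a0 K).
    by have [i iK ti] := IH tk; exists i => //; exact: ltnW.
  by exists K => //; rewrite tk.
rewrite (value y' a0 i t Ha iL ti) (value y b0 i (l t) Hb iL (lcell i t iL ti)).
by rewrite E// ltnW.
Qed.

End finite_valued_paths.

(** * Measurability of path events in the Skorohod topology *)

Section path_measurability.
Context {R : realType} {dd : measure_display} {Omega : measurableType dd}.
Context (P : probability Omega R) (n : nat) (X : Omega -> skorohod R).
Context (n_gt0 : (0 < n)%N).
Context (mX : forall t, 0 <= t -> measurable_fun setT (fun w => X w t)).
Context (EX : forall w t, 0 <= t -> E_ n (X w t)).

Let fX w : finite_valued n (X w). Proof. by move=> t; exact: EX. Qed.

Lemma measurable_same_value s t : 0 <= s -> 0 <= t ->
  measurable [set w | X w s = X w t].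
Proof.
move=> s0 t0.
have -> : [set w | X w s = X w t] = (fun w => X w s - X w t) @^-1` [set 0].
  apply/seteqP; split => w /=; first by move=> ->; rewrite subrr.
  by move/eqP; rewrite subr_eq0 => /eqP.
rewrite -[X in measurable X]setTI.
have : measurable_fun setT (fun w => X w s - X w t) by apply: measurable_funB; exact: mX.
by apply.
Qed.

(** The path is constant on a short interval to the right of each time, so a violation at [s] and
    [t] persists at rational times just after them; if [s = t], one rational serves for both. *)
Lemma one_jump_ratP y (q r : R) : finite_valued n y -> 0 <= q ->
  one_jump y q r <-> forall a b : rat, q <= ratr a -> ratr a <= (ratr b : R) -> ratr b <= r ->
    y (ratr a) = y q \/ y (ratr b) = y r.
Proof.
move=> fy q0; split => [oj a b qa ab br|H s t qs st tr]; first exact: oj.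
apply: contrapT => /not_orP[ys yt].
have s0 := le_trans q0 qs; have t0 := le_trans s0 st.
have trl : t < r by rewrite lt_neqAle tr andbT; apply/eqP => tE; apply: yt; rewrite tE.
have [e1 e10 H1] := const_right n n_gt0 y s fy s0.
have [e2 e20 H2] := const_right n n_gt0 y t fy t0.
have tlt : t < Num.min (t + e2) r by rewrite lt_min ltrDl e20.
have [b] := rat_in_itvoo tlt.
rewrite in_itv/= lt_min => /and3P[tb be br].
have yb : y (ratr b) = y t by apply: H2; rewrite (ltW tb).
have [st'|ts] := ltP s t.
  have slt : s < Num.min (s + e1) t by rewrite lt_min ltrDl e10.
  have [a] := rat_in_itvoo slt.
  rewrite in_itv/= lt_min => /and3P[sa ae at'].
  have ya : y (ratr a) = y s by apply: H1; rewrite (ltW sa).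
  have [h|h] := H a b (le_trans qs (ltW sa)) (ltW (lt_trans at' tb)) (ltW br).
    by apply: ys; rewrite -ya.
  by apply: yt; rewrite -yb.
have sE : s = t by apply/eqP; rewrite eq_le st ts.
have qb : q <= ratr b by apply: le_trans (ltW tb); rewrite -sE.
have [h|h] := H b b qb (lexx _) (ltW br).
  by apply: ys; rewrite -h yb sE.
by apply: yt; rewrite -yb.
Qed.

Lemma measurable_one_jump q r : 0 <= q -> q <= r -> measurable [set w | one_jump (X w) q r].
Proof.
move=> q0 qr.
have -> : [set w | one_jump (X w) q r] = ~` \bigcup_(a : rat) \bigcup_(b : rat)
    [set w | [/\ q <= ratr a, ratr a <= (ratr b : R) & ratr b <= r] /\
       ~ (X w (ratr a) = X w q \/ X w (ratr b) = X w r)].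
  apply/seteqP; split => w /=.
    move=> /(one_jump_ratP _ _ _ (fX w) q0) H [a _ [b _ [[h1 h2 h3]]]]; apply.
    exact: H.
  move=> nb; apply/(one_jump_ratP _ _ _ (fX w) q0) => a b h1 h2 h3.
  by apply: contrapT => h4; apply: nb; exists a => //; exists b.
apply: measurableC; apply: bigcupT_measurable_rat => a; apply: bigcupT_measurable_rat => b.
have [[h1 h2 h3]|h] := pselect [/\ q <= ratr a, ratr a <= (ratr b : R) & ratr b <= r]; last first.
  by rewrite (_ : [set w | _] = set0)//; apply/seteqP; split => // w [].
have a0 := le_trans q0 h1; have b0 := le_trans a0 h2.
rewrite (_ : [set w | _] = ~` ([set w | X w (ratr a) = X w q] `|` [set w | X w (ratr b) = X w r])).
  apply: measurableC; apply: measurableU; apply: measurable_same_value => //.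
  exact: le_trans qr.
by apply/seteqP; split => w /= => [[]|].
Qed.

Lemma measurable_nice N T : measurable [set w | nice N T (X w)].
Proof.
rewrite (_ : [set w | _] = \bigcap_(k in [set k | (k < T * 2 ^ N)%N]) [set w | one_jump (X w) (grid N k) (grid N k.+1)]).
  apply: bigcap_measurableType => k _; apply: measurable_one_jump; first exact: grid_ge0.
  by rewrite gridS lerDl invr_ge0 exprn_ge0.
by apply/seteqP; split.
Qed.

Lemma nice_probability T e : 0 < e ->
  \forall N \near \oo, (P (~` [set w | nice N T (X w)]) <= e%:E)%E.
Proof.
move=> e0.
pose D N := \bigcap_(M in [set M | (N <= M)%N]) [set w | nice M T (X w)].
have mD N : measurable (D N).
  by apply: bigcap_measurableType => M _; exact: measurable_nice.
have ndD : nondecreasing_seq D.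
  by move=> N M NM; apply/subsetPset => w Dw K /= MK; apply: Dw => /=; exact: leq_trans MK.
have UD : \bigcup_N D N = setT.
  apply/seteqP; split => // w _; have [N _ HN] := nice_near n n_gt0 (X w) T (fX w).
  by exists N => // M NM; exact: HN.
have mU : measurable (\bigcup_N D N) by rewrite UD.
have cv : P (D N) @[N --> \oo] --> (1%R%:E : \bar R).
  rewrite -(probability_setT P) -UD.
  exact: (nondecreasing_cvg_mu (mu := P) mD mU ndD).
have h1 : ((1 - e)%:E < 1)%E by rewrite lte_fin gtrBl.
have H : \forall N \near \oo, ((1 - e)%:E < P (D N))%E.
  exact: (cv _ (open_ereal_gt' h1)).
near=> N.
have DN : ((1 - e)%:E < P (D N))%E by near: N.
have mN := measurable_nice N T.
rewrite probability_setC// leeBlDr//; last exact: fin_num_measure.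
have : (P (D N) <= P [set w | nice N T (X w)])%E.
  by apply: le_measure; rewrite ?inE//; move=> w; apply => /=.
move=> /(lt_le_trans DN) /ltW; rewrite -(fineK (fin_num_measure P _ mN)) !lee_fin.
by move=> H2; lra.
Unshelve. all: by end_near. Qed.

(** The preimage is the union of those events [C i] (niceness at one scale and prescribed grid
    values) that it contains, and there are countably many. By [nice_close], samples in a common
    event are close in the Skorohod sense, so every point of the preimage lies in such an event. *)
Lemma measurable_open_preimage a c (O : set (skorohod R)) : open O ->
  measurable [set w | O (rescale a c (X w))].
Proof.
move=> oO; set pre := [set w | _].
pose vals N T w := [seq state_of n (X w (grid N k)) | k <- iota 0 (T.+1 * 2 ^ N).+1].
pose C (i : nat * nat * seq 'I_n.+1) := [set w | nice i.1.1 i.1.2.+1 (X w) /\ vals i.1.1 i.1.2 w = i.2].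
have mC i : measurable (C i).
  apply: measurableI; first exact: measurable_nice.
  have mv (ks : seq nat) (v : seq 'I_n.+1) N :
      measurable [set w | [seq state_of n (X w (grid N k)) | k <- ks] = v].
    elim: ks v => [|k ks IH] [|x v] /=.
    - by rewrite (_ : [set _ | _] = setT)//; apply/seteqP; split.
    - by rewrite (_ : [set _ | _] = set0)//; apply/seteqP; split.
    - by rewrite (_ : [set _ | _] = set0)//; apply/seteqP; split.
    rewrite (_ : [set _ | _] = (fun w => X w (grid N k)) @^-1` [set magn x] `&`
       [set w | [seq state_of n (X w (grid N k)) | k <- ks] = v]).
      apply: measurableI; last exact: IH.
      have /(_ measurableT) mf := mX (grid N k) (grid_ge0 N k).
      by rewrite -[X in measurable X]setTI; apply: mf; exact: measurable_set1.
    apply/seteqP; split => w /=.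
      by move=> [<- <-]; split => //; rewrite magnK//; apply: EX; exact: grid_ge0.
    by move=> [-> ->]; rewrite state_ofK.
  exact: mv.
pose F i := if pselect (C i `<=` pre) then C i else set0.
have -> : pre = \bigcup_i F i.
  apply/seteqP; split => w; last first.
    by move=> [i _]; rewrite /F; case: pselect => // Ci; exact: Ci.
  move=> Ow; have [T [e [e0 He]]] := (oO : skorohod_open O) _ Ow.
  pose T' := (Num.truncn T).+1.
  have [N [nN hN]] : exists N, nice N T'.+1 (X w) /\ 2 ^- N < e.
    have [N1 _ H1] := nice_near n n_gt0 (X w) T'.+1 (fX w).
    have [N2 _ H2] := half_exp_lt e e0.
    exists (maxn N1 N2); split; [apply: H1|apply: H2]; rewrite /= ?leq_maxl ?leq_maxr//.
  suff Cs : C (N, T', vals N T' w) `<=` pre.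
    by exists (N, T', vals N T' w) => //; rewrite /F; case: pselect => // _; split.
  move=> w' [nw' vw']; apply: He.
  have E k : (k <= T'.+1 * 2 ^ N)%N -> X w (grid N k) = X w' (grid N k).
    move=> kL; have : nth ord0 (vals N T' w) k = nth ord0 (vals N T' w') k by rewrite vw'.
    rewrite !(nth_map 0%N) ?size_iota// !nth_iota// add0n => H.
    have m1 := magnK n n_gt0 _ (EX w (grid N k) (grid_ge0 N k)).
    have m2 := magnK n n_gt0 _ (EX w' (grid N k) (grid_ge0 N k)).
    by rewrite -m1 H m2.
  have [l tcl Hl] := nice_close n n_gt0 (X w) (X w') N T' (fX w) (fX w') nN nw' E.
  exists l => // t /andP[t0 tT].
  have tT' : 0 <= t <= T'%:R by rewrite t0 (le_trans tT)// ltW// truncnS_gt.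
  have [h1 h2] := Hl t tT'.
  by split; [exact: le_lt_trans hN|rewrite /rescale/= h2 subrr normr0].
apply: countable_bigcupT_measurable; first exact: countableP.
by move=> i; rewrite /F; case: ifP => _; [exact: mC|exact: measurable0].
Qed.

End path_measurability.

(** * Exponential moments of the Curie-Weiss step *)

Section step_bounds.
Context {R : realType}.

Lemma generator_exponential beta n x b th : (0 < n)%N -> b != 0 ->
  CW_generator beta n (fun z : R => expR (n%:R * th / b * z)) x =
  n%:R / b ^+ 2 * (b ^+ 2 * ((1 - x) / 2 * expR (beta * x) * (expR (2 * th / b) - 1)
     + (1 + x) / 2 * expR (- beta * x) * (expR (- (2 * th / b)) - 1)))
  * expR (n%:R * th / b * x).
Proof.
move=> n0 b0; have nR : n%:R != 0 :> R by rewrite pnatr_eq0 -lt0n.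
rewrite /CW_generator.
have -> : n%:R * th / b * (x + 2 / n%:R) = n%:R * th / b * x + 2 * th / b.
  by field; rewrite b0 nR.
have -> : n%:R * th / b * (x - 2 / n%:R) = n%:R * th / b * x + - (2 * th / b).
  by field; rewrite b0 nR.
rewrite !expRD.
set e1 := expR (2 * th / b); set e2 := expR (- _); set e3 := expR (n%:R * _ / _ * _).
by field.
Qed.

(** The Hamiltonian limit is used with error [eta / 2], so that the inequalities for the generator
    are strict, as [generator_le] and [generator_ge] require. [B] is chosen before [n] and [p]; the
    threshold on [h] comes after them and is common to finitely many states and exponents. *)
Lemma step_bounds beta m : G2 beta m = 0 -> forall M eta (Th : seq R), 0 < M -> 0 < eta ->
  exists2 B : R, 0 < B & forall (b : R) n p, B <= b -> (0 < n)%N -> 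
    has_generator n p (CW_generator beta n) ->
    \forall h \near (0 : R)^'+,
      mgf_bounds (fun x y : 'I_n.+1 => p h (magn x) (magn y))
        (fun x => b * (magn x - m)) (n%:R / b ^+ 2) h
        (2 * derive1 (G2 beta) m) (4 * G1 beta m) M eta Th.
Proof.
move=> Gm M eta Th M0 eta0.
pose M' := M + \sum_(th <- Th) `|th|.
have sum0 (s : seq R) : 0 <= \sum_(th <- s) `|th| by apply: sumr_ge0.
have M'0 : 0 < M' by rewrite ltr_wpDr.
have e20 : 0 < eta / 2 by lra.
have [B B0 HB] := cw_hamiltonian_approx beta m Gm M' (eta / 2) M'0 e20.
exists B => // b n p Bb n0 gen.
have b0 : 0 < b := lt_le_trans B0 Bb.
have bn0 : b != 0 by rewrite gt_eqF.
have nR : 0 < n%:R :> R by rewrite ltr0n.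
have r0 : 0 < n%:R / b ^+ 2 by rewrite divr_gt0// exprn_gt0.
pose Y (x : 'I_n.+1) := b * (magn x - m).
pose kappa := 2 * derive1 (G2 beta) m; pose s2 := 4 * G1 beta m.
have main (i : 'I_n.+1 * 'I_(size Th)) : \forall h \near (0 : R)^'+, `|Y i.1| <= M ->
    expR (n%:R / b ^+ 2 * h * (kappa * Y i.1 * Th`_i.2 + s2 * Th`_i.2 ^+ 2 / 2 - eta)) <=
      one_step_mgf (fun x y : 'I_n.+1 => p h (magn x) (magn y)) Y (n%:R / b ^+ 2) i.1 Th`_i.2 <=
    expR (n%:R / b ^+ 2 * h * (kappa * Y i.1 * Th`_i.2 + s2 * Th`_i.2 ^+ 2 / 2 + eta)).
  case: i => x j /=.
  have [YM|YM] := lerP `|Y x| M; last by near=> h.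
  set th := Th`_j.
  pose f (z : R) := expR (n%:R * th / b * z).
  have fx0 : 0 < f (magn x) by exact: expR_gt0.
  have thM : `|th| <= M'.
    have : th \in Th by exact: mem_nth.
    move=> /(perm_to_rem)/(perm_big _) E; rewrite /M' E big_cons.
    by rewrite addrCA lerDl addr_ge0 ?sum0 ?(ltW M0).
  have YM' : `|Y x| <= M' by apply: le_trans YM _; rewrite lerDl.
  have xE : magn x = m + Y x / b by rewrite /Y; field.
  have := HB b (Y x) th (magn x) xE Bb YM' thM.
  have gE := generator_exponential beta n (magn x) b th n0 bn0.
  move: gE; set H := b ^+ 2 * _ => gE.
  rewrite ler_norml => /andP[H1 H2].
  have Ex : @E_ R n (magn x) by exists x.
  have up : CW_generator beta n f (magn x) <
      n%:R / b ^+ 2 * (kappa * Y x * th + s2 * th ^+ 2 / 2 + eta) * f (magn x).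
    rewrite gE ltr_pM2r// ltr_pM2l// /kappa /s2; lra.
  have lo : n%:R / b ^+ 2 * (kappa * Y x * th + s2 * th ^+ 2 / 2 - eta) * f (magn x) <
      CW_generator beta n f (magn x).
    rewrite gE ltr_pM2r// ltr_pM2l// /kappa /s2; lra.
  have := generator_le _ _ _ _ _ _ gen Ex fx0 up.
  have := generator_ge _ _ _ _ _ _ gen Ex fx0 lo.
  apply: filterS2 => h h1 h2 _.
  have mE : one_step_mgf (fun x y : 'I_n.+1 => p h (magn x) (magn y)) Y (n%:R / b ^+ 2) x th =
     (\sum_(k < n.+1) p h (magn x) (magn k) * f (magn k)) / f (magn x).
    rewrite /one_step_mgf mulr_suml; apply: eq_bigr => k _.
    rewrite -[RHS]mulrA /f/= -expRN -expRD; congr (_ * expR _).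
    by rewrite /Y; field.
  rewrite mE ler_pdivlMr// ler_pdivrMr//.
  rewrite -[n%:R / b ^+ 2 * h]mulrC -!mulrA.
  by apply/andP; split; [move: h1|move: h2]; rewrite -!mulrA.
have := filter_forall (at_right_proper_filter (0 : R)) main; apply: filterS => h Hh x th YM thT.
have jT : (index th Th < size Th)%N by rewrite index_mem.
by have /andP := Hh (x, Ordinal jT) YM; rewrite /= nth_index.
Unshelve. all: by end_near. Qed.

End step_bounds.

(** * Comparison of discrete paths with curves *)

Section path_comparison.
Context {R : realType}.

Lemma prim_cst (c t : R) : 0 <= t -> prim (fun=> c) t = c * t.
Proof.
move=> t0; rewrite /prim /Rintegral/= integral_cst//= lebesgue_measure_itv/= lte_fin.
case: ltrP => [_|t0']; first by rewrite /= subr0.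
by rewrite (_ : t = 0) ?mulr0 ?mule0//; apply/eqP; rewrite eq_le t0 t0'.
Qed.

Lemma prim_riemann_sum (f : R -> R) (h o : R) L : continuous f -> 0 <= h ->
  (forall i t, (i < L)%N -> i%:R * h <= t <= i.+1%:R * h -> `|f t - f (i%:R * h)| <= o) ->
  forall k, (k <= L)%N -> `|prim f (k%:R * h) - h * \sum_(i < k) f (i%:R * h)| <= o * (k%:R * h).
Proof.
move=> cf h0 H; elim=> [|k IH] kL.
  by rewrite big_ord0 mulr0 subr0 !mul0r mulr0 prim_le0// normr0.
have lf := continuous_locint f cf.
have lc : locint (fun=> f (k%:R * h)) by apply: continuous_locint => x; exact: cvg_cst.
have k0 : 0 <= k%:R * h by rewrite mulr_ge0.
have kS : k%:R * h <= k.+1%:R * h by rewrite ler_wpM2r// ler_nat.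
have := prim_norm_le (fun u => f u - f (k%:R * h)) o _ _ (locintB _ _ lf lc) k0 kS (fun u => H k u kL).
rewrite !primB// !prim_cst ?(le_trans k0 kS)// => H1.
have E : k.+1%:R * h - k%:R * h = h by rewrite -natr1; ring.
rewrite E in H1.
have -> : o * (k.+1%:R * h) = o * (k%:R * h) + o * h by rewrite -natr1; ring.
apply: le_trans (lerD (IH (ltnW kL)) H1).
apply: le_trans (ler_normD _ _); rewrite le_eqVlt; apply/orP; left; apply/eqP; congr `|_|.
by rewrite big_ord_recr/= -natr1; ring.
Qed.

(** The difference satisfies a discrete linear recursion, forced by the initial error, by the gap
    between noise and driver, and by the error of the Riemann sums. *)
Lemma path_gronwall (kappa h o e0 e1 : R) (gamma : R -> R) (y : nat -> R) L :
  continuous gamma -> 0 <= h -> 0 <= o ->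
  (forall i t, (i < L)%N -> i%:R * h <= t <= i.+1%:R * h -> `|gamma t - gamma (i%:R * h)| <= o) ->
  `|y 0%N - gamma 0| <= e0 ->
  (forall k, (k <= L)%N -> `|noise (h * kappa) y k - driver kappa gamma (k%:R * h)| <= e1) ->
  forall k, (k <= L)%N -> `|y k - gamma (k%:R * h)| <=
    (e0 + e1 + `|kappa| * (o * (L%:R * h))) * expR (h * `|kappa| * L%:R).
Proof.
move=> cg h0 o0 Ho H0 H1.
have e00 : 0 <= e0 := le_trans (normr_ge0 _) H0.
have e10 : 0 <= e1 := le_trans (normr_ge0 _) (H1 0%N isT).
apply: (gronwall_expR (h * `|kappa|) _ (fun k => `|y k - gamma (k%:R * h)|)).
- by rewrite mulr_ge0.
- by rewrite !addr_ge0// !mulr_ge0.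
move=> k kL.
have RS := prim_riemann_sum gamma h o L cg h0 Ho k kL.
have -> : y k - gamma (k%:R * h) = (y 0%N - gamma 0)
    + (noise (h * kappa) y k - driver kappa gamma (k%:R * h))
    - kappa * (prim gamma (k%:R * h) - h * \sum_(i < k) gamma (i%:R * h))
    + h * kappa * \sum_(i < k) (y i - gamma (i%:R * h)).
  by rewrite sumrB /noise /driver; ring.
apply: le_trans (ler_normD _ _) _; apply: lerD; last first.
  rewrite normrM normrM (ger0_norm h0) ler_wpM2l ?mulr_ge0//.
  exact: ler_norm_sum.
apply: le_trans (ler_normB _ _) _; apply: lerD.
  by apply: le_trans (ler_normD _ _) _; apply: lerD => //; exact: H1.
rewrite normrM ler_wpM2l//; apply: le_trans RS _.
by rewrite ler_wpM2l// ler_wpM2r// ler_nat.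
Qed.

End path_comparison.

Section block_comparison.
Context {R : realType}.

Lemma block_comparison (g : R -> R) (z : nat -> R) h J K e : 0 < h -> (0 < K)%N -> 0 <= e ->
  (forall j, (j <= J)%N -> g (j%:R * (K%:R * h)) = z (j * K)%N) ->
  (forall j t, (j < J)%N -> j%:R * (K%:R * h) <= t < j.+1%:R * (K%:R * h) ->
     `|g t - g (j%:R * (K%:R * h))| <= e) ->
  (forall j i, (j < J)%N -> (i <= K)%N -> `|z (j * K + i)%N - z (j * K)%N| <= e) ->
  forall k, (k <= J * K)%N -> `|z k - g (k%:R * h)| <= e + e.
Proof.
move=> h0 K0 e0 HJ Hd Hn k kL.
have [kE|kN] := eqVneq k (J * K)%N.
  by rewrite kE natrM -mulrA HJ// subrr normr0 addr_ge0.
have kl : (k < J * K)%N by rewrite ltn_neqAle kN.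
have jJ : (k %/ K < J)%N by rewrite ltn_divLR.
have iK : (k %% K < K)%N by rewrite ltn_pmod.
have kE := divn_eq k K.
have := Hn _ _ jJ (ltnW iK); rewrite -kE => H1.
have bd : (k %/ K)%:R * (K%:R * h) <= k%:R * h < (k %/ K).+1%:R * (K%:R * h).
  rewrite !mulrA -!natrM ler_pM2r// ltr_pM2r// ler_nat ltr_nat.
  by rewrite leq_trunc_div ltn_ceil.
have := Hd _ _ jJ bd; rewrite HJ ?(ltnW jJ)// => H2.
set a := z (_ * _)%N in H1 H2; have -> : z k - g (k%:R * h) = (z k - a) - (g (k%:R * h) - a) by ring.
by apply: le_trans (ler_normB _ _) _; exact: lerD.
Qed.

End block_comparison.

Section good_paths.
Context {R : realType} (kappa s2 : R) (s2_gt0 : 0 < s2) (I0 : R -> \bar R).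
Context (I0_good : good_rate_function I0).

(** The curve starts at [x0], and its driver interpolates the discrete noise at block ends. Its
    action is then the block cost, at most [c1], and Gronwall compares the two paths. *)
Lemma good_path_level (c T e : R) : 0 <= c -> 0 <= T -> 0 < e ->
  exists e1 theta, [/\ 0 < e1, 0 < theta &
    forall (J K : nat) (h M c1 a x0 : R) (y : nat -> R),
      0 < h -> h <= theta -> (0 < K)%N -> (J * K)%:R * h = T ->
      `|y 0%N - x0| <= e1 -> (I0 x0 <= a%:E)%E -> a + c1 <= c ->
      good_path h kappa s2 M J K c1 e1 y ->
      exists gamma, rate_level kappa s2 I0 c gamma /\
        forall k, (k <= J * K)%N -> `|y k - gamma (k%:R * h)| <= e].
Proof.
move=> c0 T0 e0.
(* Gronwall constant: [e1] from the initial value, [2 * e1] from the noise, and [|kappa| * T * e1]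
   from the Riemann sums. *)
pose W := (3 + `|kappa| * T) * expR (`|kappa| * T).
have W0 : 0 < W by rewrite mulr_gt0 ?expR_gt0// ltr_wpDr// mulr_ge0.
have e10 : 0 < e / W by rewrite divr_gt0.
have [theta theta0 Hth] := level_modulus kappa s2 s2_gt0 I0 I0_good c T (e / W) c0 T0 e10.
exists (e / W), theta; split => // J K h M c1 a x0 y h0 hth K0 TE y0 Ix ac [_ gn gs].
set e1 := e / W in e10 Hth y0 gn *.
have tau0 : 0 < K%:R * h by rewrite mulr_gt0// ltr0n.
pose N j := noise (h * kappa) y (j * K).
pose u j := (N j.+1 - N j) / (K%:R * h).
have uE j : K%:R * h * u j = N j.+1 - N j by rewrite /u mulrC divfK// gt_eqF.
have [gamma [g0 cg rg gd gi]] := polygonal_path kappa s2 s2_gt0 I0 I0_good x0 J _ u tau0.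
have sE : \sum_(j < J) K%:R * h * u j ^+ 2 / (2 * s2) =
    \sum_(j < J) (N j.+1 - N j) ^+ 2 / (2 * s2 * (K%:R * h)).
  apply: eq_bigr => j _; rewrite -uE; field.
  by rewrite !gt_eqF ?ltr0n.
have lg : rate_level kappa s2 I0 c gamma.
  apply: le_trans rg _; apply: (@le_trans _ _ (a + c1)%:E); last by rewrite lee_fin.
  by rewrite EFinD leeD// lee_fin sE.
exists gamma; split => // k kL.
have Hg i t : (i < J * K)%N -> i%:R * h <= t <= i.+1%:R * h -> `|gamma t - gamma (i%:R * h)| <= e1.
  move=> iL /andP[t1 t2].
  have tT : t <= T.
    by rewrite -TE; apply: le_trans t2 _; rewrite ler_wpM2r ?ler_nat// ltW.
  have ti : t - i%:R * h <= theta.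
    by apply: le_trans hth; move: t2; rewrite -natr1; lra.
  have i0 : 0 <= i%:R * h by rewrite mulr_ge0// ltW.
  by have [] := Hth _ _ _ lg i0 t1 tT ti.
have gdN j : (j <= J)%N -> driver kappa gamma (j%:R * (K%:R * h)) = noise (h * kappa) y (j * K).
  move=> jJ; rewrite gd// mulr_sumr; under eq_bigr do rewrite uE.
  rewrite -(big_mkord xpredT (fun i => N i.+1 - N i)) telescope_sumr//.
  by rewrite /N mul0n noise0 subr0.
have gi' j t : (j < J)%N -> j%:R * (K%:R * h) <= t < j.+1%:R * (K%:R * h) ->
     `|driver kappa gamma t - driver kappa gamma (j%:R * (K%:R * h))| <= e1.
  move=> jJ jt; apply: le_trans (gi j t jJ jt) _; rewrite uE /N mulSn addnC.
  exact: gn.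
have nd := block_comparison (driver kappa gamma) (noise (h * kappa) y) h J K e1 h0 K0 (ltW e10) gdN gi' gn.
have y0' : `|y 0%N - gamma 0| <= e1 by rewrite g0.
apply: le_trans (path_gronwall kappa h e1 e1 (e1 + e1) gamma y (J * K) cg (ltW h0) (ltW e10) Hg y0' nd k kL) _.
rewrite TE (_ : h * `|kappa| * _ = `|kappa| * T); last by rewrite -TE; ring.
rewrite le_eqVlt; apply/orP; left; apply/eqP.
transitivity (e1 * W); first by rewrite /W; ring.
by rewrite /e1 divfK// gt_eqF.
Qed.

End good_paths.

(** * Deviation bounds for the Curie-Weiss chain on a grid *)

Section chain_estimates.
Context {R : realType} (beta m : R) (Gm : G2 beta m = 0) (I0 : R -> \bar R).
Context (I0_good : good_rate_function I0).
Local Notation kappa := (2 * derive1 (G2 beta) m).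
Local Notation s2 := (4 * G1 beta m).

Let s2_gt0 : 0 < s2.
Proof. by have [_ _ h] := G2_root_bound beta m Gm; rewrite mulr_gt0. Qed.

Lemma half_exp_right (Q : R -> Prop) : (\forall h \near (0 : R)^'+, Q h) ->
  \forall N \near \oo, Q (2 ^- N).
Proof.
move=> [e /= e0 He]; have := half_exp_lt e e0; apply: filterS => N Ne.
have h0 : 0 < 2 ^- N :> R by rewrite invr_gt0 exprn_gt0.
by apply: He => //=; rewrite sub0r normrN gtr0_norm.
Qed.

(** The block length, the exponents and the window are fixed before [n], and only the mesh [2^-N]
    depends on it. Hence [C], the number of rare events, is a constant independent of [n]. *)
Lemma chain_upper (c e eta R0 : R) (T : nat) : 0 <= c -> 0 < e -> 0 < eta -> 0 <= R0 ->
  exists e1 B C : R, [/\ 0 < e1, 0 < B, 0 <= C & forall (b : R) n p, B <= b -> (0 < n)%N ->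
    transition_function n p -> has_generator n p (CW_generator beta n) ->
    \forall N \near \oo, forall (a x0 : R) (x : 'I_n.+1),
      `|b * (magn x - m)| <= R0 -> `|b * (magn x - m) - x0| <= e1 -> (I0 x0 <= a%:E)%E ->
      mass (fun=> (fun x y : 'I_n.+1 => p (2 ^- N) (magn x) (magn y))) (T * 2 ^ N) 0
        (fun s => ~ exists gamma, rate_level kappa s2 I0 c gamma /\
          forall k, (k <= T * 2 ^ N)%N ->
            `|path_of (fun x => b * (magn x - m)) x s k - gamma (k%:R * 2 ^- N)| <= e) x
        <= C * expR (- (n%:R / b ^+ 2 * (c - a - eta)))].
Proof.
move=> c0 e0 eta0 R00.
have T0 : 0 <= T%:R :> R by [].
have [e1 [theta [e10 theta0 HL]]] := good_path_level kappa s2 s2_gt0 I0 I0_good c T%:R e c0 T0 e0.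
(* Then [lam * e1 = c + 2]. Blocks are short enough for the quadratic price to be at most 1/2, and
   the moment error takes at most another 1/2, so an oscillation within a block has exponent above
   [c]. *)
pose lam := (c + 2) / e1.
have lam0 : 0 < lam by rewrite divr_gt0// ltr_wpDl.
have [Nc hNc] : exists Nc, 2 ^- Nc < (s2 * lam ^+ 2)^-1.
  have sl0 : 0 < (s2 * lam ^+ 2)^-1 by rewrite invr_gt0 mulr_gt0// exprn_gt0.
  by have [N _ HN] := half_exp_lt _ sl0; exists N; exact: (HN N (leqnn N)).
pose tau : R := 2 ^- Nc.
have tau0 : 0 < tau by rewrite invr_gt0 exprn_gt0.
have tl : tau * s2 * lam ^+ 2 / 2 <= 1 / 2.
  have sl0 : 0 < s2 * lam ^+ 2 by rewrite mulr_gt0// exprn_gt0.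
  have : tau * (s2 * lam ^+ 2) < 1 by rewrite -ltr_pdivlMr// mul1r.
  by rewrite mulrA; lra.
pose J := (T * 2 ^ Nc)%N.
(* The rounding loss [zeta * J] is at most half of [eta]; the other half is for the moment error
   [2 * eta0' * T]. *)
pose zeta := eta / 2 / J.+1%:R.
have zeta0 : 0 < zeta by rewrite !divr_gt0.
have zJ : zeta * J%:R <= eta / 2.
  by rewrite /zeta mulrAC ler_pdivrMr// ler_pM2l ?divr_gt0// ler_nat.
pose nb := (Num.truncn (c / zeta)).+1.
have cz : c <= zeta * nb%:R by rewrite mulrC -ler_pdivrMr// ltW// truncnS_gt.
pose eta0' := Num.min eta 1 / (4 * T.+1%:R).
have min0 : 0 < Num.min eta 1 by rewrite lt_min eta0 ltr01.
have eta0'0 : 0 < eta0' by rewrite divr_gt0// mulr_gt0.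
have etaT : 2 * eta0' * T%:R <= Num.min eta 1 / 2.
  have -> : 2 * eta0' * T%:R = Num.min eta 1 / 2 * (T%:R / T.+1%:R).
    by rewrite /eta0'; field.
  by rewrite ler_piMr ?divr_ge0 ?(ltW min0)// ler_pdivrMr// mul1r ler_nat.
have etaT1 : 2 * eta0' * T%:R <= eta / 2.
  by apply: le_trans etaT _; rewrite ler_pM2r// ge_min lexx.
have etaT2 : 2 * eta0' * T%:R <= 1 / 2.
  by apply: le_trans etaT _; rewrite ler_pM2r// ge_min lexx orbT.
pose w := c + T%:R * (s2 / 2 + 2 * eta0').
have w0 : 0 <= w.
  by rewrite addr_ge0// mulr_ge0// addr_ge0//; [rewrite divr_ge0// ltW|rewrite mulr_ge0// ltW].
pose M := (R0 + w) * expR (`|kappa| * T%:R) + 1.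
have M0 : 0 < M by rewrite ltr_wpDl// mulr_ge0 ?expR_ge0// addr_ge0.
(* [box_value] is taken for one step of length [tau], which equals [K] steps of length [2^-N]: the
   list of exponents does not depend on [N]. *)
pose Th := [:: 0; 1; -1; lam; - lam] ++
  [seq box_value tau s2 1 zeta (v.1, nat_of_ord v.2) | v <- enum {: bool * 'I_nb.+1}].
have [B B0 HB] := step_bounds beta m Gm M eta0' Th M0 eta0'0.
exists e1, B, #|{: rare_event J nb}|%:R; split => // b n p Bb n0 [p_ge0 p_sum1 _ _] gen.
have b0 : 0 < b := lt_le_trans B0 Bb.
have HN := half_exp_right _ (HB b n p Bb n0 gen).
have Hth := half_exp_lt theta theta0.
near=> N.
have NcN : (Nc <= N)%N by near: N; exact: nbhs_infty_ge.
have hth : 2 ^- N < theta by near: N.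
have hmgf : mgf_bounds (fun x y : 'I_n.+1 => p (2 ^- N) (magn x) (magn y))
        (fun x => b * (magn x - m)) (n%:R / b ^+ 2) (2 ^- N) kappa s2 M eta0' Th by near: N.
move=> a x0 x xR xx0 Ix.
have h0 : 0 < 2 ^- N :> R by rewrite invr_gt0 exprn_gt0.
pose K := (2 ^ (N - Nc))%N.
have K0 : (0 < K)%N by rewrite expn_gt0.
have JK : (J * K = T * 2 ^ N)%N by rewrite /J /K -mulnA -expnD subnKC.
have Kh : K%:R * 2 ^- N = tau.
  by rewrite /K /tau -{2}(subnK NcN) natrX exprD invfM mulrA divff ?mul1r// expf_neq0.
have JKh : (J * K)%:R * 2 ^- N = T%:R :> R.
  by rewrite JK natrM natrX mulfK// expf_neq0.
have a0 : 0 <= a by rewrite -lee_fin; apply: le_trans Ix; case: I0_good.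
have q_ge0 (x' y : 'I_n.+1) : 0 <= p (2 ^- N) (magn x') (magn y).
  by apply: p_ge0; [exact: ltW|exists x'|exists y].
have q_sum1 (x' : 'I_n.+1) : \sum_(y < n.+1) p (2 ^- N) (magn x') (magn y) = 1.
  have Ex : @E_ R n (magn x') by exists x'.
  exact: (p_sum1 (2 ^- N) (magn x') (ltW h0) Ex).
pose Y (x' : 'I_n.+1) := b * (magn x' - m).
apply: (@le_trans _ _ (mass (fun=> (fun x y : 'I_n.+1 => p (2 ^- N) (magn x) (magn y))) (J * K) 0
   (fun s => ~ good_path (2 ^- N) kappa s2 M J K (c - a) e1 (path_of Y x s)) x)).
  rewrite JK; apply: le_mass; first by move=> _.
  move=> s _ ng gp; apply: ng.
  have := HL J K (2 ^- N) M (c - a) a x0 (path_of Y x s) h0 (ltW hth) K0 JKh xx0 Ix _ gp.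
  by rewrite JK; apply; rewrite addrC subrK.
have r0 : 0 < n%:R / b ^+ 2 by rewrite divr_gt0 ?exprn_gt0// ltr0n.
apply: (mass_not_good _ Y (n%:R / b ^+ 2) (2 ^- N) kappa s2 M eta0' Th q_ge0 q_sum1 r0 h0 s2_gt0
   (ltW eta0'0) J K K0 hmgf nb zeta (c - a) e1 w lam R0 (c - a - eta) x zeta0 _ lam0 w0 R00 xR).
- by apply: le_trans cz; rewrite gerBl.
- by rewrite /M (_ : _ * _ * _ = `|kappa| * T%:R) ?lerDl// -JKh; ring.
- by rewrite (mulrC (2 ^- N)) JKh /w; lra.
- rewrite (mulrC (2 ^- N)) JKh Kh (_ : lam * e1 = c + 2); last by rewrite /lam divfK// gt_eqF.
  lra.
- rewrite (mulrC (2 ^- N)) JKh; lra.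
- by rewrite mem_cat !inE eqxx.
move=> [[[]|[[] j]]|f] k; rewrite mem_cat !inE /= ?mul1r ?mulN1r ?eqxx ?orbT//.
- by case: ifP => _; rewrite eqxx ?orbT.
- by case: ifP => _; rewrite eqxx ?orbT.
rewrite /box; case: insubP => [j _ _|_]; last by rewrite eqxx.
apply/orP; right; apply/mapP; exists ((f j).1, (f j).2); first by rewrite mem_enum.
by rewrite /box_value /= Kh mul1r.
Unshelve. all: by end_near. Qed.

End chain_estimates.

Section chain_lower_estimate.
Context {R : realType} (beta m : R) (Gm : G2 beta m = 0) (I0 : R -> \bar R).
Context (I0_good : good_rate_function I0).
Local Notation kappa := (2 * derive1 (G2 beta) m).
Local Notation s2 := (4 * G1 beta m).

Let s2_gt0 : 0 < s2.
Proof. by have [_ _ h] := G2_root_bound beta m Gm; rewrite mulr_gt0. Qed.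

(** The increments of the driver of [gamma] over short blocks are the targets [d] of [mass_near];
    their action is at most [c - i0] by [rate_level_sum]. Closeness of noise and driver then becomes
    closeness of the paths by Gronwall. *)
Lemma chain_lower (c i0 e eta : R) (T : nat) (gamma : skorohod R) : 0 < e -> 0 < eta ->
  rate_level kappa s2 I0 c gamma -> I0 (gamma 0) = i0%:E ->
  exists e1 B r0 : R, [/\ 0 < e1, 0 < B & forall (b : R) n p, B <= b -> (0 < n)%N ->
    r0 <= n%:R / b ^+ 2 ->
    transition_function n p -> has_generator n p (CW_generator beta n) ->
    \forall N \near \oo, forall x : 'I_n.+1, `|b * (magn x - m) - gamma 0| <= e1 ->
      expR (- (n%:R / b ^+ 2 * (c - i0 + eta))) / 2 <=
      mass (fun=> (fun x y : 'I_n.+1 => p (2 ^- N) (magn x) (magn y))) (T * 2 ^ N) 0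
        (fun s => forall k, (k <= T * 2 ^ N)%N ->
            `|path_of (fun x => b * (magn x - m)) x s k - gamma (k%:R * 2 ^- N)| <= e) x].
Proof.
move=> e0 eta0 lg Ig.
have [I0_ge0 _] := I0_good.
have [_ _ G10] := G2_root_bound beta m Gm.
have i00 : 0 <= i0 by rewrite -lee_fin -Ig.
have c0 : 0 <= c.
  by rewrite -lee_fin (le_trans _ (rate_level_initial kappa s2 s2_gt0 I0 c gamma lg)).
have T0 : 0 <= T%:R :> R by [].
have cg : continuous gamma := rate_level_continuous _ _ _ _ _ lg.
pose W := (5 + `|kappa| * T%:R) * expR (`|kappa| * T%:R).
have W0 : 0 < W by rewrite mulr_gt0 ?expR_gt0// ltr_wpDr// mulr_ge0.
pose e1 := e / W.
have e10 : 0 < e1 by rewrite divr_gt0.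
have e1W : e1 * W = e by rewrite /e1 divfK// gt_eqF.
clearbody e1.
have [theta theta0 Hth] := level_modulus kappa s2 s2_gt0 I0 I0_good c T%:R e1 c0 T0 e10.
have [Nc hNc] : exists Nc, 2 ^- Nc < theta.
  by have [N _ HN] := half_exp_lt _ theta0; exists N; exact: (HN N (leqnn N)).
pose tau : R := 2 ^- Nc.
have tau0 : 0 < tau by rewrite invr_gt0 exprn_gt0.
pose J := (T * 2 ^ Nc)%N.
have JT : J%:R * tau = T%:R.
  by rewrite /J /tau natrM natrX mulfK// expf_neq0.
pose g := driver kappa gamma.
pose d j := if (j < J)%N then g (j.+1%:R * tau) - g (j%:R * tau) else 0.
have ge0t (j : nat) : 0 <= j%:R * tau by rewrite mulr_ge0// ltW.
have gmod j t : (j < J)%N -> j%:R * tau <= t <= j.+1%:R * tau -> `|g t - g (j%:R * tau)| <= e1.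
  move=> jJ /andP[t1 t2].
  have tT : t <= T%:R.
    by rewrite -JT; apply: le_trans t2 _; rewrite ler_wpM2r ?ler_nat// ltW.
  have ti : t - j%:R * tau <= theta.
    by apply: le_trans (ltW hNc); rewrite -/tau; move: t2; rewrite -natr1; lra.
  by have [] := Hth _ _ _ lg (ge0t j) t1 tT ti.
have de1 j : `|d j| <= e1.
  rewrite /d; case: ifP => jJ; last by rewrite normr0 ltW.
  by apply: gmod => //; rewrite lexx ler_wpM2r ?ler_nat// ltW.
have dsum : \sum_(j < J) `|d j| <= J%:R * e1.
  apply: (@le_trans _ _ (\sum_(j < J) e1)); first by apply: ler_sum => j _; exact: de1.
  by rewrite sumr_const card_ord mulr_natl.
(* So narrow a tube that following [d] only up to [e'] costs at most [eta / 2], as the [|d j|] sum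
   up to at most [J * e1]. *)
pose e' := Num.min e1 (eta * tau * s2 / (4 * J.+1%:R * e1)).
have e'0 : 0 < e'.
  rewrite lt_min e10/=; apply: divr_gt0; first by rewrite !mulr_gt0.
  by rewrite mulr_gt0// mulr_gt0.
have e'e1 : e' <= e1 by rewrite ge_min lexx.
have e'e : e' <= eta * tau * s2 / (4 * J.+1%:R * e1) by rewrite ge_min lexx orbT.
have cost2 : 2 * e' * \sum_(j < J) `|d j| / (tau * s2) <= eta / 2.
  rewrite -mulr_suml [_ * (_ / _)]mulrA ler_pdivrMr; last exact: mulr_gt0 tau0 s2_gt0.
  apply: (@le_trans _ _ (2 * e' * (J.+1%:R * e1))).
    rewrite ler_wpM2l ?mulr_ge0 ?(ltW e'0)//; apply: le_trans dsum _.
    by rewrite ler_wpM2r ?ler_nat// ltW.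
  move: e'e; rewrite ler_pdivlMr ?mulr_gt0//; lra.
(* The quadratic price [T * s2 * q^2 / 2] takes at most half of the gain [q * e'], and the moment
   error a quarter. *)
pose q := e' / (T.+1%:R * s2).
have q0 : 0 < q by rewrite divr_gt0// mulr_gt0.
have qT : T%:R * (s2 * q ^+ 2 / 2) <= q * e' / 2.
  have -> : q * e' / 2 = T.+1%:R * (s2 * q ^+ 2 / 2).
    by rewrite /q; field; rewrite nat1r pnatr_eq0/= gt_eqF.
  by rewrite ler_wpM2r ?ler_nat// divr_ge0// mulr_ge0 ?sqr_ge0// ltW.
pose eta' := Num.min (q * e') eta / (8 * T.+1%:R).
have min0 : 0 < Num.min (q * e') eta by rewrite lt_min eta0 mulr_gt0.
have eta'0 : 0 < eta' by rewrite divr_gt0// mulr_gt0.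
have etaT : eta' * T%:R <= Num.min (q * e') eta / 8.
  have -> : eta' * T%:R = Num.min (q * e') eta / 8 * (T%:R / T.+1%:R).
    by rewrite /eta'; field.
  by rewrite ler_piMr ?divr_ge0 ?(ltW min0)// ler_pdivrMr// mul1r ler_nat.
have etaT1 : eta' * T%:R <= q * e' / 8.
  by apply: le_trans etaT _; rewrite ler_pM2r// ge_min lexx.
have etaT2 : eta' * T%:R <= eta / 8.
  by apply: le_trans etaT _; rewrite ler_pM2r// ge_min lexx orbT.
clearbody q eta'.
pose R0 := `|gamma 0| + e1.
have R00 : 0 <= R0 by rewrite addr_ge0// ltW.
pose D := J%:R * e1.
have D0 : 0 <= D by rewrite mulr_ge0// ltW.
pose M := (R0 + e' + D) * expR (`|kappa| * T%:R) + 1.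
have M0 : 0 < M by rewrite ltr_wpDl// mulr_ge0 ?expR_ge0// !addr_ge0// ltW.
pose th j := d j / (tau * s2).
pose Th := 0 :: q :: - q :: [seq th (nat_of_ord j) + v | j <- enum 'I_J, v <- [:: 0; q; - q]].
have ThP j v : v \in [:: 0; q; - q] -> th j + v \in Th.
  have [jJ|jJ] := ltnP j J; last first.
    by rewrite /th /d ltnNge jJ/= mul0r add0r !inE => /or3P[] ->; rewrite ?orbT.
  move=> vin; rewrite !inE; apply/or4P/Or44; apply/allpairsP.
  by exists (Ordinal jJ, v); rewrite mem_enum.
have [B B0 HB] := step_bounds beta m Gm M eta' Th M0 eta'0.
(* Beyond this speed [r * q * e' / 4] is at least 3, and [exp 3 >= 1 + 3] yields the probability 1/4
   required by [mass_near]. *)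
exists e1, B, (12 / (q * e')); split => // b n p Bb n0 rn [p_ge0 p_sum1 _ _] gen.
have b0 : 0 < b := lt_le_trans B0 Bb.
have HN := half_exp_right _ (HB b n p Bb n0 gen).
have Hthe := half_exp_lt theta theta0.
near=> N.
have NcN : (Nc <= N)%N by near: N; exact: nbhs_infty_ge.
have hth : 2 ^- N < theta by near: N.
have hmgf : mgf_bounds (fun x y : 'I_n.+1 => p (2 ^- N) (magn x) (magn y))
        (fun x => b * (magn x - m)) (n%:R / b ^+ 2) (2 ^- N) kappa s2 M eta' Th by near: N.
move=> x xx0.
have h0 : 0 < 2 ^- N :> R by rewrite invr_gt0 exprn_gt0.
set h : R := 2 ^- N in hth hmgf h0 *.
pose K := (2 ^ (N - Nc))%N.
have K0 : (0 < K)%N by rewrite expn_gt0.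
have JK : (J * K = T * 2 ^ N)%N by rewrite /J /K -mulnA -expnD subnKC.
have Kh : K%:R * h = tau.
  by rewrite /h /K /tau -{2}(subnK NcN) natrX exprD invfM mulrA divff ?mul1r// expf_neq0.
have JKh : (J * K)%:R * h = T%:R :> R.
  by rewrite JK /h natrM natrX mulfK// expf_neq0.
have q_ge0 (x' y : 'I_n.+1) : 0 <= p h (magn x') (magn y).
  by apply: p_ge0; [exact: ltW|exists x'|exists y].
have q_sum1 (x' : 'I_n.+1) : \sum_(y < n.+1) p h (magn x') (magn y) = 1.
  have Ex : @E_ R n (magn x') by exists x'.
  exact: (p_sum1 h (magn x') (ltW h0) Ex).
pose Y (x' : 'I_n.+1) := b * (magn x' - m).
have r_gt0 : 0 < n%:R / b ^+ 2 by rewrite divr_gt0 ?exprn_gt0// ltr0n.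
pose th0 k := d (k %/ K)%N / (K%:R * h * s2).
have th0E k : th0 k = th (k %/ K)%N by rewrite /th0 Kh.
pose z k := \sum_(i < k) h * s2 * th0 i.
have hth0 i : h * s2 * th0 i = d (i %/ K)%N / K%:R.
  by rewrite /th0; field; rewrite !gt_eqF ?ltr0n.
have zJ j : z (j * K)%N = \sum_(i < j) d i.
  rewrite /z; under eq_bigr do rewrite hth0.
  rewrite (sum_blocks_div j K K0 (fun i => d i / K%:R)); apply: eq_bigr => i _.
  by rewrite mulrC divfK// pnatr_eq0 -lt0n.
have gJ j : (j <= J)%N -> g (j%:R * (K%:R * h)) = z (j * K)%N.
  move=> jJ; rewrite zJ Kh.
  have := telescope_sumr (fun i => g (i%:R * tau)) (leq0n j).
  rewrite mul0r /g driver0 subr0 => <-; rewrite big_mkord.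
  by apply: eq_bigr => i _; rewrite /d (leq_trans (ltn_ord i) jJ).
have zd j i : (j < J)%N -> (i <= K)%N -> `|z (j * K + i)%N - z (j * K)%N| <= e1.
  move=> jJ iK; rewrite /z big_split_ord/= addrAC subrr add0r.
  apply: le_trans (ler_norm_sum _ _ _) _.
  apply: (@le_trans _ _ (\sum_(l < i) e1 / K%:R)).
    apply: ler_sum => l _; rewrite hth0 normrM normfV normr_nat ler_wpM2r ?invr_ge0//; exact: de1.
  rewrite sumr_const card_ord -[X in X <= _]mulr_natr mulrAC ler_pdivrMr ?ltr0n//.
  by rewrite ler_wpM2l ?ler_nat// ltW.
have zD k : (k <= J * K)%N -> `|z k| <= D.
  move=> kL; apply: le_trans (ler_norm_sum _ _ _) _.
  apply: (@le_trans _ _ (\sum_(l < k) e1 / K%:R)).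
    apply: ler_sum => l _; rewrite hth0 normrM normfV normr_nat ler_wpM2r ?invr_ge0//; exact: de1.
  rewrite sumr_const card_ord -[X in X <= _]mulr_natr mulrAC ler_pdivrMr ?ltr0n//.
  by rewrite /D mulrC mulrAC -natrM ler_wpM2r ?ler_nat// ltW.
have gmod' j t : (j < J)%N -> j%:R * (K%:R * h) <= t < j.+1%:R * (K%:R * h) ->
     `|g t - g (j%:R * (K%:R * h))| <= e1.
  by rewrite Kh => jJ /andP[t1 t2]; apply: gmod => //; rewrite t1 ltW.
have zg := block_comparison g z h J K e1 h0 K0 (ltW e10) gJ gmod' zd.
have xR : `|Y x| <= R0.
  have -> : Y x = gamma 0 + (Y x - gamma 0) by ring.
  by apply: le_trans (ler_normD _ _) _; rewrite lerD2l.
have small : expR (n%:R / b ^+ 2 * (- (q * e') + h * (J * K)%:R * (s2 * q ^+ 2 / 2 + 2 * eta'))) <= 4^-1.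
  rewrite (mulrC h) JKh.
  have H3 : 3 <= n%:R / b ^+ 2 * (q * e' / 4).
    by move: rn; rewrite ler_pdivrMr ?mulr_gt0//; lra.
  apply: (@le_trans _ _ (expR (- (n%:R / b ^+ 2 * (q * e' / 4))))).
    by rewrite ler_expR -(mulrN (n%:R / b ^+ 2)) ler_pM2l//; lra.
  rewrite expRN lef_pV2 ?posrE ?expR_gt0//.
  by apply: le_trans (expR_ge1Dx _); lra.
have RM : (R0 + e' + D) * expR (h * `|kappa| * (J * K)%:R) <= M.
  by rewrite /M (_ : h * _ * _ = `|kappa| * T%:R) ?lerDl// -JKh; ring.
have := mass_near _ Y (n%:R / b ^+ 2) h kappa s2 M eta' Th q_ge0 q_sum1 r_gt0 h0 s2_gt0
   (ltW eta'0) J K K0 hmgf d e' q R0 D x q0 (ltW e'0) D0 R00 xR RM zD.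
have h1 k : th0 k \in Th by rewrite th0E -[th _]addr0; apply: ThP; rewrite inE eqxx.
have h2 k : th0 k + q \in Th by rewrite th0E; apply: ThP; rewrite !inE eqxx orbT.
have h3 k : th0 k - q \in Th by rewrite th0E; apply: ThP; rewrite !inE eqxx !orbT.
move=> /(_ h1 h2 h3 small) mn.
apply: le_trans (le_trans mn _).
  rewrite ler_pM2r// ler_expR lerN2 ler_pM2l//.
  rewrite Kh (mulrC h) JKh.
  have := rate_level_sum kappa s2 s2_gt0 I0 c gamma tau J lg tau0.
  rewrite Ig -EFinD lee_fin => cs.
  have -> : \sum_(j < J) d j ^+ 2 / (2 * s2 * tau) = \sum_(j < J)
     (driver kappa gamma (j.+1%:R * tau) - driver kappa gamma (j%:R * tau)) ^+ 2 / (2 * s2 * tau).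
    by apply: eq_bigr => j _; rewrite /d ltn_ord.
  by move: cs cost2 etaT2 eta0; lra.
rewrite JK; apply: le_mass; first by move=> _.
move=> s _ Hs k kL.
have Hg i t : (i < J * K)%N -> i%:R * h <= t <= i.+1%:R * h -> `|gamma t - gamma (i%:R * h)| <= e1.
  move=> iL /andP[t1 t2].
  have tT : t <= T%:R.
    by rewrite -JKh; apply: le_trans t2 _; rewrite ler_wpM2r ?ler_nat// ltW.
  have ti : t - i%:R * h <= theta.
    by apply: le_trans (ltW hth); move: t2; rewrite -natr1; lra.
  have ii0 : 0 <= i%:R * h by rewrite mulr_ge0// ltW.
  by have [] := Hth _ _ _ lg ii0 t1 tT ti.
have nd k' : (k' <= J * K)%N ->
    `|noise (h * kappa) (path_of Y x s) k' - driver kappa gamma (k'%:R * h)| <= 3 * e1.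
  move=> k'L.
  have -> : noise (h * kappa) (path_of Y x s) k' - driver kappa gamma (k'%:R * h) =
     (noise (h * kappa) (path_of Y x s) k' - z k') + (z k' - g (k'%:R * h)) by rewrite /g; ring.
  apply: le_trans (ler_normD _ _) _.
  rewrite (_ : 3 * e1 = e1 + (e1 + e1)); last by ring.
  apply: lerD; last exact: zg.
  by apply: le_trans e'e1; apply: Hs; rewrite -JK.
rewrite -JK in kL.
apply: le_trans (path_gronwall kappa h e1 e1 (3 * e1) gamma (path_of Y x s) (J * K) cg (ltW h0) (ltW e10) Hg xx0 nd k kL) _.
rewrite JKh (_ : h * `|kappa| * _ = `|kappa| * T%:R); last by rewrite -JKh; ring.
apply: (@le_trans _ _ (e1 * W)); last by rewrite e1W.
rewrite /W (mulrA e1) ler_wpM2r ?expR_ge0//; lra.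
Unshelve. all: by end_near. Qed.

End chain_lower_estimate.

(** * Logarithmic limits and exponential bounds *)

Section logarithmic_limits.
Context {R : realType}.
Local Open Scope ereal_scope.

Lemma limn_esup_lt (u : (\bar R)^nat) a : limn_esup u < a -> \forall n \near \oo, u n < a.
Proof.
move=> /ereal_inf_lt[_ [V nV <-] Va]; apply: filterS nV => n Vn.
by apply: le_lt_trans Va; apply: ereal_sup_ubound; exists n.
Qed.

Lemma limn_esup_le_near (u : (\bar R)^nat) a : (\forall n \near \oo, u n <= a) -> limn_esup u <= a.
Proof.
move=> nu; apply: (@le_trans _ _ (ereal_sup (u @` [set n | u n <= a]))).
  by apply: ereal_inf_lbound; exists [set n | u n <= a].
by apply: ge_ereal_sup => _ [n un <-].
Qed.

Lemma limn_einf_gt (u : (\bar R)^nat) a : a < limn_einf u -> \forall n \near \oo, a < u n.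
Proof.
rewrite /limn_einf lteNr => /limn_esup_lt; apply: filterS => n /=.
by rewrite lteN2.
Qed.

Lemma limn_einf_ge_near (u : (\bar R)^nat) a : (\forall n \near \oo, a <= u n) -> a <= limn_einf u.
Proof.
move=> nu; rewrite /limn_einf leeNr; apply: limn_esup_le_near.
by apply: filterS nu => n /=; rewrite leeN2.
Qed.

Lemma log_le_inv (p : \bar R) (r a : R) : 0 <= p -> (0 < r)%R ->
  (r^-1%:E * lne p <= (- a)%:E) = (p <= (expR (- (r * a)))%:E).
Proof.
move=> p0 r0; rewrite muleC lee_pdivrMr// -EFinM mulNr mulrC.
have -> : (expR (- (r * a)))%:E = expeR (- (r * a))%:E by [].
rewrite -[in RHS](lneK (x := p)) ?lee_expeR//.
by rewrite in_itv/= p0 leey.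
Qed.

Lemma log_ge_inv (p : \bar R) (r a : R) : 0 <= p -> (0 < r)%R ->
  ((- a)%:E <= r^-1%:E * lne p) = ((expR (- (r * a)))%:E <= p).
Proof.
move=> p0 r0; rewrite muleC lee_pdivlMr// -EFinM mulNr mulrC.
have -> : (expR (- (r * a)))%:E = expeR (- (r * a))%:E by [].
rewrite -[in RHS](lneK (x := p)) ?lee_expeR//.
by rewrite in_itv/= p0 leey.
Qed.

Context (r : nat -> R) (r_gt0 : forall n, (0 < n)%N -> (0 < r n)%R).
Context (r_infty : r n @[n --> \oo] --> +oo%R) (p : nat -> \bar R) (p_ge0 : forall n, 0 <= p n).

Lemma exp_bound_of_limn_esup (a eta : R) : (0 < eta)%R ->
  limn_esup (fun n => (r n)^-1%:E * lne (p n)) <= (- a)%:E ->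
  \forall n \near \oo, p n <= (expR (- (r n * (a - eta))))%:E.
Proof.
move=> eta0 H.
have : limn_esup (fun n => (r n)^-1%:E * lne (p n)) < (- (a - eta))%:E.
  by apply: le_lt_trans H _; rewrite lte_fin; lra.
move=> /limn_esup_lt H'; near=> n.
have n0 : (0 < n)%N by near: n; exact: nbhs_infty_gt.
by rewrite -log_le_inv ?r_gt0// ltW//; near: n.
Unshelve. all: by end_near. Qed.

Lemma exp_bound_of_limn_einf (a eta : R) : (0 < eta)%R ->
  (- a)%:E <= limn_einf (fun n => (r n)^-1%:E * lne (p n)) ->
  \forall n \near \oo, (expR (- (r n * (a + eta))))%:E <= p n.
Proof.
move=> eta0 H.
have : (- (a + eta))%:E < limn_einf (fun n => (r n)^-1%:E * lne (p n)).
  by apply: lt_le_trans H; rewrite lte_fin; lra.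
move=> /limn_einf_gt H'; near=> n.
have n0 : (0 < n)%N by near: n; exact: nbhs_infty_gt.
by rewrite -log_ge_inv ?r_gt0// ltW//; near: n.
Unshelve. all: by end_near. Qed.

Lemma near_le_expR (C eta : R) : (0 < eta)%R -> \forall n \near \oo, (C <= expR (r n * eta))%R.
Proof.
move=> eta0; near=> n.
have h : (C / eta <= r n)%R.
  by near: n; move/cvgryPge : r_infty; apply.
apply: le_trans (expR_ge1Dx _).
by move: h; rewrite ler_pdivrMr//; lra.
Unshelve. all: by end_near. Qed.

(** As [r] tends to infinity, the constant [C] is eventually below [exp(r * eta / 2)] and is paid
    out of [eta]. *)
Lemma limn_esup_of_exp_bound (a : R) :
  (forall eta, (0 < eta)%R -> exists C : R,
     \forall n \near \oo, p n <= (C * expR (- (r n * (a - eta))))%:E) ->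
  limn_esup (fun n => (r n)^-1%:E * lne (p n)) <= (- a)%:E.
Proof.
move=> H; apply/lee_addgt0Pr => eta eta0.
have e20 : (0 < eta / 2)%R by lra.
have [C HC] := H _ e20; have HE := near_le_expR C _ e20.
apply: limn_esup_le_near; near=> n.
have n0 : (0 < n)%N by near: n; exact: nbhs_infty_gt.
have -> : (- a)%:E + eta%:E = (- (a - eta))%:E by rewrite -EFinD; congr _%:E; ring.
rewrite log_le_inv ?r_gt0//.
have hC : p n <= (C * expR (- (r n * (a - eta / 2))))%:E by near: n.
apply: le_trans hC _; rewrite lee_fin.
have -> : (- (r n * (a - eta)) = r n * (eta / 2) + - (r n * (a - eta / 2)))%R by field.
by rewrite expRD ler_wpM2r ?expR_ge0//; near: n.
Unshelve. all: by end_near. Qed.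

Lemma limn_einf_of_exp_bound (a : R) :
  (forall eta, (0 < eta)%R -> exists2 C : R, (0 < C)%R &
     \forall n \near \oo, (C * expR (- (r n * (a + eta))))%:E <= p n) ->
  (- a)%:E <= limn_einf (fun n => (r n)^-1%:E * lne (p n)).
Proof.
move=> H; apply/lee_subgt0Pr => eta eta0.
have e20 : (0 < eta / 2)%R by lra.
have [C C0 HC] := H _ e20; have HE := near_le_expR C^-1 _ e20.
apply: limn_einf_ge_near; near=> n.
have n0 : (0 < n)%N by near: n; exact: nbhs_infty_gt.
have -> : (- a)%:E - eta%:E = (- (a + eta))%:E by rewrite -EFinB; congr _%:E; ring.
rewrite log_ge_inv ?r_gt0//.
have hC : (C * expR (- (r n * (a + eta / 2))))%:E <= p n by near: n.
apply: le_trans hC; rewrite lee_fin.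
have hE : (C^-1 <= expR (r n * (eta / 2)))%R by near: n.
have -> : (- (r n * (a + eta)) = - (r n * (eta / 2)) + - (r n * (a + eta / 2)))%R by field.
rewrite expRD ler_wpM2r ?expR_ge0// expRN -[X in (_ <= X)%R]invrK lef_pV2 ?posrE ?expR_gt0//.
by rewrite invr_gt0.
Unshelve. all: by end_near. Qed.

End logarithmic_limits.

(** * Bounds for the rescaled process, and the theorem *)

Section process_estimates.
Context {R : realType}.

(** In a cell with at most one jump every value is taken at one of the two ends, so the grid
    controls the whole path up to the oscillation of [gamma] over one mesh. *)
Lemma grid_tube (gamma x : skorohod R) (b m e : R) N T : nice N T.+1 x ->
  (forall k, (k <= T.+1 * 2 ^ N)%N -> `|b * (x (grid N k) - m) - gamma (grid N k)| <= e) ->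
  (forall s t, 0 <= s -> s <= t -> t <= T.+1%:R -> t - s <= 2 ^- N -> `|gamma t - gamma s| <= e) ->
  tube T%:R (e + e) gamma (rescale b m x).
Proof.
move=> nx Hg Hm t /andP[t0 tT].
have tT' : t < T.+1%:R by apply: le_lt_trans tT _; rewrite ltr_nat.
have [k [kL k1 k2 xk]] := nice_grid x N T.+1 t nx t0 tT'.
have kS : grid N k.+1 <= T.+1%:R :> R.
  by rewrite /grid ler_pdivrMr ?exprn_gt0// -natrX -natrM ler_nat.
have kh := gridS (R := R) N k.
case: xk => xk; rewrite /rescale/= xk.
  set u := grid N k in k1 k2 kS xk kh *.
  have -> : b * (x u - m) - gamma t = (b * (x u - m) - gamma u) - (gamma t - gamma u) by ring.
  apply: le_trans (ler_normB _ _) _; apply: lerD; first exact: Hg (ltnW kL).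
  by apply: Hm => //; [exact: grid_ge0|exact: ltW|lra].
set u := grid N k.+1 in k2 kS xk kh *.
have -> : b * (x u - m) - gamma t = (b * (x u - m) - gamma u) + (gamma u - gamma t) by ring.
apply: le_trans (ler_normD _ _) _; apply: lerD; first exact: Hg kL.
by apply: Hm => //; [exact: ltW|lra].
Qed.

Lemma path_of_skeleton {dd : measure_display} {Omega : measurableType dd} n
    (X : Omega -> skorohod R) (b m h : R) w N k : (0 < n)%N ->
  (forall w t, 0 <= t -> E_ n (X w t)) -> 0 <= h -> (k <= N)%N ->
  path_of (fun x : 'I_n.+1 => b * (magn x - m)) (state_of n (X w 0)) (skeleton n X h 0 N w) k =
  b * (X w (k%:R * h) - m).
Proof.
move=> n0 EX h0 kN; rewrite /path_of nth_skeleton// magnK//.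
by apply: EX; rewrite mulr_ge0.
Qed.

Context (beta m : R) (Gm : G2 beta m = 0).
Context (d : nat -> measure_display) (Omega : forall n, measurableType (d n)).
Context (P : forall n, probability (Omega n) R) (mn : forall n, Omega n -> skorohod R).
Context (hmn : forall n, (0 < n)%N -> markov_process (P n) n (CW_generator beta n) (mn n)).
Context (b : nat -> R) (hb : forall n, (0 < n)%N -> 0 < b n).
Context (hb_infty : b n @[n --> \oo] --> +oo).
Context (hb_sqr : b n ^+ 2 / n%:R @[n --> \oo] --> (0 : R)).
Context (I0 : R -> \bar R).
Context (hI0 : LDP P (fun n w => b n * (mn n w 0 - m)) (fun n => n%:R / b n ^+ 2) I0).
Local Notation r := (fun n : nat => n%:R / b n ^+ 2).
Local Notation kappa := (2 * derive1 (G2 beta) m).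
Local Notation s2 := (4 * G1 beta m).
Local Notation rate := (path_rate I0 (ou_lagrangian kappa s2)).

Let s2_gt0 : 0 < s2.
Proof. by have [_ _ h] := G2_root_bound beta m Gm; rewrite mulr_gt0. Qed.

Let I0_good : good_rate_function I0. Proof. by case: hI0. Qed.

Lemma speed_gt0 n : (0 < n)%N -> 0 < n%:R / b n ^+ 2.
Proof. by move=> n0; rewrite divr_gt0 ?exprn_gt0 ?hb ?ltr0n. Qed.

Lemma speed_infty : r n @[n --> \oo] --> +oo.
Proof.
apply/cvgryPge => A; have A0 : 0 < Num.max A 1 by rewrite lt_max ltr01 orbT.
have A1 : 0 < (Num.max A 1)^-1 by rewrite invr_gt0.
have := @cvgr0_norm_lt _ _ _ _ _ _ hb_sqr _ A1.
move=> H; near=> n.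
have n0 : (0 < n)%N by near: n; exact: nbhs_infty_gt.
have b0 := hb n n0; have nR : 0 < n%:R :> R by rewrite ltr0n.
have : `|b n ^+ 2 / n%:R| < (Num.max A 1)^-1 by near: n; exact: H.
rewrite gtr0_norm ?divr_gt0 ?exprn_gt0// -ltf_pV2 ?posrE ?invr_gt0 ?divr_gt0 ?exprn_gt0//.
rewrite invrK invf_div => /ltW; apply: le_trans.
by rewrite le_max lexx.
Unshelve. all: by end_near. Qed.

Lemma measurable_path_event n (A : set (skorohod R)) : (0 < n)%N -> open A ->
  measurable ((fun w => rescale (b n) m (mn n w)) @^-1` A).
Proof.
move=> n0 oA; have [mX EX _] := hmn n n0.
exact: (measurable_open_preimage n (mn n) n0 mX EX).
Qed.

Lemma initial_upper (F : set R) (a eta : R) : 0 < eta -> closed F ->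
  (forall y, F y -> (a%:E <= I0 y)%E) ->
  \forall n \near \oo, (P n [set w | F (b n * (mn n w 0%R - m))%R] <=
    (expR (- (n%:R / b n ^+ 2 * (a - eta))))%:E)%E.
Proof.
move=> eta0 cF HF; have [_ _ up _] := hI0.
apply: (exp_bound_of_limn_esup r speed_gt0 (fun n => P n [set w | F (b n * (mn n w 0%R - m))%R])) => //.
apply: le_trans (up F cF) _; rewrite EFinN leeN2.
by apply: le_ereal_inf_tmp => _ [y Fy <-]; exact: HF.
Qed.

Lemma initial_lower (U : set R) (x eta i0 : R) : 0 < eta -> open U -> U x -> I0 x = i0%:E ->
  \forall n \near \oo, ((expR (- (n%:R / b n ^+ 2 * (i0 + eta))))%:E <=
    P n [set w | U (b n * (mn n w 0%R - m))%R])%E.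
Proof.
move=> eta0 oU Ux Ix; have [_ _ _ lo] := hI0.
apply: (exp_bound_of_limn_einf r speed_gt0 (fun n => P n [set w | U (b n * (mn n w 0%R - m))%R])) => //.
apply: le_trans (lo U oU); rewrite EFinN leeN2 -Ix.
by apply: ereal_inf_lbound; exists x.
Qed.

(** The initial value is sliced by the levels of [I0] in steps of [eta]. Being away from the level
    [i * eta] has exponent [i * eta - eta]; starting near the level [(i + 1) * eta] leaves
    [c - (i + 1) * eta - eta] for the path. The sum is [c - 3 * eta] in every slice. *)
Lemma path_upper (A : set (skorohod R)) (c eta : R) : closed A -> 0 <= c -> 0 < eta ->
  (forall gamma, rate_level kappa s2 I0 c gamma -> ~ A gamma) ->
  exists C : R, \forall n \near \oo,
    (P n ((fun w => rescale (b n) m (mn n w)) @^-1` A) <=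
      (C * expR (- (n%:R / b n ^+ 2 * (c - 3 * eta))))%:E)%E.
Proof.
move=> cA c0 eta0 dA.
have [T [e e0 sep]] := closed_separation kappa s2 s2_gt0 I0 I0_good A c c0 cA dA.
have e20 : 0 < e / 2 by lra.
have T0 : 0 <= T.+1%:R :> R by [].
have [theta theta0 Hth] := level_modulus kappa s2 s2_gt0 I0 I0_good c T.+1%:R (e / 2) c0 T0 e20.
(* Beyond slice [L] the initial cost alone exceeds the required exponent. *)
pose L := (Num.truncn (c / eta)).+1.
have cL : c <= L%:R * eta by rewrite -ler_pdivrMr// ltW// truncnS_gt.
have L0 : 0 <= L%:R * eta by rewrite mulr_ge0// ltW.
have [r0 r00 Hr0] := initial_level_bounded I0 I0_good (L%:R * eta) L0.
have R00 : 0 <= r0 + 1 by rewrite addr_ge0.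
have [e1 [B [C [e10 B0 C0 Hchain]]]] :=
  chain_upper beta m Gm I0 I0_good c (e / 2) eta (r0 + 1) T.+1 c0 e20 eta0 R00.
pose e' := Num.min e1 1.
have e'0 : 0 < e' by rewrite lt_min e10 ltr01.
pose F (i : nat) : set R := [set y | forall x, (I0 x <= (i%:R * eta)%:E)%E -> e' <= `|y - x|].
have cF i : closed (F i).
  rewrite (_ : F i = \bigcap_(x in [set x | (I0 x <= (i%:R * eta)%:E)%E]) [set y | e' <= `|y - x|]).
    apply: closed_bigI => x _.
    rewrite (_ : [set y | _] = (fun y => `|y - x|) @^-1` [set z | e' <= z])//.
    apply: closed_comp; last exact: closed_ge.
    move=> y _; apply: cvg_norm; apply: cvgB; [exact: cvg_id|exact: cvg_cst].
  by apply/seteqP; split.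
have inF i y : F i y -> ((i%:R * eta)%:E <= I0 y)%E.
  move=> Fy; rewrite leNgt; apply/negP => /ltW /Fy.
  by rewrite subrr normr0 leNgt e'0.
(* One [C] per slice, one unit for starts beyond the last slice and one for paths that are not
   nice. *)
exists (C * L.+1%:R + 2).
have HF : \forall n \near \oo, forall i : 'I_L.+1,
    (P n [set w | F i (b n * (mn n w 0%R - m))%R] <=
      (expR (- (n%:R / b n ^+ 2 * (i%:R * eta - eta))))%:E)%E.
  exact: (filter_forall eventually_filter (fun i : 'I_L.+1 => initial_upper (F i) (i%:R * eta) eta eta0 (cF i) (inF i))).
have HB : \forall n \near \oo, B <= b n by move/cvgryPge : hb_infty; apply.
near=> n.
have n0 : (0 < n)%N by near: n; exact: nbhs_infty_gt.
have Bb : B <= b n by near: n; exact: HB.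
have Hi : forall i : 'I_L.+1, (P n [set w | F i (b n * (mn n w 0%R - m))%R] <=
      (expR (- (n%:R / b n ^+ 2 * (i%:R * eta - eta))))%:E)%E by near: n; exact: HF.
have b0 := hb n n0.
have rn0 := speed_gt0 n n0.
set rn := n%:R / b n ^+ 2 in Hi rn0 *.
have [mX EX [p [tp gen mk]]] := hmn n n0.
have HN := Hchain (b n) n p Bb n0 tp gen.
(* For this fixed [n] the mesh is refined until paths that are not nice have probability at most the
   bound aimed at. *)
pose E0 := expR (- (rn * (c - 3 * eta))).
have E00 : 0 < E0 by exact: expR_gt0.
have HN2 := nice_probability (P n) n (mn n) n0 mX EX T.+1 E0 E00.
have HN3 := half_exp_lt theta theta0.
have HN23 : \forall N \near \oo,
    (P n (~` [set w | nice N T.+1 (mn n w)]) <= E0%:E)%E /\ 2 ^- N < theta.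
  by apply: filterS2 HN2 HN3.
have /filter_ex[N [hN [hnice hth]]] := @filterI _ _ eventually_filter _ _ HN HN23.
have h0 : 0 < 2 ^- N :> R by rewrite invr_gt0 exprn_gt0.
pose V (i : nat) : set R := [set v | ~ F i (b n * (v - m))].
pose W (i : nat) : set R := [set v | F i (b n * (v - m))].
have mW i : measurable (W i).
  have mf : measurable_fun setT (fun v : R => b n * (v - m)).
    by apply: measurable_funM => //; apply: measurable_funB.
  rewrite -[X in measurable X]setTI; apply: mf => //.
  exact: closed_measurable.
have mV i : measurable (V i) by apply: measurableC; exact: mW.
pose Y (x : 'I_n.+1) := b n * (magn x - m).
pose S (x : 'I_n.+1) (s : seq 'I_n.+1) := ~ exists gamma, rate_level kappa s2 I0 c gamma /\
          forall k, (k <= T.+1 * 2 ^ N)%N ->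
            `|path_of Y x s k - gamma (k%:R * 2 ^- N)| <= e / 2.
pose kernel := fun x y : 'I_n.+1 => p (2 ^- N) (magn x) (magn y).
have chain i x : (i <= L)%N -> V i (magn x) ->
    mass (fun=> kernel) (T.+1 * 2 ^ N) 0 (S x) x <= C * expR (- (rn * (c - i%:R * eta - eta))).
  move=> iL /existsNP[x0 /not_implyP[Ix0 /negP]]; rewrite -ltNge => xx0.
  have Ix0L : (I0 x0 <= (L%:R * eta)%:E)%E.
    by apply: le_trans Ix0 _; rewrite lee_fin ler_wpM2r ?ler_nat// ltW.
  have x01 : `|Y x - x0| <= 1 by apply: le_trans (ltW xx0) _; rewrite ge_min lexx orbT.
  have xe1 : `|Y x - x0| <= e1 by apply: le_trans (ltW xx0) _; rewrite ge_min lexx.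
  apply: hN Ix0 => //.
  have -> : b n * (magn x - m) = x0 + (Y x - x0) by rewrite /Y; ring.
  by apply: le_trans (ler_normD _ _) _; apply: lerD => //; exact: Hr0.
pose SE (U : set R) := skeleton_event n (mn n) (2 ^- N) U S (T.+1 * 2 ^ N).
have mSE U : measurable U -> measurable (SE U) by move=> mU; exact: measurable_skeleton_event.
have sle := skeleton_le (P n) n (mn n) n0 mX EX p mk (2 ^- N) (ltW h0).
have PV i : (i <= L)%N -> (P n (SE (V i)) <= (C * i.+1%:R * E0)%:E)%E.
  elim: i => [|i IH] iL.
    have c1 : 0 <= C * expR (- (rn * (c - 0%:R * eta - eta))) by rewrite mulr_ge0// expR_ge0.
    apply: le_trans (sle (V 0%N) S _ _ (mV 0%N) c1 (fun x => chain 0%N x iL)) _.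
    apply: (@le_trans _ _ (1 * (C * expR (- (rn * (c - 0%:R * eta - eta))))%:E)%E).
      by apply: lee_wpmul2r; [rewrite lee_fin|apply: probability_le1; apply: measurable_initial => //].
    rewrite mul1e lee_fin mulr1 ler_wpM2l// ler_expR lerN2 ler_pM2l//; lra.
  have sub : SE (V i.+1) `<=` SE (V i) `|` SE (V i.+1 `&` W i).
    move=> w [Vw Sw]; have [Fw|Fw] := pselect (F i (b n * (mn n w 0 - m))).
      by right; split.
    by left; split.
  have mVW : measurable (V i.+1 `&` W i) by exact: measurableI.
  apply: (@le_trans _ _ (P n (SE (V i) `|` SE (V i.+1 `&` W i)))).
    apply: le_measure => //; rewrite inE; first exact: mSE.
    by apply: measurableU; exact: mSE.
  apply: le_trans (measureU2 _ (mSE _ (mV i)) (mSE _ mVW)) _.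
  rewrite -natr1 mulrDr mulr1 mulrDl EFinD; apply: leeD; first exact: IH (ltnW iL).
  have c1 : 0 <= C * expR (- (rn * (c - i.+1%:R * eta - eta))) by rewrite mulr_ge0// expR_ge0.
  apply: le_trans (sle (V i.+1 `&` W i) S _ _ mVW c1 (fun x Vx => chain i.+1 x iL (proj1 Vx))) _.
  apply: (@le_trans _ _ ((expR (- (rn * (i%:R * eta - eta))))%:E *
      (C * expR (- (rn * (c - i.+1%:R * eta - eta))))%:E)%E).
    apply: lee_wpmul2r; first by rewrite lee_fin.
    have iL' : (i < L.+1)%N by apply: ltnW.
    apply: le_trans (Hi (Ordinal iL')).
    apply: le_measure; rewrite ?inE; [exact: measurable_initial|exact: (measurable_initial (mn n) mX _ (mW i))|].
    by move=> w [].
  rewrite -EFinM lee_fin mulrCA -expRD ler_wpM2l// ler_expR -opprD -mulrDr lerN2 ler_pM2l//.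
  by rewrite -natr1; lra.
pose bad := ~` [set w | nice N T.+1 (mn n w)].
have mbad : measurable bad by apply: measurableC; exact: (measurable_nice n (mn n) n0 mX EX).
have mFL := measurable_initial (mn n) mX _ (mW L).
have sub : (fun w => rescale (b n) m (mn n w)) @^-1` A `<=`
    (bad `|` SE (V L)) `|` [set w | W L (mn n w 0)].
  move=> w Aw; have [nw|nw] := pselect (nice N T.+1 (mn n w)); last by left; left.
  have [Fw|Fw] := pselect (W L (mn n w 0)); first by right.
  left; right; split => // -[gamma [lg Hg]].
  apply: (sep gamma _ lg Aw); rewrite (splitr e); apply: (grid_tube _ _ _ _ _ N) => // [k kL|s t s0 st tT ts].
    by have := Hg k kL; rewrite path_of_skeleton// ltW.
  by have [] := Hth gamma s t lg s0 st tT (le_trans ts (ltW hth)).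
have mA : measurable ((fun w => rescale (b n) m (mn n w)) @^-1` A).
  rewrite -[A]setCK -preimage_setC; apply: measurableC.
  by apply: measurable_path_event => //; exact: closed_openC.
apply: (@le_trans _ _ (P n ((bad `|` SE (V L)) `|` [set w | W L (mn n w 0)]))).
  apply: le_measure => //; rewrite inE//.
  by apply: measurableU => //; apply: measurableU => //; exact: mSE.
apply: le_trans (measureU2 _ (measurableU _ _ mbad (mSE _ (mV L))) mFL) _.
have -> : (C * L.+1%:R + 2) * expR (- (rn * (c - 3 * eta))) = (E0 + C * L.+1%:R * E0) + E0.
  by rewrite -/E0; ring.
rewrite !EFinD; apply: leeD.
  by apply: le_trans (measureU2 _ mbad (mSE _ (mV L))) _; apply: leeD => //; exact: PV.
apply: le_trans (Hi ord_max) _; rewrite lee_fin ler_expR lerN2 ler_pM2l//=; lra.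
Unshelve. all: by end_near. Qed.

(** The exponent [i0 + eta] of starting near [gamma 0] and the exponent [c - i0 + eta] of then
    following [gamma] add up to [c + 2 * eta]. *)
Lemma path_lower (U : set (skorohod R)) (gamma : skorohod R) (c eta : R) : open U -> U gamma ->
  0 < eta -> rate_level kappa s2 I0 c gamma ->
  \forall n \near \oo,
    ((4^-1 * expR (- (n%:R / b n ^+ 2 * (c + 2 * eta))))%:E <=
      P n ((fun w => rescale (b n) m (mn n w)) @^-1` U))%E.
Proof.
move=> oU Ug eta0 lg.
have I0_ge0 := proj1 I0_good.
have c0 : 0 <= c.
  by rewrite -lee_fin; apply: le_trans lg; exact: rate_ge0.
have Ig := rate_level_initial kappa s2 s2_gt0 I0 c gamma lg.
have [i0 Ii0] : exists i0, I0 (gamma 0) = i0%:E.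
  by move: Ig (I0_ge0 (gamma 0)); case: (I0 _) => // i0 _ _; exists i0.
have [T1 [e [e0 HT]]] := skorohod_open_tube U gamma oU Ug.
pose T := (Num.truncn T1).+1.
have T1T : T1 <= T%:R by rewrite ltW// truncnS_gt.
have e20 : 0 < e / 2 by lra.
have T0 : 0 <= T.+1%:R :> R by [].
have [theta theta0 Hth] := level_modulus kappa s2 s2_gt0 I0 I0_good c T.+1%:R (e / 2) c0 T0 e20.
have [e1 [B [r0 [e10 B0 Hchain]]]] :=
  chain_lower beta m Gm I0 I0_good c i0 (e / 2) eta T.+1 gamma e20 eta0 lg Ii0.
pose O : set R := [set y | `|y - gamma 0| < e1].
have oO : open O.
  rewrite (_ : O = (fun y => `|y - gamma 0|) @^-1` [set z | z < e1])//.
  apply: open_comp; last exact: open_lt.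
  by move=> y _; apply: cvg_norm; apply: cvgB; [exact: cvg_id|exact: cvg_cst].
have Og : O (gamma 0) by rewrite /O /= subrr normr0.
have HO := initial_lower O (gamma 0) eta i0 eta0 oO Og Ii0.
have HB : \forall n \near \oo, B <= b n by move/cvgryPge : hb_infty; apply.
have Hr : \forall n \near \oo, r0 <= n%:R / b n ^+ 2 by move/cvgryPge : speed_infty; apply.
near=> n.
have n0 : (0 < n)%N by near: n; exact: nbhs_infty_gt.
have Bb : B <= b n by near: n; exact: HB.
have rb : r0 <= n%:R / b n ^+ 2 by near: n; exact: Hr.
have PO : ((expR (- (n%:R / b n ^+ 2 * (i0 + eta))))%:E <=
    P n [set w | O (b n * (mn n w 0%R - m))%R])%E by near: n; exact: HO.
have b0 := hb n n0.
have rn0 := speed_gt0 n n0.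
have [mX EX [p [tp gen mk]]] := hmn n n0.
have HN := Hchain (b n) n p Bb n0 rb tp gen.
set rn := n%:R / b n ^+ 2 in PO rn0 HN *.
(* Half of the factor 1/2 from [chain_lower]; the other half absorbs the probability that the path
   is not nice. *)
pose E0 := 4^-1 * expR (- (rn * (c + 2 * eta))).
have E00 : 0 < E0 by rewrite mulr_gt0 ?expR_gt0.
have HN2 := nice_probability (P n) n (mn n) n0 mX EX T.+1 E0 E00.
have HN3 := half_exp_lt theta theta0.
have HN23 : \forall N \near \oo,
    (P n (~` [set w | nice N T.+1 (mn n w)]) <= E0%:E)%E /\ 2 ^- N < theta.
  by apply: filterS2 HN2 HN3.
have /filter_ex[N [hN [hnice hth]]] := @filterI _ _ eventually_filter _ _ HN HN23.
have h0 : 0 < 2 ^- N :> R by rewrite invr_gt0 exprn_gt0.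
pose V : set R := [set v | O (b n * (v - m))].
have mV : measurable V.
  have mf : measurable_fun setT (fun v : R => b n * (v - m)).
    by apply: measurable_funM => //; apply: measurable_funB.
  rewrite -[X in measurable X]setTI; apply: mf => //.
  exact: open_measurable.
pose Y (x : 'I_n.+1) := b n * (magn x - m).
pose S (x : 'I_n.+1) (s : seq 'I_n.+1) := forall k, (k <= T.+1 * 2 ^ N)%N ->
            `|path_of Y x s k - gamma (k%:R * 2 ^- N)| <= e / 2.
pose SE := skeleton_event n (mn n) (2 ^- N) V S (T.+1 * 2 ^ N).
have mSE : measurable SE by exact: (measurable_skeleton_event n (mn n) n0 mX EX _ (ltW h0)).
have c1 : 0 <= expR (- (rn * (c - i0 + eta))) / 2 by rewrite divr_ge0// expR_ge0.
have sge := skeleton_ge (P n) n (mn n) n0 mX EX p mk (2 ^- N) (ltW h0) V S (T.+1 * 2 ^ N) _ mV c1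
  (fun x Vx => hN x (ltW Vx)).
have PSE : ((E0 + E0)%:E <= P n SE)%E.
  apply: le_trans sge.
  apply: (@le_trans _ _ ((expR (- (rn * (i0 + eta))))%:E * (expR (- (rn * (c - i0 + eta))) / 2)%:E)%E).
    rewrite -EFinM lee_fin mulrA -expRD.
    have -> : - (rn * (i0 + eta)) - rn * (c - i0 + eta) = - (rn * (c + 2 * eta)) by ring.
    by rewrite /E0; lra.
  by apply: lee_wpmul2r; [rewrite lee_fin|exact: PO].
pose bad := ~` [set w | nice N T.+1 (mn n w)].
have mbad : measurable bad.
  by apply: measurableC; exact: (measurable_nice n (mn n) n0 mX EX).
have mU := measurable_path_event n U n0 oU.
have sub : SE `<=` (fun w => rescale (b n) m (mn n w)) @^-1` U `|` bad.
  move=> w [Vw Sw]; have [nw|nw] := pselect (nice N T.+1 (mn n w)); last by right.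
  left; apply: HT => t /andP[t0 tT].
  have tT' : 0 <= t <= T%:R by rewrite t0 (le_trans tT).
  move: t tT' {t0 tT}; rewrite (splitr e); apply: (grid_tube _ _ _ _ _ N) => // [k kL|s t s0 st tT ts].
    by have := Sw k kL; rewrite path_of_skeleton// ltW.
  by have [] := Hth gamma s t lg s0 st tT (le_trans ts (ltW hth)).
have le1 : ((E0 + E0)%:E <= P n ((fun w => rescale (b n) m (mn n w)) @^-1` U) + E0%:E)%E.
  apply: le_trans PSE _; apply: (@le_trans _ _ (P n ((fun w => rescale (b n) m (mn n w)) @^-1` U `|` bad))).
    by apply: le_measure => //; rewrite inE//; exact: measurableU.
  by apply: le_trans (measureU2 _ mU mbad) _; apply: leeD.
move: le1; rewrite EFinD leeD2rE//.
Unshelve. all: by end_near. Qed.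

End process_estimates.

(** Reduces the upper bound to real levels below the infimum of the rate, also when that infimum is
    infinite. *)
Lemma le_oppe_of_real {R : realType} (x y : \bar R) : (0 <= y)%E ->
  (forall c : R, (c%:E < y)%E -> (x <= (- c)%:E)%E) -> (x <= - y)%E.
Proof.
case: y => [y| |] // y0 H.
  apply/lee_addgt0Pr => e e0; rewrite -EFinN -EFinD.
  have -> : - y + e = - (y - e) by ring.
  by apply: H; rewrite lte_fin gtrBl.
case: x H => [x| |] H //=.
- by exfalso; have := H (- x + 1)%R; rewrite ltry lee_fin => /(_ isT); lra.
- by have := H 0%R; rewrite ltry => /(_ isT).
Qed.

Theorem theorem2p5 (R : realType) (beta : R) (hbeta : 1 < beta)
    (d : nat -> measure_display) (Omega : forall n, measurableType (d n))
    (P : forall n, probability (Omega n) R)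
    (mn : forall n, Omega n -> skorohod R)
    (hmn : forall n, (0 < n)%N ->
      markov_process (P n) n (CW_generator beta n) (mn n))
    (m : R) (hm : G2 beta m = 0) (hm0 : m != 0)
    (b : nat -> R) (hb : forall n, (0 < n)%N -> 0 < b n)
    (hb_infty : b n @[n --> \oo] --> +oo)
    (hb_sqr : b n ^+ 2 / n%:R @[n --> \oo] --> (0 : R))
    (I0 : R -> \bar R)
    (hI0 : LDP P (fun n w => b n * (mn n w 0 - m))
             (fun n => n%:R / b n ^+ 2) I0) :
  LDP P (fun n w => rescale (b n) m (mn n w))
    (fun n => n%:R / b n ^+ 2)
    (path_rate I0 (CW_lagrangian beta m)).
Proof.
have [_ _ G10] := G2_root_bound beta m hm.
have s2_gt0 : 0 < 4 * G1 beta m by rewrite mulr_gt0.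
have LE : CW_lagrangian beta m = ou_lagrangian (2 * derive1 (G2 beta) m) (4 * G1 beta m).
  apply/funext => x; apply/funext => v; rewrite /CW_lagrangian /ou_lagrangian.
  by congr (_ ^+ 2 / _); ring.
have I0_good : good_rate_function I0 by case: hI0.
have rate_good := path_rate_good (2 * derive1 (G2 beta) m) (4 * G1 beta m) s2_gt0 I0 I0_good.
have rate0 := proj1 rate_good.
have rpos := speed_gt0 b hb; have rinf := speed_infty b hb hb_sqr.
rewrite LE; split.
- by move=> n U n0; exact: (measurable_path_event beta m d Omega P mn hmn b).
- exact: rate_good.
- move=> A cA; pose p n := P n ((fun w => rescale (b n) m (mn n w)) @^-1` A).
  have p0 n : (0 <= p n)%E by exact: measure_ge0.
  apply: le_oppe_of_real.
    by apply: le_ereal_inf_tmp => _ [gamma _ <-]; exact: rate0.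
  move=> c cA'; apply: (limn_esup_of_exp_bound _ rpos rinf p p0) => eta eta0.
  (* For a negative level the exponential is at least 1, and any probability is below it. *)
  have [c0|c0] := ltP c 0.
    exists 1; near=> n.
    have n0 : (0 < n)%N by near: n; exact: nbhs_infty_gt.
    apply: (@le_trans _ _ 1%E).
      apply: probability_le1; rewrite -[A]setCK -preimage_setC; apply: measurableC.
      by apply: (measurable_path_event beta m d Omega P mn hmn b) => //; exact: closed_openC.
    rewrite mul1r lee_fin; apply: le_trans (expR_ge1Dx _); rewrite lerDl oppr_ge0.
    by rewrite (pmulr_rle0 _ (rpos n n0)); lra.
  have e30 : 0 < eta / 3 by rewrite divr_gt0.
  have dA gamma : rate_level (2 * derive1 (G2 beta) m) (4 * G1 beta m) I0 c gamma -> ~ A gamma.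
    move=> lg Ag; move: cA'; rewrite ltNge => /negP; apply.
    by apply: le_trans lg; apply: ereal_inf_lbound; exists gamma.
  have [C HC] := path_upper beta m hm d Omega P mn hmn b hb hb_infty I0 hI0 A c (eta / 3) cA c0 e30 dA.
  exists C; move: HC; rewrite (_ : 3 * (eta / 3) = eta)//; by field.
move=> U oU; pose p n := P n ((fun w => rescale (b n) m (mn n w)) @^-1` U).
have p0 n : (0 <= p n)%E by exact: measure_ge0.
rewrite leeNl; apply: le_ereal_inf_tmp => _ [gamma Ug <-].
have := rate0 gamma; case E : (path_rate _ _ gamma) => [c| |] // _; last by rewrite leey.
rewrite leeNl -EFinN; apply: (limn_einf_of_exp_bound _ rpos rinf p p0) => eta eta0.
have e20 : 0 < eta / 2 by rewrite divr_gt0.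
exists 4^-1; first by [].
have lg : rate_level (2 * derive1 (G2 beta) m) (4 * G1 beta m) I0 c gamma.
  by rewrite /rate_level /= E.
have := path_lower beta m hm d Omega P mn hmn b hb hb_infty hb_sqr I0 hI0 U gamma c (eta / 2) oU Ug e20 lg.
by rewrite (_ : 2 * (eta / 2) = eta)//; field.
Unshelve. all: by end_near. Qed.
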